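(* Let $c>0$, $T>0$ and $\epsilon>0$ be fixed. Suppose that a pair $(\rho,z)$ with $\rho>c$ is a weak solution (in the sense given in the context) of $$\partial_t\rho+\operatorname{div}\big[\rho\nabla(\operatorname{div}z-\epsilon f'(\rho))\big]=0$$ with initial condition $\rho_0\in\mathcal P(\mathbb T)\cap L^\infty(\mathbb T)$, and that it satisfies the regularity assumptions $$\rho\in L^2((0,T);H^1(\mathbb T)),\qquad z\in L^2((0,T);H^2_{\operatorname{div}}(\mathbb T)).$$ Then for any $\alpha>c$, if $\rho_0\ge\alpha$ a.e., it follows that $\rho\ge\alpha$ a.e.
   Context: $\mathbb T=\mathbb T^d=\mathbb R^d/\mathbb Z^d$ is the flat torus, $d\ge1$. $\mathcal P(\mathbb T)$ is the set of Borel probability measures on $\mathbb T$, absolutely continuous measures being identified with their densities; $W_2$ is the quadratic Wasserstein distance. The function $f$ is $f(s)=\frac1{s-c}$ if $s>c$ and $f(s)=+\infty$ otherwise. Total variation: $J(\rho)=\sup\{\int_{\mathbb T}-\rho\operatorname{div}z:\ z\in C^\infty(\mathbb T,\mathbb R^d),\ \|z\|_\infty\le1\}$ for $\rho\in L^1(\mathbb T)$, and $BV(\mathbb T)=\{\rho\in L^1(\mathbb T):J(\rho)<\infty\}$. $H^1_{\operatorname{div}}(\mathbb T)=\{z\in L^2(\mathbb T,\mathbb R^d):\operatorname{div}z\in L^2(\mathbb T)\}$ and $H^2_{\operatorname{div}}(\mathbb T)=\{z\in L^2(\mathbb T,\mathbb R^d):\operatorname{div}z\in H^1(\mathbb T)\}$,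 with norms $\|z\|_{L^2}+\|\operatorname{div}z\|_{L^2}$ and $\|z\|_{L^2}+\|\operatorname{div}z\|_{H^1}$. $\mathcal A=\{(\rho,z):\rho\in BV(\mathbb T)\cap L^2(\mathbb T),\ z\in H^1_{\operatorname{div}}(\mathbb T),\ \|z\|_\infty\le1,\ J(\rho)\le-\int_{\mathbb T}\rho\operatorname{div}z\}$. Weak solution: $\rho\in L^\infty((0,T);BV(\mathbb T)\cap L^\infty(\mathbb T))\cap C^0([0,T];(\mathcal P(\mathbb T),W_2))$, $\rho>c$ a.e., $z\in L^\infty((0,T)\times\mathbb T;\mathbb R^d)$, $(\rho(t,\cdot),z(t,\cdot))\in\mathcal A$ for a.e. $t\in(0,T)$, $\operatorname{div}z-\epsilon f'(\rho)\in L^2((0,T);H^1(\mathbb T))$, and for every $u\in C_c^\infty([0,T)\times\mathbb T)$, $$\int_0^T\int_{\mathbb T}\big(\rho\,\partial_tu+\rho\nabla(\operatorname{div}z-\epsilon f'(\rho))\cdot\nabla u\big)\,dx\,dt=-\int_{\mathbb T}\rho_0(x)u(0,x)\,dx.$$ *)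

(* Defs.v *)
From HB Require Import structures.
From mathcomp Require Import all_boot all_order all_algebra.
From mathcomp Require Import all_classical all_reals all_analysis.

Set Implicit Arguments.
Unset Strict Implicit.
Unset Printing Implicit Defensive.

Import Order.TTheory GRing.Theory Num.Theory.
Import numFieldNormedType.Exports.

Local Open Scope classical_set_scope.
Local Open Scope ring_scope.

(* The product sigma-algebra on row vectors; on 'rV[R]_n with R : realType it
   is the Borel sigma-algebra. *)
Definition rV_display : measure_display -> measure_display.
Proof. exact. Qed.

Section measurable_rV.
Context {d} {T : sigmaRingType d}.
Variable n : nat.

Let coors : 'I_n -> 'rV[T]_n -> T := fun i x => x ord0 i.

Let rV_set0 : g_sigma_preimage coors set0.
Proof. exact: sigma_algebra0. Qed.

Let rV_setC A : g_sigma_preimage coors A -> g_sigma_preimage coors (~` A).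
Proof. exact: sigma_algebraC. Qed.

Let rV_bigcup (F : _^nat) : (forall i, g_sigma_preimage coors (F i)) ->
  g_sigma_preimage coors (\bigcup_i (F i)).
Proof. exact: sigma_algebra_bigcup. Qed.

HB.instance Definition _ := @isMeasurable.Build (rV_display d)
  'rV[T]_n (g_sigma_preimage coors) rV_set0 rV_setC rV_bigcup.

End measurable_rV.

Lemma measurable_rV_coord d (T : sigmaRingType d) n (i : 'I_n) :
  measurable_fun [set: 'rV[T]_n] (fun x : 'rV[T]_n => x ord0 i).
Proof.
move=> _ Y mY; rewrite setTI; apply: sub_sigma_algebra => /=.
rewrite -bigcup_seq/=; exists i => /=; first by rewrite mem_index_enum.
by exists Y => //; rewrite setTI.
Qed.

Lemma measurable_fun_rVP d1 d2 (T1 : measurableType d1) (T2 : measurableType d2)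
    n (f : T1 -> 'rV[T2]_n) :
  (forall i, measurable_fun [set: T1] (fun t => f t ord0 i)) ->
  measurable_fun [set: T1] f.
Proof.
move=> mf _ A mA; rewrite setTI.
suff : measurable `<=` [set B : set 'rV[T2]_n | measurable (f @^-1` B)].
  by apply.
apply: smallest_sub.
  split => [|B /= mB|F mF] /=.
  - by rewrite preimage_set0.
  - by rewrite setTD preimage_setC; exact: measurableC.
  - by rewrite preimage_bigcup; by apply: bigcupT_measurable => k; exact: mF.
rewrite -bigcup_seq; apply: bigcup_sub => i _ B /= [C mC <-].
by have := mf i measurableT C mC; rewrite !setTI.
Qed.


(* Functions on the torus T^d = R^d / Z^d.  Smooth functions on T^d are smooth
   Z^d-periodic functions on 'rV[R]_d.  For measure theory T^d is identified
   with its fundamental domain, a cube of side one: a measurable function on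
   T^d is a measurable function on 'rV[R]_d, of which only the values on the
   unit cube matter, since [torus_measure] is carried by that cube. *)

Section torus_measure.
Context {R : realType}.

Definition rV_cons n (p : measurableTypeR R * 'rV[R]_n) : 'rV[R]_n.+1 := row_mx (p.1 : R)%:M p.2.

Lemma measurable_rV_cons n :
  measurable_fun [set: measurableTypeR R * 'rV[R]_n] (@rV_cons n).
Proof.
apply: measurable_fun_rVP => i; rewrite -[n.+1]/(1 + n)%N in i *.
case: (split_ordP i) => j ->.
- rewrite (_ : (fun _ => _) = fst); first exact: measurable_fst.
  by apply/funext => p; rewrite /rV_cons row_mxEl mxE !ord1 eqxx mulr1n.
- rewrite (_ : (fun _ => _) = (fun x : 'rV[R]_n => x ord0 j) \o snd).
    exact: measurableT_comp (measurable_rV_coord j) measurable_snd.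
  by apply/funext => p; rewrite /rV_cons row_mxEr.
Qed.

HB.instance Definition _ n := isMeasurableFun.Build _ _ _ _ (@rV_cons n)
  (@measurable_rV_cons n).

(* d-fold product of the Lebesgue measure on [0, 1] *)
Fixpoint torus_measure (d : nat) : probability 'rV[R]_d R :=
  match d with
  | 0 => dirac (0 : 'rV[R]_0)
  | n.+1 => distribution (uniform_prob (@ltr01 R) \x torus_measure n)%E
                         (@rV_cons n)
  end.

Definition time_measure (T : R) : set (measurableTypeR R) -> \bar R :=
  mrestr lebesgue_measure (measurable_itv `]0, T[).

HB.instance Definition _ T := Measure.on (time_measure T).

Lemma time_measure_finite T : fin_num_fun (time_measure T).
Proof.
apply: lty_fin_num_fun => /=; rewrite /time_measure /mrestr setTI.
by rewrite lebesgue_measure_itv /=; case: ifP => _; rewrite ?ltry.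
Qed.

HB.instance Definition _ T := Measure_isFinite.Build _ _ _ (time_measure T)
  (time_measure_finite T).
End torus_measure.

Section torus_functions.
Context {R : realType} {d : nat}.
Implicit Types (x y : 'rV[R]_d) (phi rho g h : 'rV[R]_d -> R)
  (z G : 'rV[R]_d -> 'rV[R]_d).

Definition dot x y : R := \sum_(i < d) x ord0 i * y ord0 i.

(* Euclidean norm; the library norm on 'rV[R]_d is the sup norm *)
Definition enorm x : R := Num.sqrt (dot x x).

(* On a finite-dimensional V this is the usual notion of C^k function. *)
Fixpoint Ck (V : normedModType R) (k : nat) (u : V -> R) : Prop :=
  continuous u /\
  match k with
  | 0 => True
  | l.+1 => (forall (x v : V), derivable u x v) /\
            (forall v : V, Ck l (fun x : V => 'D_v u x))
  end.

Definition smooth (V : normedModType R) (u : V -> R) : Prop :=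
  forall k, Ck k u.

Definition Zd_periodic phi : Prop :=
  forall x (i : 'I_d), phi (x + delta_mx ord0 i) = phi x.

Definition torus_smooth phi : Prop := smooth phi /\ Zd_periodic phi.

Definition torus_vsmooth z : Prop :=
  forall i, torus_smooth (fun x => z x ord0 i).

Definition grad phi x : 'rV[R]_d := \row_i 'D_(delta_mx ord0 i) phi x.

Definition div z x : R :=
  \sum_(i < d) 'D_(delta_mx ord0 i) (fun y => z y ord0 i) x.

Local Notation mT := (torus_measure d).

Definition TV rho : \bar R :=
  ereal_sup [set (\int[mT]_x (- (rho x * div z x)))%:E | z in
    [set z | torus_vsmooth z /\ forall x, enorm (z x) <= 1]].

Definition BV : set ('rV[R]_d -> R) :=
  [set rho | rho \in Lfun mT 1%E /\ (TV rho < +oo)%E].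

Definition vLfun dp (X : measurableType dp) (mu : {measure set X -> \bar R})
    (p : \bar R) (w : X -> 'rV[R]_d) : Prop :=
  forall i, (fun a : X => w a ord0 i) \in Lfun mu p.

(* g belongs to H^1(T^d) and its weak gradient is G *)
Definition H1_grad g G : Prop :=
  [/\ g \in Lfun mT 2%:E, vLfun mT 2%:E G &
    forall phi, torus_smooth phi -> forall i,
      \int[mT]_x (g x * grad phi x ord0 i) =
      - \int[mT]_x (G x ord0 i * phi x)].

(* z belongs to H^1_div(T^d) and its weak divergence is h *)
Definition Hdiv_div z h : Prop :=
  [/\ vLfun mT 2%:E z, h \in Lfun mT 2%:E &
    forall phi, torus_smooth phi ->
      \int[mT]_x dot (z x) (grad phi x) = - \int[mT]_x (h x * phi x)].

Definition calA rho z : Prop :=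
  [/\ BV rho, rho \in Lfun mT 2%:E,
      (Lnorm mT +oo (EFin \o (enorm \o z)) <= 1)%E &
      exists2 h, Hdiv_div z h &
        (TV rho <= (- \int[mT]_x (rho x * h x))%:E)%E].

(* Borel probability measures on T^d are those carried by [0, 1)^d. *)
Definition on_torus (mu : probability 'rV[R]_d R) : Prop :=
  mu [set x | forall i, 0 <= x ord0 i < 1] = 1%E.

Definition torus_dist x y : R :=
  inf [set enorm (x - y + map_mx intr k) | k in [set: 'rV[int]_d]].

Definition coupling (mu nu : probability 'rV[R]_d R) :
    set (probability ('rV[R]_d * 'rV[R]_d)%type R) :=
  [set gam | forall B, measurable B ->
    gam (B `*` setT) = mu B /\ gam (setT `*` B) = nu B].

Definition W2 (mu nu : probability 'rV[R]_d R) : \bar R :=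
  (ereal_inf [set \int[gam]_p ((torus_dist p.1 p.2) ^+ 2)%:E
             | gam in coupling mu nu] `^ 2^-1)%E.

Definition W2_continuous (T : R) (mu : R -> probability 'rV[R]_d R) : Prop :=
  forall s, 0 <= s <= T -> forall e, 0 < e -> exists2 dl, 0 < dl &
  forall t, 0 <= t <= T -> `|t - s| < dl -> (W2 (mu s) (mu t) < e%:E)%E.

End torus_functions.

Section weak_solutions.
Context {R : realType} {d : nat}.
Implicit Types (T : R) (rho g h : R * 'rV[R]_d -> R)
  (z G : R * 'rV[R]_d -> 'rV[R]_d).

Local Notation mT := (torus_measure d).
Local Notation mQ T := (time_measure T \x torus_measure d)%E.

Definition slice (X : Type) (w : R * 'rV[R]_d -> X) (t : R) : 'rV[R]_d -> X :=
  fun x => w (t, x).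

(* g belongs to L^2((0,T);H^1(T^d)) and its weak space gradient is G *)
Definition L2H1_grad T g G : Prop :=
  [/\ g \in Lfun (mQ T) 2%:E, vLfun (mQ T) 2%:E G &
    \forall t \ae time_measure T, H1_grad (slice g t) (slice G t)].

Definition L2H1 T g : Prop := exists G, L2H1_grad T g G.

Definition L2H2div T z : Prop :=
  vLfun (mQ T) 2%:E z /\
  exists2 h, L2H1 T h &
    \forall t \ae time_measure T, Hdiv_div (slice z t) (slice h t).

Definition LinftyBVLinfty T rho : Prop :=
  measurable_fun [set: measurableTypeR R * 'rV[R]_d] rho /\
  exists M : R, \forall t \ae time_measure T,
    BV (slice rho t) /\
    (Lnorm mT 1 (EFin \o slice rho t) + TV (slice rho t)
     + Lnorm mT +oo (EFin \o slice rho t) <= M%:E)%E.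

(* rho belongs to C^0([0,T];(P(T^d),W_2)): it has a continuous representative,
   a curve of measures whose density is rho(t,.) for almost every t *)
Definition C0W2 T rho : Prop :=
  exists mu : R -> probability 'rV[R]_d R,
    [/\ forall t, 0 <= t <= T -> on_torus (mu t), W2_continuous T mu &
      \forall t \ae time_measure T, forall B, measurable B ->
        mu t B = (\int[mT]_(x in B) (rho (t, x))%:E)%E].

(* C_c^oo([0,T) x T^d), as restrictions to [0,T) of smooth functions of
   t : R vanishing near and after T *)
Definition test_function T (u : R * 'rV[R]_d -> R) : Prop :=
  [/\ smooth u, forall t, Zd_periodic (slice u t) &
    exists2 T', T' < T & forall t x, T' <= t -> u (t, x) = 0].

Definition potential (c s : R) : \bar R :=
  if c < s then ((s - c)^-1)%:E else +oo%E.

(* f', meaningful on the set s > c where f is finite *)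
Definition potential' (c : R) : R -> R := derive1 (fine \o potential c).

(* The L^2 function h is the divergence of z in space, and w is the gradient of
   div z - eps f'(rho). *)
Record weak_solution_with c T eps (rho0 : 'rV[R]_d -> R) rho z h w : Prop := {
  ws_bound : LinftyBVLinfty T rho ;
  ws_cont : C0W2 T rho ;
  ws_gtc : \forall p \ae mQ T, c < rho p ;
  ws_z : vLfun (mQ T) +oo%E z ;
  ws_calA : \forall t \ae time_measure T, calA (slice rho t) (slice z t) ;
  ws_div : \forall t \ae time_measure T, Hdiv_div (slice z t) (slice h t) ;
  ws_grad : L2H1_grad T (fun p => h p - eps * potential' c (rho p)) w ;
  ws_eq : forall u, test_function T u ->
    \int[time_measure T]_t \int[mT]_x
      (rho (t, x) * derive1 (fun s : R => u (s, x)) t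
       + rho (t, x) * dot (w (t, x)) (grad (slice u t) x)) =
    - \int[mT]_x (rho0 x * u (0, x)) }.

Definition weak_solution c T eps (rho0 : 'rV[R]_d -> R) rho z : Prop :=
  exists h w, weak_solution_with c T eps rho0 rho z h w.

Definition prob_density (rho0 : 'rV[R]_d -> R) : Prop :=
  [/\ measurable_fun setT rho0, \forall x \ae mT, 0 <= rho0 x &
    (\int[mT]_x (rho0 x)%:E)%E = 1%E].

End weak_solutions.

(* Main.v *)
Require Import Defs.
From HB Require Import structures.
From mathcomp Require Import all_boot all_order all_algebra.
From mathcomp Require Import all_classical all_reals all_analysis.
From mathcomp Require Import measurable_realfun ess_sup_inf.
From mathcomp Require Import ring lra zify.

Set Implicit Arguments.
Unset Strict Implicit.
Unset Printing Implicit Defensive.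

Import Order.TTheory GRing.Theory Num.Theory.
Import numFieldNormedType.Exports.

Local Open Scope classical_set_scope.
Local Open Scope ring_scope.

(* Let [S] be the convolution with a product of kernels proportional to
   [cos (pi s) ^ (2 n)]. The kernel is a nonnegative trigonometric polynomial of
   integral one, and [(x, y) |-> kernel (x - y)] is positive semidefinite; so [S]
   is a symmetric contraction of L^2, commutes with weak gradients, and tends to
   the identity as [n] tends to infinity.

   With [Phi s = ((alpha - s)^+)^3 / 6], [w = grad (div z - eps f'(rho))] and
   [flux' s = s (alpha - s)^+], testing the equation with the trigonometric
   polynomials that make up the kernel, using convexity of [Phi] along the
   resulting ordinary differential equations, and letting [n] tend to infinity,
   gives for almost every [t]
     [int Phi (rho t) <= int_0^t int w . flux'(rho) grad rho].
   The right-hand side is nonpositive. Put [P = div z - eps f'(rho)] and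
   [q = flux rho]. Then [int P q <= int P (S q)]: for the [f'] part because [f']
   and [flux] are both nondecreasing; for the [div z] part because
   [J rho <= - int rho div z] forces [z . grad rho = |grad rho|], so that
   [int q div z = - int |grad q| <= - int z . S (grad q) = int (S q) div z].
   Kernels of consecutive exponents differ by a multiple of a second derivative;
   so if [int w . grad q], the limit of [int w . S (grad q)], were positive, then
   [int P (S q)] would eventually increase strictly to [int P q] as the exponents
   are raised one at a time. *)

(** * Integrable and square-integrable functions *)

(** Formally the dissipation is the pairing of [grad P] with [grad q], and both gradients are only
    in L^2: there is no second derivative to integrate by parts with. Moreover [rho] may come
    arbitrarily close to [c], so [f'(rho)] may be unbounded and no chain rule is available for it.
    The zero-order quantity [int P (S q - q)] therefore stands in for the Dirichlet form: its sign
    needs only the monotonicity of [f'] and the duality between [z] and [rho], and raising the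
    exponents plays the role of a discrete heat flow. The powers of the cosine make all of this
    explicit: the kernel has finite rank, so mollifying the equation leaves finitely many scalar
    equations in time; the mean of [sin (pi (x i - y i)) ^ 2] is a rational number, which measures
    concentration and gives convergence in L^2. The cube in [Phi] is the smallest integer power for
    which [Phi''] and [flux'] are still locally Lipschitz, the regularity with which the chain rule
    is passed to the limit. *)

Section square_integrable.
Context d (T : measurableType d) (R : realType).
Variable mu : {finite_measure set T -> \bar R}.
Implicit Types (f g h : T -> R).

Definition intble f := mu.-integrable [set: T] (EFin \o f).

(** Integrability of [f ^ 2] says nothing about the sign of [f], so measurability of [f] is a
    separate condition. *)
Definition sqint f := measurable_fun setT f /\ intble (fun x => f x ^+ 2).

Lemma intble_meas f : intble f -> measurable_fun setT f.
Proof. by move=> /measurable_int /measurable_EFinP. Qed.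

Lemma intble_le f g : measurable_fun setT f -> (forall x, `|f x| <= g x) ->
  intble g -> intble f.
Proof.
move=> mf fg; apply: le_integrable => //; first exact/measurable_EFinP.
by move=> x _; rewrite lee_fin (le_trans (fg x))// ler_norm.
Qed.

Lemma intble_cst c : intble (fun=> c).
Proof. exact: (finite_measure_integrable_cst mu c measurableT). Qed.

Lemma intble_bdd M f : measurable_fun setT f -> (forall x, `|f x| <= M) ->
  intble f.
Proof. by move=> mf fM; apply: intble_le fM _ => //; exact: intble_cst. Qed.

Lemma intbleD f g : intble f -> intble g -> intble (fun x => f x + g x).
Proof. by move=> If Ig; exact: (integrableD measurableT If Ig). Qed.

Lemma intbleB f g : intble f -> intble g -> intble (fun x => f x - g x).
Proof. by move=> If Ig; exact: (integrableB measurableT If Ig). Qed.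

Lemma intbleZ c f : intble f -> intble (fun x => c * f x).
Proof. by move=> If; exact: (integrableZl measurableT c If). Qed.

Lemma intbleN f : intble f -> intble (fun x => - f x).
Proof. by move=> If; exact: (integrableN If). Qed.

Lemma intble_norm f : intble f -> intble (fun x => `|f x|).
Proof. by move=> If; exact: (integrable_norm If). Qed.

Lemma intble_sum I (s : seq I) (F : I -> T -> R) :
  (forall i, intble (F i)) -> intble (fun x => \sum_(i <- s) F i x).
Proof.
move=> IF; elim: s => [|i s ih].
  by under eq_fun do rewrite big_nil; exact: intble_cst.
by under eq_fun do rewrite big_cons; exact: intbleD.
Qed.

Lemma intble_bddM M f g : measurable_fun setT f -> (forall x, `|f x| <= M) ->
  intble g -> intble (fun x => f x * g x).
Proof.
move=> mf fM Ig; apply: (@intble_le _ (fun x => M * `|g x|)).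
- by apply: measurable_funM => //; exact: intble_meas.
- by move=> x; rewrite normrM ler_wpM2r.
- exact/intbleZ/intble_norm.
Qed.

Lemma sqint_meas f : sqint f -> measurable_fun setT f.
Proof. by case. Qed.

Lemma sqintM f g : sqint f -> sqint g -> intble (fun x => f x * g x).
Proof.
move=> [mf If] [mg Ig]; apply: (@intble_le _ (fun x => f x ^+ 2 + g x ^+ 2)).
- exact: measurable_funM.
- move=> x; rewrite ler_norml; apply/andP; split; nra.
- exact: intbleD.
Qed.

Lemma sqint_bdd M f : measurable_fun setT f -> (forall x, `|f x| <= M) ->
  sqint f.
Proof.
move=> mf fM; split=> //; apply: (@intble_bdd (M ^+ 2)).
  exact: measurable_funX.
by move=> x; rewrite normrX lerXn2r ?nnegrE// (le_trans _ (fM x)).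
Qed.

Lemma sqint_cst c : sqint (fun=> c).
Proof. exact: (@sqint_bdd `|c|). Qed.

Lemma sqint_intble f : sqint f -> intble f.
Proof.
move=> sf; have := sqintM sf (sqint_cst 1).
by under eq_fun do rewrite mulr1.
Qed.

Lemma sqintD f g : sqint f -> sqint g -> sqint (fun x => f x + g x).
Proof.
move=> sf sg; split.
  by apply: measurable_funD; exact: sqint_meas.
apply: (@eq_integrable _ _ _ _ _ measurableT
  (EFin \o (fun x => f x ^+ 2 + g x ^+ 2 + (2 * (f x * g x))))).
  by move=> x _ /=; congr (_%:E); ring.
apply: intbleD; first by apply: intbleD; [case: sf|case: sg].
exact/intbleZ/sqintM.
Qed.

Lemma sqint_bddM M f g : measurable_fun setT f -> (forall x, `|f x| <= M) ->
  sqint g -> sqint (fun x => f x * g x).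
Proof.
move=> mf fM [mg Ig]; split; first exact: measurable_funM.
under eq_fun do rewrite exprMn.
apply: (@intble_bddM (M ^+ 2)) => //; first exact: measurable_funX.
by move=> x; rewrite normrX lerXn2r ?nnegrE// (le_trans _ (fM x)).
Qed.

Lemma sqintZ c f : sqint f -> sqint (fun x => c * f x).
Proof. by apply: (@sqint_bddM `|c|) => //; exact: measurable_cst. Qed.

Lemma sqintN f : sqint f -> sqint (fun x => - f x).
Proof. by move=> /(sqintZ (-1)); under eq_fun do rewrite mulN1r. Qed.

Lemma sqintB f g : sqint f -> sqint g -> sqint (fun x => f x - g x).
Proof. by move=> sf /sqintN; exact: sqintD. Qed.

Lemma sqint_sum I (s : seq I) (F : I -> T -> R) :
  (forall i, sqint (F i)) -> sqint (fun x => \sum_(i <- s) F i x).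
Proof.
move=> IF; elim: s => [|i s ih].
  by under eq_fun do rewrite big_nil; exact: sqint_cst.
by under eq_fun do rewrite big_cons; exact: sqintD.
Qed.

Lemma sqint_le f g : measurable_fun setT f -> (forall x, `|f x| <= `|g x|) ->
  sqint g -> sqint f.
Proof.
move=> mf fg [mg Ig]; split=> //; apply: intble_le Ig.
  exact: measurable_funX.
by move=> x; rewrite normrX -[leRHS]real_normK ?num_real// lerXn2r ?nnegrE.
Qed.

Lemma eq_Rint f g : f =1 g -> \int[mu]_x f x = \int[mu]_x g x.
Proof. by move=> fg; apply: eq_Rintegral => x _. Qed.

Lemma RintD f g : intble f -> intble g ->
  \int[mu]_x (f x + g x) = \int[mu]_x f x + \int[mu]_x g x.
Proof. exact: RintegralD. Qed.

Lemma RintB f g : intble f -> intble g ->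
  \int[mu]_x (f x - g x) = \int[mu]_x f x - \int[mu]_x g x.
Proof. exact: RintegralB. Qed.

Lemma RintZ c f : intble f -> \int[mu]_x (c * f x) = c * \int[mu]_x f x.
Proof. exact: RintegralZl. Qed.

Lemma RintN f : intble f -> \int[mu]_x (- f x) = - \int[mu]_x f x.
Proof.
move=> If; rewrite -mulN1r -RintZ//.
by apply: eq_Rint => x; rewrite mulN1r.
Qed.

Lemma Rintegral0 : \int[mu]_x (0 : R) = 0.
Proof. by rewrite Rintegral_cst// mul0r. Qed.

Lemma Rint_sum I (s : seq I) (F : I -> T -> R) : (forall i, intble (F i)) ->
  \int[mu]_x (\sum_(i <- s) F i x) = \sum_(i <- s) \int[mu]_x F i x.
Proof.
move=> IF; elim: s => [|i s ih].
  by rewrite big_nil -[RHS]Rintegral0; apply: eq_Rint => x; rewrite big_nil.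
rewrite big_cons -ih -RintD //; last exact: intble_sum.
by apply: eq_Rint => x; rewrite big_cons.
Qed.

Lemma ae_eq_Rint f g : measurable_fun setT f -> measurable_fun setT g ->
  (\forall x \ae mu, f x = g x) -> \int[mu]_x f x = \int[mu]_x g x.
Proof.
move=> mf mg fg; rewrite /Rintegral; congr fine.
apply: ae_eq_integral => //; [exact/measurable_EFinP|exact/measurable_EFinP|].
by apply: filterS fg => x /= ->.
Qed.

Lemma le_Rint f g : intble f -> intble g -> (\forall x \ae mu, f x <= g x) ->
  \int[mu]_x f x <= \int[mu]_x g x.
Proof.
(* The order holds only almost everywhere; the positive part of [g - f] is nonnegative everywhere
   and has the same integral as [g - f]. *)
move=> If Ig fg; have Ifg : intble (fun x => Num.max 0 (g x - f x)).
  apply: (@intble_le _ (fun x => `|g x - f x|)).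
  - apply: measurable_maxr => //.
    by apply: measurable_funB; exact: intble_meas.
  - move=> x; rewrite ger0_norm ?le_max ?lexx//.
    by rewrite ge_max normr_ge0 ler_norm.
  - exact/intble_norm/intbleB.
rewrite -subr_ge0 -RintB//.
rewrite (@ae_eq_Rint _ (fun x => Num.max 0 (g x - f x))).
- by apply: Rintegral_ge0 => x _; rewrite le_max lexx.
- exact/intble_meas/intbleB.
- exact: intble_meas.
- by apply: filterS fg => x fgx; rewrite max_r// subr_ge0.
Qed.

Lemma Rint_ge0 f : (forall x, 0 <= f x) -> 0 <= \int[mu]_x f x.
Proof. by move=> f0; apply: Rintegral_ge0 => x _. Qed.

Lemma ge0_Rint_eq0 f : intble f -> (\forall x \ae mu, 0 <= f x) ->
  \int[mu]_x f x <= 0 -> \forall x \ae mu, f x = 0.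
Proof.
move=> If f0 intf.
have eqn : \int[mu]_x `|f x| = \int[mu]_x f x.
  apply: ae_eq_Rint; [exact/intble_meas/intble_norm|exact: intble_meas|].
  by apply: filterS f0 => x; exact: ger0_norm.
have : (\int[mu]_x `|(EFin \o f) x| = 0)%E.
  have Inf : intble (fun x => `|f x|) by exact: intble_norm.
  rewrite -[LHS]fineK; last exact: (integrable_fin_num _ Inf).
  congr (_%:E); apply/eqP; rewrite eq_le.
  rewrite -[X in X <= 0]/(\int[mu]_x `|f x|) eqn intf/=.
  by rewrite -[X in 0 <= X]/(\int[mu]_x `|f x|); exact: Rint_ge0.
move=> /ae_eq_integral_abs => /(_ measurableT).
have mf : measurable_fun setT (EFin \o f) by exact/measurable_EFinP/intble_meas.
by move=> /(_ mf); apply: filterS => x /(_ I) /= [].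
Qed.

Lemma le_norm_Rint f : intble f -> `|\int[mu]_x f x| <= \int[mu]_x `|f x|.
Proof. exact: le_normr_Rintegral. Qed.

(** The quadratic form [int (s f + t g) ^ 2] in [s] and [t] is nonnegative, and its value at
    [s = - b], [t = a] is [a (a c - b ^ 2)]. *)
Lemma Rint_CS f g : sqint f -> sqint g ->
  (\int[mu]_x (f x * g x)) ^+ 2 <=
  \int[mu]_x (f x ^+ 2) * \int[mu]_x (g x ^+ 2).
Proof.
move=> sf sg; set a := \int[mu]_x (f x ^+ 2); set c := \int[mu]_x (g x ^+ 2).
set b := \int[mu]_x _.
have If : intble (fun x => f x ^+ 2) by case: sf.
have Ig : intble (fun x => g x ^+ 2) by case: sg.
have Ifg := sqintM sf sg.
have a0 : 0 <= a by apply: Rint_ge0 => x; exact: sqr_ge0.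
have quad s t : 0 <= s ^+ 2 * a + s * t * 2 * b + t ^+ 2 * c.
  rewrite -!RintZ// -!RintD//; try by do ?[exact: intbleZ|apply: intbleD].
  apply: Rint_ge0 => x.
  suff -> : s ^+ 2 * f x ^+ 2 + s * t * 2 * (f x * g x) + t ^+ 2 * g x ^+ 2
    = (s * f x + t * g x) ^+ 2 by exact: sqr_ge0.
  by ring.
have [a_eq0|a_neq0] := eqVneq a 0.
  rewrite a_eq0 mul0r; have := quad (- (c + 1) * b) 1; rewrite a_eq0.
  have c0 : 0 <= c by apply: Rint_ge0 => x; exact: sqr_ge0.
  (* When [a = 0] the form at this point is [- (c + 2) b ^ 2], which forces [b = 0]. *)
  have := quad (- (c + 1)) b; rewrite a_eq0 => h _.
  nra.
have a_gt0 : 0 < a by rewrite lt_def a_neq0.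
have := quad (- b) a.
suff -> : (- b) ^+ 2 * a + - b * a * 2 * b + a ^+ 2 * c = a * (a * c - b ^+ 2).
  by rewrite pmulr_rge0// subr_ge0.
by ring.
Qed.

Lemma Rint_DCT (F : nat -> T -> R) f g : (forall n, measurable_fun setT (F n)) ->
  measurable_fun setT f -> intble g ->
  (\forall x \ae mu, (F n x) @[n --> \oo] --> f x) ->
  (forall n, \forall x \ae mu, `|F n x| <= g x) ->
  \int[mu]_x F n x @[n --> \oo] --> \int[mu]_x f x.
Proof.
move=> mF mf Ig cvF Fg.
have [| | | | |If _ cv] := @dominated_convergence _ _ _ mu _ measurableT
    (fun n => EFin \o F n) (EFin \o f) (EFin \o g).
- by move=> n; exact/measurable_EFinP.
- exact/measurable_EFinP.
- apply: filterS cvF => x cvx _; apply/fine_cvgP; split; first exact: nearW.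
  exact: cvx.
- exact: Ig.
- have : \forall x \ae mu, forall n, `|F n x| <= g x by apply/ae_foralln.
  by apply: filterS => x h n _ /=; rewrite lee_fin.
have : (\int[mu]_x (EFin \o f) x)%E \is a fin_num by exact: integrable_fin_num.
move=> fnum; rewrite /Rintegral; apply: fine_cvg; rewrite fineK//.
Qed.

End square_integrable.

(** * Functions of class C^k *)

Section Ck_theory.
Context {R : realType}.
Implicit Types (V W : normedModType R).

Lemma CkS V k (u : V -> R) : Ck k.+1 u -> Ck k u.
Proof.
elim: k u => [|k ih] u [cu [du Du]]; first by split.
by split=> //; split=> // v; exact/ih/Du.
Qed.

Lemma Ck_cst V k (a : R) : Ck k (fun _ : V => a).
Proof.
elim: k a => [|k ih] a; split; [exact: cst_continuous|by []|exact: cst_continuous|].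
split=> [x v|v]; first exact: (derivable_cst a).
rewrite (_ : 'D_v _ = (fun=> 0)); first exact: ih.
by apply/funext => x; exact: (derive_cst a).
Qed.

Lemma CkD V k (u w : V -> R) : Ck k u -> Ck k w -> Ck k (fun x => u x + w x).
Proof.
elim: k u w => [|k ih] u w [cu Cu] [cw Cw].
  by split=> // x; apply: continuousD; [exact: cu|exact: cw].
split; first by move=> x; apply: continuousD; [exact: cu|exact: cw].
case: Cu => du Du; case: Cw => dw Dw; split=> [x v|v].
  exact: (@derivableD _ _ _ u w).
rewrite (_ : 'D_v _ = (fun x => 'D_v u x + 'D_v w x)).
  by apply: ih; [exact: Du|exact: Dw].
by apply/funext => x; exact: (@deriveD _ _ _ u w).
Qed.

Lemma CkM V k (u w : V -> R) : Ck k u -> Ck k w -> Ck k (fun x => u x * w x).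
Proof.
elim: k u w => [|k ih] u w.
  by move=> [cu _] [cw _]; split=> // x; apply: continuousM; [exact: cu|exact: cw].
move=> Cu Cw; have [cu [du Du]] := Cu; have [cw [dw Dw]] := Cw; split.
  by move=> x; apply: continuousM; [exact: cu|exact: cw].
split=> [x v|v]; first exact: (@derivableM _ _ u w).
rewrite (_ : 'D_v _ = (fun x => u x * 'D_v w x + w x * 'D_v u x)).
  by apply: CkD; apply: ih; [exact: CkS|exact: Dw|exact: CkS|exact: Du].
by apply/funext => x; rewrite (@deriveM _ _ u w).
Qed.

(* The difference quotients of [u \o A] and of [u] coincide. *)
Lemma derive_affine V W (A : V -> W) (u : W -> R) (x v : V) (w : W) :
  (forall h : R, A (h *: v + x) = h *: w + A x) ->
  (derivable (u \o A) x v <-> derivable u (A x) w) /\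
  'D_v (u \o A) x = 'D_w u (A x).
Proof.
move=> Aw; rewrite /derivable /derive.
suff -> : (fun h : R => h^-1 *: ((u \o A \o shift x) (h *: v) - (u \o A) x)) =
  (fun h : R => h^-1 *: ((u \o shift (A x)) (h *: w) - u (A x))) by [].
by apply/funext => h /=; rewrite Aw.
Qed.

Lemma Ck_comp_linear V W k (L : V -> W) (u : W -> R) :
  (forall h x v, L (h *: v + x) = h *: L v + L x) -> continuous L ->
  Ck k u -> Ck k (u \o L).
Proof.
move=> linL cL; elim: k u => [|k ih] u [cu Cu]; split=> //; last first.
- case: Cu => du Du; split=> [x v|v].
    by apply/(derive_affine u (fun h => linL h x v)).1.
  rewrite (_ : 'D_v _ = (fun x => 'D_(L v) u x) \o L); first exact/ih/Du.
  by apply/funext => x; exact: (derive_affine u (fun h => linL h x v)).2.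
- by move=> x; apply: continuous_comp; [exact: cL|exact: cu].
- by move=> x; apply: continuous_comp; [exact: cL|exact: cu].
Qed.

Lemma is_derive1_scale (f : R -> R) (x v df : R) :
  is_derive x 1 f df -> derivable f x v /\ 'D_v f x = v * df.
Proof.
move=> [fx <-]; have dfx : differentiable f x by exact/derivable1_diffP.
split; first exact: diff_derivable.
by rewrite !deriveE// -[in LHS](mulr1 v) linearZ.
Qed.

(** On the line a derivative in direction [v] is [v] times the usual one, so the single function
    [f'] controls all the directional derivatives in [Ck]. *)
Lemma CkS_R k (f f' : R -> R) : (forall x : R, is_derive x 1 f (f' x)) ->
  Ck k f' -> Ck k.+1 f.
Proof.
move=> ff' Cf'; split.
  by move=> x; apply/differentiable_continuous/derivable1_diffP; case: (ff' x).
split=> [x v|v]; first by have [] := is_derive1_scale v (ff' x).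
rewrite (_ : 'D_v _ = (fun x => v * f' x)).
  by apply: CkM => //; exact: Ck_cst.
by apply/funext => x; have [] := is_derive1_scale v (ff' x).
Qed.

Lemma Ck_cos_sin k : Ck k (@cos R) /\ Ck k (@sin R).
Proof.
elim: k => [|k [Cc Cs]]; first by split; split=> //; [exact: continuous_cos|exact: continuous_sin].
split; last by apply: (CkS_R _ Cc) => x; exact: is_derive_sin.
apply: (@CkS_R _ _ (fun x => - sin x)).
under eq_fun do rewrite -mulN1r.
by apply: CkM => //; exact: Ck_cst.
Qed.

End Ck_theory.

(** * Integration by parts on the torus *)

Section torus_ibp.
Context {R : realType}.

Lemma Rint_uniform_deriv (F f : R -> R) (M : R) :
  measurable_fun setT (f : measurableTypeR R -> R) ->
  (forall s, `|f s| <= M) -> continuous f ->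
  (forall s : R, is_derive s 1 F (f s)) ->
  (\int[uniform_prob (@ltr01 R)]_s (f s)%:E)%E = (F 1 - F 0)%:E.
Proof.
move=> mf fM cf Ff.
have If : (uniform_prob (@ltr01 R)).-integrable setT (EFin \o (f : measurableTypeR R -> R)).
  exact: (intble_bdd _ mf fM).
have Ic : (uniform_prob (@ltr01 R)).-integrable setT (EFin \o (cst M : measurableTypeR R -> R)).
  exact: (intble_cst _ M).
(* The formula for the uniform law is applied to a nonnegative integrand, hence the shift by the
   bound [M]; it cancels at the end. *)
have := @integral_uniform R 0 1 ltr01 (fun s => (f s + M)%:E).
have -> : (\int[uniform_prob (@ltr01 R)]_s (f s + M)%:E)%E =
    (\int[uniform_prob (@ltr01 R)]_s (f s)%:E + M%:E)%E.
  transitivity (\int[uniform_prob (@ltr01 R)]_s ((EFin \o f) s + (EFin \o cst M) s))%E.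
    by apply: eq_integral => s _; rewrite /= EFinD.
  rewrite integralD_EFin//; congr (_ + _)%E.
  rewrite [LHS](@integral_cst _ _ _ (uniform_prob (@ltr01 R)) setT measurableT M%:E) -[RHS]mule1.
  by congr (_ * _)%E; exact: probability_setT.
have cFM : (\int[lebesgue_measure]_(s in `[0%R, 1%R]) (f s + M)%:E = (F 1 + M * 1)%R%:E - (F 0 + M * 0)%R%:E)%E.
  have dG (s : R) : is_derive s 1 (fun s => F s + M * s) (f s + M).
    have -> : f s + M = f s + M *: 1 by rewrite /GRing.scale/= mulr1.
    have dM : is_derive s 1 (M *: id : R -> R) (M *: 1) by exact: is_deriveZ.
    exact: (is_deriveD (Ff s) dM).
  apply: (@continuous_FTC2 _ (fun s => f s + M) (fun s => F s + M * s)) => //.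
  - apply: continuous_subspaceT => s; apply: cvgD; [exact: cf|exact: cvg_cst].
  - have cG : continuous (fun s => F s + M * s).
      by move=> s; apply/differentiable_continuous/derivable1_diffP; case: (dG s).
    split; first by move=> s _; case: (dG s).
      by apply: cvg_at_right_filter; exact: cG.
    by apply: cvg_at_left_filter; exact: cG.
  - by move=> s _; rewrite derive1E; have [_ ->] := dG s.
have mfM : measurable_fun setT (fun s : measurableTypeR R => (f s + M)%:E).
  apply/measurable_EFinP; apply: measurable_funD => //.
have fM0 s : (0 <= (f s + M)%:E)%E.
  by rewrite lee_fin; have := fM s; rewrite ler_norml => /andP[]; lra.
move=> /(_ mfM fM0).
rewrite cFM subr0 invr1 mul1e => h.
have fin : (\int[uniform_prob (@ltr01 R)]_s (f s)%:E)%E \is a fin_num.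
  exact: (integrable_fin_num _ If).
move: h; rewrite -(fineK fin) -EFinD -EFinB => -[h].
by congr (_%:E); lra.
Qed.

End torus_ibp.

Section torus_integration.
Context {R : realType}.
Local Notation U := (uniform_prob (@ltr01 R)).

Lemma torus_integralS n (f : 'rV[R]_n.+1 -> R) (M : R) :
  measurable_fun setT f -> (forall x, `|f x| <= M) ->
  (\int[torus_measure n.+1]_x (f x)%:E =
   \int[torus_measure n]_x \int[U]_s (f (rV_cons (s, x)))%:E)%E.
Proof.
move=> mf fM.
have mfc : measurable_fun setT (f \o @rV_cons R n).
  exact: measurableT_comp mf (@measurable_rV_cons R n).
have I : (U \x torus_measure n)%E.-integrable setT (EFin \o (f \o @rV_cons R n)).
  apply: measurable_bounded_integrable => //.
    by rewrite [ltLHS](@probability_setT _ _ _ (U \x torus_measure n)%E) ltry.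
  by exists M; split; [exact: num_real|move=> x Mx y _; exact: le_trans (fM _) (ltW Mx)].
rewrite [LHS](@integral_pushforward _ _ _ _ _ _ (@measurable_rV_cons R n)
  (U \x torus_measure n)%E setT (EFin \o f))//=; last exact/measurable_EFinP.
by rewrite -(integral21_prod_meas1 I).
Qed.

(** With the first coordinate outermost, a derivative in another coordinate can be integrated over
    the remaining ones first. *)
Lemma torus_integralS' n (f : 'rV[R]_n.+1 -> R) (M : R) :
  measurable_fun setT f -> (forall x, `|f x| <= M) ->
  (\int[torus_measure n.+1]_x (f x)%:E =
   \int[U]_s \int[torus_measure n]_x (f (rV_cons (s, x)))%:E)%E.
Proof.
move=> mf fM.
have mfc : measurable_fun setT (f \o @rV_cons R n).
  exact: measurableT_comp mf (@measurable_rV_cons R n).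
have I : (U \x torus_measure n)%E.-integrable setT (EFin \o (f \o @rV_cons R n)).
  apply: measurable_bounded_integrable => //.
    by rewrite [ltLHS](@probability_setT _ _ _ (U \x torus_measure n)%E) ltry.
  by exists M; split; [exact: num_real|move=> x Mx y _; exact: le_trans (fM _) (ltW Mx)].
by rewrite (torus_integralS mf fM) -(Fubini I).
Qed.

Lemma rV_consE0 n (p : R * 'rV[R]_n) : rV_cons p ord0 ord0 = p.1.
Proof.
have := row_mxEl ((p.1)%:M : 'M[R]_1) p.2 ord0 (@ord0 0).
rewrite [in RHS]mxE eqxx mulr1n => <-.
by rewrite /rV_cons; congr (fun_of_matrix _ _ _); exact/val_inj.
Qed.

Lemma rV_consES n (p : R * 'rV[R]_n) j :
  rV_cons p ord0 (lift ord0 j) = p.2 ord0 j.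
Proof.
have := row_mxEr ((p.1)%:M : 'M[R]_1) p.2 ord0 j => <-.
by rewrite /rV_cons; congr (fun_of_matrix _ _ _); exact/val_inj.
Qed.

Lemma scale_deltaE n (h : R) (x : 'rV[R]_n) (i j : 'I_n) :
  (h *: delta_mx ord0 i + x) ord0 j = h * (j == i)%:R + x ord0 j.
Proof. by rewrite !mxE eqxx. Qed.

Lemma rV_cons_delta0 n (h s : R) (x : 'rV[R]_n) :
  rV_cons (h + s, x) = h *: delta_mx ord0 ord0 + rV_cons (s, x).
Proof.
apply/rowP => j; rewrite scale_deltaE; case: (unliftP ord0 j) => [k|] ->;
  rewrite ?rV_consE0 ?rV_consES /= ?eqxx ?mulr1//.
by rewrite mulr0 add0r.
Qed.

Lemma rV_cons_deltaS n (h s : R) (x : 'rV[R]_n) (i : 'I_n) :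
  rV_cons (s, h *: delta_mx ord0 i + x) =
  h *: delta_mx ord0 (lift ord0 i) + rV_cons (s, x).
Proof.
apply/rowP => j; rewrite scale_deltaE; case: (unliftP ord0 j) => [k|] ->;
  rewrite ?rV_consE0 ?rV_consES /= ?scale_deltaE ?(inj_eq lift_inj)//.
by rewrite mulr0 add0r.
Qed.

Lemma rV_cons_measurable1 n (s : R) : measurable_fun setT (fun x : 'rV[R]_n => rV_cons (s, x)).
Proof.
exact: measurableT_comp (@measurable_rV_cons R n) (measurable_pair1 (s : measurableTypeR R)).
Qed.

Lemma rV_cons_measurable2 n (x : 'rV[R]_n) :
  measurable_fun setT (fun s : measurableTypeR R => rV_cons (s, x)).
Proof.
exact: measurableT_comp (@measurable_rV_cons R n) (measurable_pair2 x).
Qed.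

(** Induction on the dimension: if [i] is the first coordinate, the inner integral is an increment
    over one period; otherwise freezing the first coordinate reduces to a lower dimension. The
    derivative is supplied as [du], bounded and continuous along the lines in direction [i], so that
    products involving a composite [p (v x)] qualify. *)
Lemma torus_ibp n (i : 'I_n) (u du : 'rV[R]_n -> R) (M : R) :
  measurable_fun setT du -> (forall x, `|du x| <= M) ->
  (forall x, continuous (fun s : R => du (s *: delta_mx ord0 i + x))) ->
  (forall x, is_derive x (delta_mx ord0 i) u (du x)) ->
  (forall x, u (x + delta_mx ord0 i) = u x) ->
  (\int[torus_measure n]_x (du x)%:E = 0)%E.
Proof.
elim: n i u du => [[]//|n ih] i u du mdu duM cdu udu pu.
case: (unliftP ord0 i) => [j ij|i0]; last first.
  rewrite (torus_integralS mdu duM).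
  rewrite (eq_integral (fun=> 0%E)) ?integral0// => x _.
  pose F (s : R) := u (rV_cons (s, x)).
  have cons0 (h s : R) : rV_cons (h + s, x) = h *: delta_mx ord0 i + rV_cons (s, x).
    by rewrite i0; exact: rV_cons_delta0.
  have F10 : F 1 = F 0.
    by rewrite /F -[X in u (rV_cons (X, _))]addr0 cons0 scale1r addrC pu.
  transitivity (F 1 - F 0)%:E; last by rewrite F10 subrr.
  apply: (@Rint_uniform_deriv R F (fun s => du (rV_cons (s, x))) M).
  - exact: measurableT_comp mdu (rV_cons_measurable2 x).
  - by move=> s.
  - suff -> : (fun s => du (rV_cons (s, x))) =
      (fun s => du (s *: delta_mx ord0 i + rV_cons (0, x))) by exact: cdu.
    by apply/funext => s; rewrite -cons0 addr0.
  - move=> s; have [d1 d2] := udu (rV_cons (s, x)).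
    have [a b] := @derive_affine R R^o _ (fun s => rV_cons (s, x)) u s 1 (delta_mx ord0 i)
       (fun h => etrans (congr1 (fun t => rV_cons (t + s, x)) (mulr1 h)) (cons0 h s)).
    split; first exact: a.2.
    by rewrite -d2 -b.
rewrite (torus_integralS' mdu duM).
rewrite (eq_integral (fun=> 0%E)) ?integral0// => s _.
have consS h x : rV_cons (s, h *: delta_mx ord0 j + x) =
    h *: delta_mx ord0 i + rV_cons (s, x).
  by rewrite ij rV_cons_deltaS.
apply: (ih j (fun x => u (rV_cons (s, x))) (fun x => du (rV_cons (s, x)))).
- exact: measurableT_comp mdu (rV_cons_measurable1 s).
- by move=> x.
- move=> x; under eq_fun do rewrite consS.
  exact: cdu.
- move=> x; have [d1 d2] := udu (rV_cons (s, x)).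
  have [a b] := derive_affine u (fun h => consS h x).
  split; first exact: a.2.
  by rewrite -d2 -b.
- move=> x; rewrite addrC -[delta_mx _ _]scale1r consS scale1r addrC.
  exact: pu.
Qed.

Lemma uniform_oo : U `]0, 1[%classic = 1%E.
Proof.
rewrite /uniform_prob.
rewrite (eq_integral (fun=> 1%E)); last first.
  move=> s; rewrite inE /= in_itv /= /uniform_pdf => /andP[s0 s1].
  by rewrite !ltW// subr0 invr1.
rewrite integral_cst//= mul1e lebesgue_measure_itv/= lte_fin ltr01.
by rewrite oppr0 adde0.
Qed.

(** The measure is built from a closed interval; discarding the faces of the cube as null sets makes
    sign arguments on one open period possible. *)
Lemma torus_coord_oo n (i : 'I_n) :
  \forall x \ae torus_measure n, 0 < (x : 'rV[R]_n) ord0 i < 1.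
Proof.
pose E m (j : 'I_m) := [set x : 'rV[R]_m | 0 < x ord0 j < 1].
have mE m (j : 'I_m) : measurable (E m j).
  rewrite (_ : E m j = (fun x : 'rV[R]_m => x ord0 j) @^-1` `]0, 1[%classic).
    by rewrite -[X in measurable X]setTI; exact: measurable_rV_coord.
  by apply/seteqP; split => x /=; rewrite in_itv.
suff h : torus_measure n (E n i) = 1%E.
  exists (~` E n i); split.
  - exact: (measurableC (mE n i)).
  - by apply: (etrans (probability_setC (torus_measure n) (mE n i))); rewrite h subee.
  - by move=> x.
elim: n i => [[]//|n ih] i.
have -> : torus_measure n.+1 (E n.+1 i) = (U \x torus_measure n)%E (@rV_cons R n @^-1` E n.+1 i) by [].
case: (unliftP ord0 i) => [j ij|i0].
  rewrite (_ : _ @^-1` _ = setT `*` E n j).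
    apply: (etrans (product_measure1E _ _ measurableT (mE n j))).
    by rewrite -[RHS]mule1; congr (_ * _)%E; [exact: probability_setT|exact: ih].
  by apply/seteqP; split=> -[s x] /=; rewrite /E /= ij rV_consES => // -[].
have mI : measurable (`]0%R, 1%R[%classic : set (measurableTypeR R)).
  exact: measurable_itv.
rewrite (_ : _ @^-1` _ = (`]0%R, 1%R[%classic : set (measurableTypeR R)) `*` setT).
  apply: (etrans (product_measure1E U (torus_measure n) mI measurableT)).
  by rewrite -[RHS]mule1; congr (_ * _)%E; [exact: uniform_oo|exact: probability_setT].
by apply/seteqP; split=> -[s x] /=; rewrite /E /= i0 rV_consE0 in_itv => // -[].
Qed.

End torus_integration.

(** * Trigonometric polynomials and mollification *)

Section trig.
Context {R : realType} {d : nat}.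
Implicit Types (u v : 'rV[R]_d -> R) (x y : 'rV[R]_d).

(** The algebra generated by the sines and cosines of period one in each coordinate. Presented
    inductively, it yields smoothness, periodicity, bounds and stability under differentiation by
    induction. *)
Inductive trig : ('rV[R]_d -> R) -> Prop :=
| trig_cst a : trig (fun=> a)
| trig_cos (i : 'I_d) : trig (fun x => cos (2 * pi * x ord0 i))
| trig_sin (i : 'I_d) : trig (fun x => sin (2 * pi * x ord0 i))
| trigD u v : trig u -> trig v -> trig (fun x => u x + v x)
| trigM u v : trig u -> trig v -> trig (fun x => u x * v x).

Lemma trigZ a u : trig u -> trig (fun x => a * u x).
Proof. by move=> tu; apply: trigM => //; exact: trig_cst. Qed.

Lemma trigB u v : trig u -> trig v -> trig (fun x => u x - v x).
Proof.
move=> tu tv; under eq_fun do rewrite -mulN1r.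
by apply: trigD => //; exact: trigZ.
Qed.

Lemma trig_sum I (s : seq I) (F : I -> 'rV[R]_d -> R) :
  (forall i, trig (F i)) -> trig (fun x => \sum_(i <- s) F i x).
Proof.
move=> tF; elim: s => [|i s ih].
  by under eq_fun do rewrite big_nil; exact: trig_cst.
by under eq_fun do rewrite big_cons; exact: trigD.
Qed.

Lemma trig_prod I (s : seq I) (F : I -> 'rV[R]_d -> R) :
  (forall i, trig (F i)) -> trig (fun x => \prod_(i <- s) F i x).
Proof.
move=> tF; elim: s => [|i s ih].
  by under eq_fun do rewrite big_nil; exact: trig_cst.
by under eq_fun do rewrite big_cons; exact: trigM.
Qed.

Lemma trigX u n : trig u -> trig (fun x => u x ^+ n).
Proof.
move=> tu; elim: n => [|n ih]; first exact: trig_cst.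
by under eq_fun do rewrite exprS; exact: trigM.
Qed.

Let coor (i : 'I_d) (x : 'rV[R]_d) : R := 2 * pi * x ord0 i.

Let coor_linear i (h : R) x y : coor i (h *: x + y) = h *: coor i x + coor i y.
Proof. by rewrite /coor !mxE /GRing.scale /=; ring. Qed.

Let coor_continuous i : continuous (coor i).
Proof.
move=> x; apply: (@continuousM _ _ (fun=> 2 * pi) (fun y : 'rV[R]_d => y ord0 i)).
  exact: cst_continuous.
exact: coord_continuous.
Qed.

Lemma trig_smooth u : trig u -> torus_smooth u.
Proof.
have Ckc k i : Ck k (@cos R \o coor i).
  by apply: (@Ck_comp_linear R _ _ k (coor i)); [by move=> *; exact: coor_linear|exact: coor_continuous|case: (@Ck_cos_sin R k)].
have Cks k i : Ck k (@sin R \o coor i).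
  by apply: (@Ck_comp_linear R _ _ k (coor i)); [by move=> *; exact: coor_linear|exact: coor_continuous|case: (@Ck_cos_sin R k)].
have per i x j : coor i (x + delta_mx ord0 j) = coor i x + pi *+ 2 *+ (i == j).
  rewrite /coor !mxE eqxx /= mulrDr; congr (_ + _).
  by case: eqP => _; rewrite ?mulr1 ?mulr0 ?mulr0n ?mulr1n// mulr_natl.
elim=> {u} [a|i|i|u v _ [Cu pu] _ [Cv pv]|u v _ [Cu pu] _ [Cv pv]].
- by split=> [k|x i//]; exact: Ck_cst.
- split=> [k|x j]; first exact: Ckc.
  by rewrite -/(coor _ _) per; case: eqP => _; rewrite ?addr0 ?mulr1n// cosD2pi.
- split=> [k|x j]; first exact: Cks.
  by rewrite -/(coor _ _) per; case: eqP => _; rewrite ?addr0 ?mulr1n// sinD2pi.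
- by split=> [k|x i]; [exact: CkD|rewrite pu pv].
- by split=> [k|x i]; [exact: CkM|rewrite pu pv].
Qed.

Lemma trig_derivable u x w : trig u -> derivable u x w.
Proof. by move=> /trig_smooth [/(_ 1%N) [_ [du _]] _]. Qed.

Lemma trig_continuous u : trig u -> continuous u.
Proof. by move=> /trig_smooth [/(_ 0%N) [cu _] _]. Qed.

Lemma trig_derive u w : trig u -> trig ('D_w u).
Proof.
elim=> {u} [a|i|i|u v tu tu' tv tv'|u v tu tu' tv tv'].
- rewrite (_ : 'D_w _ = (fun=> 0)); first exact: trig_cst.
  by apply/funext => x; exact: (derive_cst a).
- rewrite (_ : 'D_w _ = fun x => - coor i w * sin (2 * pi * x ord0 i)).
    by apply: trigZ; exact: trig_sin.
  apply/funext => x; have [_ ->] := derive_affine (@cos R) (fun h => coor_linear i h w x).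
  have [_ ->] := is_derive1_scale (coor i w) (is_derive_cos (coor i x)).
  by rewrite mulrN mulNr.
- rewrite (_ : 'D_w _ = fun x => coor i w * cos (2 * pi * x ord0 i)).
    by apply: trigZ; exact: trig_cos.
  apply/funext => x; have [_ ->] := derive_affine (@sin R) (fun h => coor_linear i h w x).
  by have [_ ->] := is_derive1_scale (coor i w) (is_derive_sin (coor i x)).
- rewrite (_ : 'D_w _ = fun x => 'D_w u x + 'D_w v x); first exact: trigD.
  by apply/funext => x; apply: (@deriveD _ _ _ u v); exact: trig_derivable.
- rewrite (_ : 'D_w _ = fun x => u x * 'D_w v x + v x * 'D_w u x).
    by apply: trigD; exact: trigM.
  by apply/funext => x; rewrite (@deriveM _ _ u v)//; exact: trig_derivable.
Qed.

Lemma trig_measurable u : trig u -> measurable_fun setT u.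
Proof.
have mcoor i : measurable_fun setT (coor i).
  by apply: measurable_funM => //; exact: measurable_rV_coord.
elim=> {u} [a|i|i|u v _ mu _ mv|u v _ mu _ mv].
- exact: measurable_cst.
- apply: measurableT_comp (mcoor i).
  by apply: continuous_measurable_fun; exact: continuous_cos.
- apply: measurableT_comp (mcoor i).
  by apply: continuous_measurable_fun; exact: continuous_sin.
- exact: measurable_funD.
- exact: measurable_funM.
Qed.

Lemma trig_bounded u : trig u -> exists M : R, forall x, `|u x| <= M.
Proof.
elim=> {u} [a|i|i|u v _ [M uM] _ [N vN]|u v _ [M uM] _ [N vN]].
- by exists `|a|.
- by exists 1 => x; rewrite ler_norml cos_geN1 cos_le1.
- by exists 1 => x; rewrite ler_norml sin_geN1 sin_le1.
- by exists (M + N) => x; rewrite (le_trans (ler_normD _ _))// lerD.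
- by exists (M * N) => x; rewrite normrM ler_pM.
Qed.

End trig.

(** * The one-dimensional cosine kernel and its derivatives *)

Section kernel.
Context {R : realType}.

(* [wallis n] is the inverse of the mean of [cos^(2n)] over a period. *)
Fixpoint wallis (n : nat) : R :=
  if n is m.+1 then wallis m * ((2 * m.+1)%:R / (2 * m + 1)%:R) else 1.

Definition kern1 (n : nat) (s : R) : R := wallis n * cos (pi * s) ^+ (2 * n).

Lemma wallis_gt0 n : 0 < wallis n.
Proof.
by elim: n => //= n ih; rewrite mulr_gt0// divr_gt0// ltr0n// addn1.
Qed.

Lemma kern1_ge0 n s : 0 <= kern1 n s.
Proof. by rewrite mulr_ge0 ?(ltW (wallis_gt0 n))// exprM exprn_ge0// sqr_ge0. Qed.

Lemma kern1S n s :
  kern1 n.+1 s = (2 * n.+1)%:R / (2 * n + 1)%:R * cos (pi * s) ^+ 2 * kern1 n s.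
Proof. by rewrite /kern1 /= mulnS exprD; ring. Qed.

Definition kern1' n (s : R) : R :=
  - (wallis n * ((2 * n)%:R * pi)) * (sin (pi * s) * cos (pi * s) ^+ (2 * n).-1).

(** The ratio of consecutive [wallis] numbers turns [2 n (2 n - 1) wallis n] into
    [4 n ^ 2 wallis n.-1]; hence the second derivative is a difference of two normalised kernels. At
    [n = 0] the factor [n ^ 2] vanishes, whatever [n.-1] means there. *)
Definition kern1'' n (s : R) : R :=
  4 * pi ^+ 2 * n%:R ^+ 2 * (kern1 n.-1 s - kern1 n s).

Lemma is_derive_cospi (s : R) :
  is_derive s 1 (fun s => cos (pi * s)) (- (pi * sin (pi * s))).
Proof.
have [_ h1] := is_derive1_scale pi (is_derive_cos (pi * s)).
have aff (h : R) : pi * (h *: 1 + s) = h *: pi + pi * s.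
  by rewrite /GRing.scale /=; ring.
have [a b] := @derive_affine R R^o R^o (fun s => pi * s) (@cos R) s 1 pi aff.
split; last by rewrite [LHS]b h1 mulrN.
by apply: a.2; have [] := is_derive1_scale pi (is_derive_cos (pi * s)).
Qed.

Lemma is_derive_sinpi (s : R) :
  is_derive s 1 (fun s => sin (pi * s)) (pi * cos (pi * s)).
Proof.
have [_ h1] := is_derive1_scale pi (is_derive_sin (pi * s)).
have aff (h : R) : pi * (h *: 1 + s) = h *: pi + pi * s.
  by rewrite /GRing.scale /=; ring.
have [a b] := @derive_affine R R^o R^o (fun s => pi * s) (@sin R) s 1 pi aff.
split; last by rewrite [LHS]b h1.
by apply: a.2; have [] := is_derive1_scale pi (is_derive_sin (pi * s)).
Qed.

Lemma is_derive_cospiX (n : nat) (s : R) :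
  is_derive s 1 (fun s => cos (pi * s) ^+ n)
    (- (n%:R * pi * (sin (pi * s) * cos (pi * s) ^+ n.-1))).
Proof.
have := @is_deriveX _ _ (fun s => cos (pi * s)) n s 1 _ (is_derive_cospi s).
rewrite (_ : (fun s => cos (pi * s)) ^+ n = (fun s => cos (pi * s) ^+ n)); last first.
  by apply/funext => x; elim: n => // n ih; rewrite !exprS -ih.
move=> h; apply: is_derive_eq.
by rewrite /GRing.scale /=; ring.
Qed.

Lemma is_derive_kern1 n (s : R) : is_derive s 1 (kern1 n) (kern1' n s).
Proof.
have h := @is_deriveZ _ _ _ _ (wallis n) s 1 _ (is_derive_cospiX (2 * n) s).
by apply: is_derive_eq; rewrite /kern1' /GRing.scale /=; ring.
Qed.

Lemma is_derive_kern1' n (s : R) : is_derive s 1 (kern1' n) (kern1'' n s).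
Proof.
have h := @is_deriveM _ _ _ _ s 1 _ _ (is_derive_sinpi s) (is_derive_cospiX (2 * n).-1 s).
have := @is_deriveZ _ _ _ _ (- (wallis n * ((2 * n)%:R * pi))) s 1 _ h.
move=> {}h; apply: is_derive_eq.
rewrite /kern1'' /kern1; case: n {h} => [|n]; first by rewrite !muln0 /GRing.scale /=; ring.
have -> : (2 * n.+1).-1 = (2 * n).+1 by rewrite mulnS.
have -> : (2 * n.+1)%N = (2 * n).+2 by rewrite mulnS.
have sc := cos2Dsin2 (pi * s); set C := cos _ in sc *; set S := sin _ in sc *.
rewrite /= /GRing.scale /=.
have S2 : S * S = 1 - C ^+ 2 by rewrite -sc; ring.
have w : (2 * n).+1%:R != 0 :> R by rewrite pnatr_eq0.
rewrite !exprS addn1; set q := C ^+ (2 * n).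
have e1 : (2 * n.+1)%:R = 2 * n.+1%:R :> R by rewrite natrM.
have e2 : (2 * n).+2%:R = 2 * n.+1%:R :> R by rewrite -natrM mulnS.
have e3 : (2 * n).+1%:R = 2 * n.+1%:R - 1 :> R by rewrite -natrM mulnS natrD -natr1; ring.
rewrite e1 e2 e3 in w *; set N := n.+1%:R in w *.
have -> : S * - ((2 * N - 1) * pi * (S * q)) = - ((2 * N - 1) * pi * q) * (S * S) by ring.
by rewrite S2; field.
Qed.

End kernel.

(** * The product kernel and its positive semidefinite factorisation *)

Section kern.
Context {R : realType} {d : nat}.
Implicit Types (nu : 'I_d -> nat) (v x y : 'rV[R]_d) (i : 'I_d).

Definition kern nu v : R := \prod_(i < d) kern1 (nu i) (v ord0 i).

Definition upd nu i n : 'I_d -> nat := fun j => if j == i then n else nu j.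

Lemma kern_ge0 nu v : 0 <= kern nu v.
Proof. by apply: prodr_ge0 => i _; exact: kern1_ge0. Qed.

Lemma kernD1 nu i v : kern nu v =
  kern1 (nu i) (v ord0 i) * \prod_(j < d | j != i) kern1 (nu j) (v ord0 j).
Proof. by rewrite /kern (bigD1 i). Qed.

Lemma kern_upd nu i n v : kern (upd nu i n) v =
  kern1 n (v ord0 i) * \prod_(j < d | j != i) kern1 (nu j) (v ord0 j).
Proof.
rewrite (kernD1 _ i) /upd eqxx; congr (_ * _).
by apply: eq_bigr => j /negbTE ->.
Qed.

Lemma upd_id nu i : upd nu i (nu i) = nu.
Proof. by apply/funext => j; rewrite /upd; case: eqP => // ->. Qed.

(** On the line through [v] in direction [i] the factor [q] is constant, which leaves a derivative
    in one variable. *)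
Lemma derive_coord (p p' : R -> R) (q : 'rV[R]_d -> R) i v :
  (forall s : R, is_derive s 1 p (p' s)) ->
  (forall h, q (h *: delta_mx ord0 i + v) = q v) ->
  is_derive v (delta_mx ord0 i) (fun v => p (v ord0 i) * q v)
    (p' (v ord0 i) * q v).
Proof.
move=> pp' qi; pose u := fun v => p (v ord0 i) * q v.
pose A (s : R) := s *: delta_mx ord0 i + v.
have affA (h : R) : A (h *: 1 + 0) = h *: delta_mx ord0 i + A 0.
  by rewrite /A addr0 scale0r add0r [h *: 1]mulr1.
have affB (h : R) : (h *: 1 + 0) + v ord0 i = h *: 1 + (0 + v ord0 i).
  by rewrite addr0 add0r.
have [B1 B2] := @derive_affine R R^o R^o (fun s => s + v ord0 i) p 0 1 1 affB.
have uA : u \o A = q v \*: (p \o (fun s => s + v ord0 i)).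
  apply/funext => s /=; rewrite /u /A qi scale_deltaE eqxx mulr1.
  by rewrite mulrC.
have [A1 A2] := @derive_affine R R^o _ A u 0 1 _ affA.
have A0 : A 0 = v by rewrite /A scale0r add0r.
have pd : is_derive (0 : R) 1 (p \o (fun s => s + v ord0 i)) (p' (v ord0 i)).
  have [p1 p2] := pp' (v ord0 i).
  by split; [apply/B1; rewrite add0r|rewrite B2 add0r].
have qd := @is_deriveZ _ _ _ _ (q v) (0 : R) 1 _ pd.
rewrite -uA in qd; case: qd => q1 q2.
split; first by rewrite A0 in A1; exact/A1.
by rewrite A0 in A2; rewrite -A2 q2 mulrC.
Qed.

Let rest_const nu i h v : \prod_(j < d | j != i) kern1 (nu j) ((h *: delta_mx ord0 i + v) ord0 j) =
  \prod_(j < d | j != i) kern1 (nu j) (v ord0 j).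
Proof. by apply: eq_bigr => j /negbTE ji; rewrite scale_deltaE ji mulr0 add0r. Qed.

Lemma derive_kern nu i v : 'D_(delta_mx ord0 i) (kern nu) v =
  kern1' (nu i) (v ord0 i) * \prod_(j < d | j != i) kern1 (nu j) (v ord0 j).
Proof.
rewrite (_ : kern nu = fun v => kern1 (nu i) (v ord0 i) * \prod_(j < d | j != i) kern1 (nu j) (v ord0 j)).
  by have [_ ->] := @derive_coord (kern1 (nu i)) (kern1' (nu i))
    (fun v => \prod_(j < d | j != i) kern1 (nu j) (v ord0 j)) i v
    (is_derive_kern1 (nu i)) (fun h => rest_const nu i h v).
by apply/funext => w; exact: kernD1.
Qed.

Lemma derive2_kern nu i n v :
  'D_(delta_mx ord0 i) ('D_(delta_mx ord0 i) (kern (upd nu i n.+1))) v =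
  4 * pi ^+ 2 * n.+1%:R ^+ 2 * (kern (upd nu i n) v - kern (upd nu i n.+1) v).
Proof.
rewrite (_ : 'D_(delta_mx ord0 i) (kern _) = fun v => kern1' n.+1 (v ord0 i) * \prod_(j < d | j != i) kern1 (nu j) (v ord0 j)).
  have [_ ->] := @derive_coord (kern1' n.+1) (kern1'' n.+1)
    (fun v => \prod_(j < d | j != i) kern1 (nu j) (v ord0 j)) i v
    (is_derive_kern1' n.+1) (fun h => rest_const nu i h v).
  by rewrite !kern_upd /kern1'' /=; ring.
apply/funext => w; rewrite derive_kern /upd eqxx; congr (_ * _).
by apply: eq_bigr => j /negbTE ->.
Qed.

(** Raising the exponent absorbs the extra [cos ^ 2]; the factor is the inverse of the [wallis]
    ratio [(2 n + 2) / (2 n + 1)]. Once integrated, it measures how the kernel concentrates. *)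
Lemma kern_cos2 nu i v : cos (pi * v ord0 i) ^+ 2 * kern nu v =
  (1 - (2 * nu i + 2)%:R^-1) * kern (upd nu i (nu i).+1) v.
Proof.
rewrite kern_upd (kernD1 _ i) kern1S.
have e1 : (2 * (nu i).+1)%:R = 2 * (nu i)%:R + 2 :> R.
  by rewrite mulnS natrD natrM addrC.
have e2 : (2 * nu i + 1)%:R = 2 * (nu i)%:R + 1 :> R by rewrite natrD natrM.
have e3 : (2 * nu i + 2)%:R = 2 * (nu i)%:R + 2 :> R by rewrite natrD natrM.
rewrite e1 e2 e3.
have n0 : 0 <= (nu i)%:R :> R by [].
by field; rewrite !gt_eqF //; lra.
Qed.

Lemma cos_sqr (s : R) : cos (pi * s) ^+ 2 = (1 + cos (2 * pi * s)) / 2.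
Proof.
have -> : 2 * pi * s = pi * s + pi * s by ring.
rewrite cosD; have := cos2Dsin2 (pi * s); rewrite !expr2 => h; lra.
Qed.

Lemma trig_kern nu : trig (kern nu).
Proof.
apply: trig_prod => i; apply: trigZ.
under eq_fun do rewrite exprM cos_sqr mulrC.
by apply/trigX/trigZ/trigD; [exact: trig_cst|exact: trig_cos].
Qed.

(** An explicit finite factorisation rather than the sign of a quadratic form: it gives that sign,
    and also makes the convolution an operator of finite rank with trigonometric polynomials as
    values. *)
Definition psd (K : 'rV[R]_d -> 'rV[R]_d -> R) := exists (J : finType)
  (e : J -> 'rV[R]_d -> R), (forall j, trig (e j)) /\
  forall x y, K x y = \sum_j e j x * e j y.

Lemma psd_rank1 u : trig u -> psd (fun x y => u x * u y).
Proof.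
move=> tu; exists unit, (fun=> u); split=> // x y.
by rewrite (big_pred1 tt) => [|[]].
Qed.

Lemma psdD K L : psd K -> psd L -> psd (fun x y => K x y + L x y).
Proof.
move=> [J [e [te eK]]] [I [f [tf fL]]].
exists (J + I)%type, (fun k => match k with inl j => e j | inr k => f k end).
split; first by case.
by move=> x y; rewrite big_sumType /= eK fL.
Qed.

(** The Schur product: the products of one function from each family factor the product kernel. *)
Lemma psdM K L : psd K -> psd L -> psd (fun x y => K x y * L x y).
Proof.
move=> [J [e [te eK]]] [I [f [tf fL]]].
exists (J * I)%type, (fun k x => e k.1 x * f k.2 x).
split; first by move=> k; exact: trigM.
move=> x y; rewrite eK fL big_distrl /=.
rewrite -(pair_bigA _ (fun j k => e j x * f k x * (e j y * f k y))) /=.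
apply: eq_bigr => j _; rewrite big_distrr /=; apply: eq_bigr => k _.
by ring.
Qed.

Lemma psd_cst a : 0 <= a -> psd (fun _ _ => a).
Proof.
move=> a0; have := psd_rank1 (trig_cst (Num.sqrt a)).
by rewrite (_ : (fun _ _ => _) = (fun _ _ => a))//; apply/funext => x; apply/funext => y; rewrite -expr2 sqr_sqrtr.
Qed.

Lemma psdX K n : psd K -> psd (fun x y => K x y ^+ n).
Proof.
move=> psdK; elim: n => [|n ih]; first exact: psd_cst.
by under eq_fun do under eq_fun do rewrite exprS; exact: psdM.
Qed.

Lemma psd_prod I (s : seq I) (F : I -> _) : (forall k, psd (F k)) ->
  psd (fun x y => \prod_(k <- s) F k x y).
Proof.
move=> pF; elim: s => [|k s ih].
  by under eq_fun do under eq_fun do rewrite big_nil; exact: psd_cst.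
by under eq_fun do under eq_fun do rewrite big_cons; exact: psdM.
Qed.

(** By the addition formula, [cos (pi (s - t)) ^ 2] is a nonnegative combination of [1], [cos cos]
    and [sin sin]; powers and products preserve [psd]. *)
Lemma psd_kern nu : psd (fun x y => kern nu (x - y)).
Proof.
apply: psd_prod => i.
rewrite (_ : (fun x y => kern1 (nu i) ((x - y) ord0 i)) = fun x y => wallis (nu i) *
  (2^-1 * (1 + (cos (2 * pi * x ord0 i) * cos (2 * pi * y ord0 i) +
    sin (2 * pi * x ord0 i) * sin (2 * pi * y ord0 i)))) ^+ nu i).
  apply: psdM; first by apply: psd_cst; exact/ltW/wallis_gt0.
  apply: psdX; apply: psdM; first by apply: psd_cst; rewrite invr_ge0.
  apply: psdD; first exact: psd_cst.
  by apply: psdD; apply: psd_rank1; [exact: trig_cos|exact: trig_sin].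
apply/funext => x; apply/funext => y; rewrite /kern1 exprM cos_sqr !mxE.
by rewrite mulrBr cosB [_ / 2]mulrC.
Qed.

Lemma derive_subl u i x y :
  'D_(delta_mx ord0 i) (fun x => u (x - y)) x =
  'D_(delta_mx ord0 i) u (x - y) :> R.
Proof.
have aff h : (h *: delta_mx ord0 i + x) - y = h *: delta_mx ord0 i + (x - y).
  by rewrite addrA.
by have [_ <-] := @derive_affine R _ _ (fun x => x - y) u x _ _ aff.
Qed.

Lemma deriveZdir u (c : R) x w : derivable u x w ->
  derivable u x (c *: w) /\ 'D_(c *: w) u x = c * 'D_w u x.
Proof.
move=> du; pose A (s : R) := s *: w + x.
have affA k (h s : R) : A (h *: k + s) = h *: (k *: w) + A s.
  by rewrite /A scalerDl scalerA addrA.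
have A0 : A 0 = x by rewrite /A scale0r add0r.
have [A1 A2] := @derive_affine R R^o _ A u 0 1 _ (fun h => affA 1 h 0).
have [B1 B2] := @derive_affine R R^o _ A u 0 c _ (fun h => affA c h 0).
rewrite A0 scale1r in A1 A2; rewrite A0 in B1 B2.
have uA : is_derive (0 : R) 1 (u \o A) ('D_w u x) by split; [exact/A1|].
have [h1 h2] := is_derive1_scale c uA.
by split; [exact/B1|rewrite -B2].
Qed.

Lemma derive_subr u i x y : trig u ->
  is_derive y (delta_mx ord0 i) (fun y => u (x - y))
  (- 'D_(delta_mx ord0 i) u (x - y)).
Proof.
move=> tu.
have aff h : x - (h *: delta_mx ord0 i + y) = h *: (-1 *: delta_mx ord0 i) + (x - y).
  by rewrite opprD addrCA scaleN1r scalerN.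
have [a b] := @derive_affine R _ _ (fun y => x - y) u y _ _ aff.
have [c e] := deriveZdir (-1) (@trig_derivable _ _ u (x - y) (delta_mx ord0 i) tu).
by split; [apply/a|rewrite [LHS]b e mulN1r].
Qed.

End kern.

(** * The mollification operator and its algebraic properties *)

Section smoothing.
Context {R : realType} {d : nat}.
Local Notation mT := (torus_measure d : probability 'rV[R]_d R).
Local Notation D i u := ('D_(delta_mx ord0 i) u).
Implicit Types (nu : 'I_d -> nat) (x y : 'rV[R]_d) (i : 'I_d)
  (f g u : 'rV[R]_d -> R).

Lemma line_continuous (u : 'rV[R]_d -> R) (w x : 'rV[R]_d) : continuous u ->
  continuous (fun s : R => u (s *: w + x)).
Proof.
move=> cu s; apply: (@continuous_comp _ _ _ (fun s : R => s *: w + x) u).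
  apply: (@continuousD _ _ _ (fun s : R => s *: w) (fun=> x)).
    exact: scalel_continuous.
  exact: cst_continuous.
exact: cu.
Qed.

Lemma trig_intble u : trig u -> intble mT u.
Proof.
move=> tu; have [M uM] := trig_bounded tu.
exact: intble_bdd (trig_measurable tu) uM.
Qed.

Lemma trig_sqint u : trig u -> sqint mT u.
Proof.
move=> tu; have [M uM] := trig_bounded tu.
exact: sqint_bdd (trig_measurable tu) uM.
Qed.

Lemma trig_intbleM u f : trig u -> intble mT f -> intble mT (fun x => u x * f x).
Proof.
move=> tu; have [M uM] := trig_bounded tu.
exact: intble_bddM (trig_measurable tu) uM.
Qed.

Lemma trig_ibp i u : trig u -> \int[mT]_x D i u x = 0.
Proof.
move=> tu; have tDu := trig_derive (delta_mx ord0 i) tu.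
have [M uM] := trig_bounded tDu.
suff e : (\int[mT]_x (D i u x)%:E = 0)%E by exact: (congr1 fine e).
apply: (@torus_ibp R d i u (D i u) M) => //.
- exact: trig_measurable.
- by move=> x; apply: (@line_continuous (D i u)); exact: trig_continuous.
- by move=> x; split; [exact: trig_derivable|].
- by move=> x; have [_] := trig_smooth tu; apply.
Qed.

Lemma trig_subr u x : trig u -> trig (fun y => u (x - y)).
Proof.
elim=> {u} [a|i|i|u v _ tu _ tv|u v _ tu _ tv].
- exact: trig_cst.
- under eq_fun do rewrite !mxE mulrBr cosB.
  by apply: trigD; apply: trigZ; [exact: trig_cos|exact: trig_sin].
- under eq_fun do rewrite !mxE mulrBr sinB.
  by apply: trigB; apply: trigZ; [exact: trig_cos|exact: trig_sin].
- exact: trigD.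
- exact: trigM.
Qed.

Lemma Rint_derive2_kern nu i x :
  \int[mT]_y D i (D i (kern nu)) (x - y) = 0.
Proof.
have tk := trig_derive (delta_mx ord0 i) (@trig_kern R d nu).
have tkk := trig_subr x (trig_derive (delta_mx ord0 i) tk).
have : -1 * \int[mT]_y D i (D i (kern nu)) (x - y) = 0.
  rewrite -(RintZ _ (trig_intble tkk)) -[RHS](trig_ibp i (trig_subr x tk)).
  apply: eq_Rint => y; have [_ ->] := derive_subr i x y tk.
  by rewrite mulN1r.
by move/eqP; rewrite mulN1r oppr_eq0 => /eqP.
Qed.

Lemma trig_kern_sub nu x : trig (fun y => kern nu (x - y)).
Proof. exact: (trig_subr x (@trig_kern R d nu)). Qed.

(** Induction on the total exponent: lowering one exponent changes the kernel by a multiple of a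
    second derivative, whose integral vanishes, and with all exponents zero the kernel is the
    constant [1]. *)
Lemma Rint_kern nu x : \int[mT]_y kern nu (x - y) = 1.
Proof.
have [m] := ubnP (\sum_i nu i); elim: m nu => // m ih nu.
have [/eqP|] := boolP (\sum_i nu i == 0)%N.
  move=> /eqP; rewrite sum_nat_eq0 => /forallP nu0 _.
  rewrite (eq_Rint mT (_ : _ =1 (fun=> 1))).
    by rewrite Rintegral_cst// mul1r [X in fine X](probability_setT mT).
  move=> y; rewrite /kern big1// => i _.
  by rewrite (eqP (implyP (nu0 i) isT)) /kern1 /= muln0 expr0 mulr1.
rewrite sum_nat_eq0 negb_forall => /existsP[i]; rewrite /= => nui.
case nuiE : (nu i) nui => [//|n] _.
have nuE : nu = upd nu i n.+1 by rewrite -nuiE upd_id.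
rewrite (bigD1 i)//= nuiE addSn ltnS => sm.
have <- : \int[mT]_y kern (upd nu i n) (x - y) = 1.
  apply: ih; rewrite (bigD1 i)//= {1}/upd eqxx.
  by rewrite (eq_bigr nu)// => j /negbTE; rewrite /upd => ->.
apply/eqP; rewrite eq_sym -subr_eq0 {2}nuE -RintB; try exact/trig_intble/trig_kern_sub.
have h0 := Rint_derive2_kern (upd nu i n.+1) i x.
have : 4 * pi ^+ 2 * n.+1%:R ^+ 2 *
    \int[mT]_y (kern (upd nu i n) (x - y) - kern (upd nu i n.+1) (x - y)) = 0.
  rewrite -RintZ; last by apply/trig_intble/trigB; exact: trig_kern_sub.
  by rewrite -[RHS]h0; apply: eq_Rint => y; rewrite derive2_kern.
move/eqP; rewrite mulf_eq0 => /orP[|//].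
by rewrite gt_eqF// !mulr_gt0 ?exprn_gt0 ?pi_gt0.
Qed.

(** A factorisation chosen once and for all; only [trig_bas] and [kernE] are used of it. *)
Definition bas_idx nu : finType := sval (cid (@psd_kern R d nu)).

Definition bas nu : bas_idx nu -> 'rV[R]_d -> R :=
  sval (cid (svalP (cid (@psd_kern R d nu)))).

Lemma trig_bas nu j : trig (@bas nu j).
Proof. by have [tb _] := svalP (cid (svalP (cid (@psd_kern R d nu)))); exact: tb. Qed.

Lemma kernE nu x y : kern nu (x - y) = \sum_j bas j x * @bas nu j y.
Proof. by have [_ kb] := svalP (cid (svalP (cid (@psd_kern R d nu)))); exact: kb. Qed.

Definition S nu f x : R := \int[mT]_y (kern nu (x - y) * f y).

Definition coef nu (j : bas_idx nu) f : R := \int[mT]_y (bas j y * f y).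

Lemma bas_intble nu (j : bas_idx nu) f : intble mT f ->
  intble mT (fun y => bas j y * f y).
Proof. by apply: trig_intbleM; exact: trig_bas. Qed.

Lemma kern_intble nu x f : intble mT f ->
  intble mT (fun y => kern nu (x - y) * f y).
Proof. by apply: trig_intbleM; exact: trig_kern_sub. Qed.

Lemma SE nu f x : intble mT f -> S nu f x = \sum_j coef j f * @bas nu j x.
Proof.
move=> If; rewrite /S.
under eq_Rintegral do rewrite kernE big_distrl /=.
rewrite Rint_sum => [|j]; last first.
  under eq_fun do rewrite -mulrA.
  exact/intbleZ/bas_intble.
apply: eq_bigr => j _; under eq_Rintegral do rewrite -mulrA.
rewrite RintZ; last exact: bas_intble.
by rewrite [RHS]mulrC.
Qed.

Lemma trig_S nu f : intble mT f -> trig (S nu f).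
Proof.
move=> If; rewrite (_ : S nu f = fun x => \sum_j coef j f * @bas nu j x).
  by apply: trig_sum => j; apply: trigZ; exact: trig_bas.
by apply/funext => x; exact: SE.
Qed.

(** In the chosen factorisation the pairing is visibly symmetric in [f] and [g], and for [f = g] it
    is a sum of squares. *)
Lemma S_pair nu f g : intble mT f -> intble mT g ->
  \int[mT]_x (g x * S nu f x) = \sum_j coef j f * @coef nu j g.
Proof.
move=> If Ig; under eq_Rintegral do rewrite SE// big_distrr /=.
rewrite Rint_sum => [|j]; last first.
  by under eq_fun do rewrite mulrCA [g _ * _]mulrC; exact/intbleZ/bas_intble.
apply: eq_bigr => j _; under eq_Rintegral do rewrite mulrCA [g _ * _]mulrC.
by rewrite RintZ//; exact: bas_intble.
Qed.

Lemma S_adj nu f g : intble mT f -> intble mT g ->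
  \int[mT]_x (g x * S nu f x) = \int[mT]_x (S nu g x * f x).
Proof.
move=> If Ig; rewrite S_pair//.
under [RHS]eq_Rintegral do rewrite mulrC.
by rewrite S_pair//; apply: eq_bigr => j _; rewrite mulrC.
Qed.

Lemma S_D nu f g x : intble mT f -> intble mT g ->
  S nu (fun x => f x + g x) x = S nu f x + S nu g x.
Proof.
move=> If Ig; rewrite /S -RintD; try exact: kern_intble.
by apply: eq_Rint => y; rewrite mulrDr.
Qed.

Lemma S_Z nu f c x : intble mT f -> S nu (fun x => c * f x) x = c * S nu f x.
Proof.
move=> If; rewrite /S -RintZ; last exact: kern_intble.
by apply: eq_Rint => y; rewrite mulrCA.
Qed.

Lemma S_B nu f g x : intble mT f -> intble mT g ->
  S nu (fun x => f x - g x) x = S nu f x - S nu g x.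
Proof.
move=> If Ig; rewrite /S -RintB; try exact: kern_intble.
by apply: eq_Rint => y; rewrite mulrBr.
Qed.

Lemma S_cst nu c x : S nu (fun=> c) x = c.
Proof.
have -> : S nu (fun=> c) x = S nu (fun=> c * 1) x by rewrite mulr1.
rewrite S_Z; last exact: intble_cst.
by rewrite /S; under eq_Rintegral do rewrite mulr1; rewrite Rint_kern mulr1.
Qed.

Lemma S_le nu f g x : intble mT f -> intble mT g ->
  (\forall y \ae mT, f y <= g y) -> S nu f x <= S nu g x.
Proof.
move=> If Ig fg; apply: le_Rint; try exact: kern_intble.
by apply: filterS fg => y fgy; rewrite ler_wpM2l// kern_ge0.
Qed.

Lemma Rint_S nu f : intble mT f -> \int[mT]_x S nu f x = \int[mT]_x f x.
Proof.
move=> If; have I1 : intble mT (fun=> 1) by exact: intble_cst.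
have := S_adj nu If I1.
under eq_Rintegral do rewrite mul1r.
by move=> ->; apply: eq_Rint => x; rewrite S_cst mul1r.
Qed.

(** Jensen's inequality for the probability density [kern nu (x - y)] in [y]: the variance around
    the mean [m] is nonnegative. *)
Lemma S_sqr_le nu f x : sqint mT f -> S nu f x ^+ 2 <= S nu (fun y => f y ^+ 2) x.
Proof.
move=> sf; have If := sqint_intble sf; have [mf If2] := sf.
set m := S nu f x.
have : 0 <= S nu (fun y => (f y ^+ 2 + (- (2 * m)) * f y) + m ^+ 2) x.
  apply: Rint_ge0 => y; rewrite mulr_ge0 ?kern_ge0//.
  by rewrite (_ : _ + _ = (f y - m) ^+ 2) ?sqr_ge0//; ring.
have I1 : intble mT (fun y => (- (2 * m)) * f y) by exact: intbleZ.
rewrite S_D; [|exact: intbleD|exact: intble_cst].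
rewrite S_D// S_Z// S_cst -/m; lra.
Qed.

Lemma S_sqint nu f : intble mT f -> sqint mT (S nu f).
Proof. by move=> If; apply/trig_sqint/trig_S. Qed.

Lemma S_intble nu f : intble mT f -> intble mT (S nu f).
Proof. by move=> If; apply/trig_intble/trig_S. Qed.

Lemma S_contract nu f : sqint mT f ->
  \int[mT]_x (S nu f x ^+ 2) <= \int[mT]_x (f x ^+ 2).
Proof.
move=> sf; have If := sqint_intble sf; have [mf If2] := sf.
rewrite -(Rint_S nu If2); apply: le_Rint.
- by case: (S_sqint nu If).
- exact: S_intble.
- by apply: aeW => x; exact: S_sqr_le.
Qed.

Lemma trig_sum_derive (J : finType) (c : J -> R) (e : J -> 'rV[R]_d -> R) x w :
  (forall j, trig (e j)) ->
  'D_w (fun z => \sum_j c j * e j z) x = \sum_j c j * 'D_w (e j) x.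
Proof.
move=> te; elim: (index_enum J) => [|j r ih].
  rewrite big_nil (_ : (fun z => _) = (fun=> 0)); first exact: derive_cst.
  by apply/funext => z; rewrite big_nil.
rewrite big_cons -ih (_ : (fun z => _) =
    (fun z => c j * e j z) + (fun z => \sum_(j <- r) c j * e j z)); last first.
  by apply/funext => z; rewrite big_cons.
rewrite deriveD; last 2 first.
  by apply: trig_derivable; apply: trigZ.
  by apply: trig_derivable; apply: trig_sum => k; apply: trigZ.
congr (_ + _); rewrite -[LHS]/('D_w (c j \*: e j) x) deriveZ//.
exact: trig_derivable.
Qed.

(* Both sides are the derivatives of [kern nu (x - y)], in [x] and, up to the
   sign, in [y]. *)
Lemma derive_bas nu i x y :
  \sum_j D i (bas j) x * @bas nu j y = - \sum_j bas j x * D i (@bas nu j) y.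
Proof.
rewrite -(trig_sum_derive (fun j => @bas nu j x) y _ (@trig_bas nu)).
under eq_bigr do rewrite mulrC.
rewrite -(trig_sum_derive (fun j => @bas nu j y) x _ (@trig_bas nu)).
transitivity (D i (fun x => kern nu (x - y)) x).
  by congr ('D__ _ x); apply/funext => z; rewrite kernE; apply: eq_bigr => j _; rewrite mulrC.
rewrite derive_subl; have [_] := derive_subr i x y (@trig_kern R d nu).
rewrite (_ : (fun y => kern nu (x - y)) = (fun z => \sum_j bas j x * @bas nu j z)).
  by move=> ->; rewrite opprK.
by apply/funext => z; rewrite kernE.
Qed.

Lemma derive2_bas nu i x y :
  \sum_j D i (D i (bas j)) x * @bas nu j y = D i (D i (kern nu)) (x - y).
Proof.
under eq_bigr do rewrite mulrC.
rewrite -(trig_sum_derive (fun j => @bas nu j y) x _ (fun j => trig_derive _ (@trig_bas nu j))).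
rewrite -derive_subl; congr ('D__ _ x); apply/funext => z.
rewrite -derive_subl -trig_sum_derive; last exact: trig_bas.
by congr ('D__ _ z); apply/funext => t; rewrite kernE; apply: eq_bigr => j _; rewrite mulrC.
Qed.

(** Trigonometric test functions are enough to commute the derivative with [S], because the
    functions [bas] are of this kind. *)
Definition wgrad i f g := forall u, trig u ->
  \int[mT]_x (f x * D i u x) = - \int[mT]_x (g x * u x).

Lemma Rint_sum_mul (J : finType) (c : J -> R) (e : J -> 'rV[R]_d -> R) f :
  (forall j, trig (e j)) -> intble mT f ->
  \int[mT]_y ((\sum_j c j * e j y) * f y) = \sum_j c j * \int[mT]_y (e j y * f y).
Proof.
move=> te If; under eq_Rintegral do rewrite big_distrl /=.
rewrite Rint_sum => [|j]; last first.
  under eq_fun do rewrite -mulrA.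
  exact/intbleZ/trig_intbleM.
apply: eq_bigr => j _; under eq_Rintegral do rewrite -mulrA.
by rewrite RintZ//; exact: trig_intbleM.
Qed.

(** [derive_bas] moves the derivative from [x] to the integration variable at the cost of a sign;
    there the weak derivative applies and restores the sign. *)
Lemma derive_S nu i f g x : intble mT f -> intble mT g -> wgrad i f g ->
  D i (S nu f) x = S nu g x.
Proof.
move=> If Ig fg.
rewrite (_ : S nu f = fun x => \sum_j coef j f * @bas nu j x); last first.
  by apply/funext => z; exact: SE.
rewrite trig_sum_derive; last exact: trig_bas.
under eq_bigr do rewrite mulrC.
rewrite -Rint_sum_mul//; last exact: trig_bas.
under eq_Rintegral do rewrite derive_bas -sumrN.
under eq_Rintegral do under eq_bigr do rewrite -mulNr.
rewrite Rint_sum_mul//; last by move=> j; exact/trig_derive/trig_bas.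
rewrite SE//; apply: eq_bigr => j _.
rewrite mulrC mulrN -mulNr; congr (_ * _).
under eq_Rintegral do rewrite mulrC.
by rewrite fg ?opprK; [apply: eq_Rint => y; rewrite mulrC|exact: trig_bas].
Qed.

Lemma derive2_S nu i n f x : intble mT f ->
  D i (D i (S (upd nu i n.+1) f)) x =
  4 * pi ^+ 2 * n.+1%:R ^+ 2 * (S (upd nu i n) f x - S (upd nu i n.+1) f x).
Proof.
move=> If; set nu1 := upd nu i n.+1.
rewrite (_ : S nu1 f = fun x => \sum_j coef j f * @bas nu1 j x); last first.
  by apply/funext => z; exact: SE.
rewrite (_ : D i _ = fun x => \sum_j coef j f * D i (@bas nu1 j) x); last first.
  by apply/funext => z; rewrite trig_sum_derive//; exact: trig_bas.
rewrite trig_sum_derive; last by move=> j; exact/trig_derive/trig_bas.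
under eq_bigr do rewrite mulrC.
rewrite -Rint_sum_mul//; last exact: trig_bas.
under eq_Rintegral do rewrite derive2_bas derive2_kern -mulrA.
rewrite RintZ; last first.
  under eq_fun do rewrite mulrBl.
  by apply: intbleB; exact: kern_intble.
congr (_ * _); rewrite -(SE nu1 x If) -[RHS]RintB; [|exact: kern_intble|exact: kern_intble].
by apply: eq_Rint => y; rewrite mulrBl.
Qed.

End smoothing.

(** * Convergence of the mollification in L^2 *)

Section approximation.
Context {R : realType} {d : nat}.
Local Notation mT := (torus_measure d : probability 'rV[R]_d R).
Implicit Types (nu : 'I_d -> nat) (x y : 'rV[R]_d) (i : 'I_d)
  (f g h : 'rV[R]_d -> R).

(** Half of the double integral of [kern nu (x - y) (f x - f y) ^ 2], by [Rint_S_sqrB]. In that form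
    it is monotone under pointwise bounds on differences, and it controls the L^2 distance from [f]
    to [S nu f]. *)
Definition defect nu f : R :=
  \int[mT]_x (f x ^+ 2) - \int[mT]_x (f x * S nu f x).

Lemma Rint_S_sqrB nu f : sqint mT f ->
  \int[mT]_x S nu (fun y => (f x - f y) ^+ 2) x = 2 * defect nu f.
Proof.
move=> sf; have If := sqint_intble sf; have [mf If2] := sf.
have IfS : intble mT (fun x => f x * S nu f x) by apply: sqintM => //; exact: S_sqint.
have IS2 : intble mT (S nu (fun y => f y ^+ 2)) by exact: S_intble.
have E x : S nu (fun y => (f x - f y) ^+ 2) x =
    (f x ^+ 2 + (- 2) * (f x * S nu f x)) + S nu (fun y => f y ^+ 2) x.
  rewrite (_ : (fun y => (f x - f y) ^+ 2) =
      (fun y => (f x ^+ 2 + (- 2 * f x) * f y) + f y ^+ 2)); last first.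
    by apply/funext => y; ring.
  have I1 : intble mT (fun y => (- 2 * f x) * f y) by exact: intbleZ.
  have I0 : intble mT (fun=> f x ^+ 2) by exact: intble_cst.
  rewrite S_D//; last exact: intbleD.
  by rewrite S_D// S_cst S_Z// mulrA.
rewrite (eq_Rint _ E) RintD//; last first.
  by apply: intbleD => //; exact: intbleZ.
rewrite RintD//; last exact: intbleZ.
rewrite RintZ// Rint_S// /defect; ring.
Qed.

Lemma S_sqrB_intble nu f : sqint mT f ->
  intble mT (fun x => S nu (fun y => (f x - f y) ^+ 2) x).
Proof.
move=> sf; have If := sqint_intble sf; have [mf If2] := sf.
have IfS : intble mT (fun x => f x * S nu f x) by apply: sqintM => //; exact: S_sqint.
have IS2 : intble mT (S nu (fun y => f y ^+ 2)) by exact: S_intble.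
rewrite (_ : (fun x => _) = fun x =>
    (f x ^+ 2 + (- 2) * (f x * S nu f x)) + S nu (fun y => f y ^+ 2) x).
  by apply: intbleD => //; apply: intbleD => //; exact: intbleZ.
apply/funext => x.
rewrite (_ : (fun y => (f x - f y) ^+ 2) =
    (fun y => (f x ^+ 2 + (- 2 * f x) * f y) + f y ^+ 2)); last first.
  by apply/funext => y; ring.
have I1 : intble mT (fun y => (- 2 * f x) * f y) by exact: intbleZ.
have I0 : intble mT (fun=> f x ^+ 2) by exact: intble_cst.
rewrite S_D//; last exact: intbleD.
by rewrite S_D// S_cst S_Z// mulrA.
Qed.

Lemma sqrB_intble f x : sqint mT f -> intble mT (fun y => (f x - f y) ^+ 2).
Proof. by move=> sf; case: (sqintB (sqint_cst mT (f x)) sf). Qed.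

(** The kernel of the double integral is nonnegative, so a pointwise bound on squared differences
    can be integrated. This reduces unions, sums and limits to elementary inequalities. *)
Lemma defect_le nu (A B : R) f g h : sqint mT f -> sqint mT g -> sqint mT h ->
  (forall x y, (h x - h y) ^+ 2 <= A * (f x - f y) ^+ 2 + B * (g x - g y) ^+ 2) ->
  defect nu h <= A * defect nu f + B * defect nu g.
Proof.
move=> sf sg sh le.
have := Rint_S_sqrB nu sf; have := Rint_S_sqrB nu sg; have := Rint_S_sqrB nu sh.
move: (defect nu f) (defect nu g) (defect nu h) => a b c Ec Eb Ea.
suff : \int[mT]_x S nu (fun y => (h x - h y) ^+ 2) x <=
    A * \int[mT]_x S nu (fun y => (f x - f y) ^+ 2) x +
    B * \int[mT]_x S nu (fun y => (g x - g y) ^+ 2) x.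
  by rewrite Ea Eb Ec (mulrCA A) (mulrCA B) -mulrDr ler_pM2l.
have If := S_sqrB_intble nu sf; have Ig := S_sqrB_intble nu sg.
rewrite -!RintZ// -RintD//; try exact: intbleZ.
apply: le_Rint.
- exact: S_sqrB_intble.
- by apply: intbleD; exact: intbleZ.
- apply: aeW => x.
  have I1 := sqrB_intble x sf; have I2 := sqrB_intble x sg.
  rewrite -!S_Z// -S_D; [|exact: intbleZ|exact: intbleZ].
  apply: S_le; [exact: sqrB_intble|by apply: intbleD; exact: intbleZ|].
  by apply: aeW => y; exact: le.
Qed.

(** [kern_cos2] and the unit mass of every kernel give the mean of [cos ^ 2], namely [1 - a]. *)
Lemma S_sin2 nu i x : S nu (fun y => sin (pi * (x ord0 i - y ord0 i)) ^+ 2) x =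
  (2 * nu i + 2)%:R^-1.
Proof.
set a := (2 * nu i + 2)%:R^-1.
rewrite /S -[RHS](_ : \int[mT]_y (kern nu (x - y)
   - (1 - a) * kern (upd nu i (nu i).+1) (x - y)) = a); last first.
  have It mu : intble mT (fun y => kern mu (x - y)) by exact/trig_intble/trig_kern_sub.
  rewrite RintB//; last exact: intbleZ.
  by rewrite RintZ// !Rint_kern; ring.
apply: eq_Rint => y; rewrite -kern_cos2 !mxE.
have sc := cos2Dsin2 (pi * (x ord0 i - y ord0 i)).
by rewrite (_ : sin _ ^+ 2 = 1 - cos (pi * (x ord0 i - y ord0 i)) ^+ 2); [ring|rewrite -sc; ring].
Qed.

(** [|sin (pi s)|] serves as a periodic distance; for functions that are Lipschitz for it, the
    defect decays like the inverse of the exponents. *)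
Lemma defect_sin nu (L : R) f : sqint mT f ->
  (forall x y, (f x - f y) ^+ 2 <= L * \sum_i sin (pi * (x ord0 i - y ord0 i)) ^+ 2) ->
  2 * defect nu f <= L * \sum_i (2 * nu i + 2)%:R^-1.
Proof.
move=> sf le; rewrite -Rint_S_sqrB//.
have Is x i : intble mT (fun y => sin (pi * (x ord0 i - y ord0 i)) ^+ 2).
  apply: (@intble_bdd _ _ _ _ 1).
    apply: measurable_funX; apply: (measurableT_comp (continuous_measurable_fun (@continuous_sin R))).
    apply: measurable_funM => //; apply: measurable_funB => //.
    exact: measurable_rV_coord.
  move=> y; rewrite normrX expr_le1 // ler_norml.
  by rewrite sin_geN1 sin_le1.
set C := L * _.
rewrite -[leRHS](_ : \int[mT]_x C = C); last first.
  by rewrite Rintegral_cst// [X in fine X](probability_setT mT) mulr1.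
apply: le_Rint; [exact: S_sqrB_intble|exact: intble_cst|].
apply: aeW => x; rewrite /C.
rewrite -[leRHS](_ : S nu (fun y => L * \sum_i sin (pi * (x ord0 i - y ord0 i)) ^+ 2) x = _).
  apply: S_le; [exact: sqrB_intble|by apply/intbleZ/intble_sum|].
  by apply: aeW => y; exact: le.
rewrite S_Z; last exact: intble_sum.
congr (_ * _).
elim: (index_enum 'I_d) => [|i s ih].
  under [X in S _ X _]eq_fun do rewrite big_nil.
  by rewrite S_cst big_nil.
under [X in S _ X _]eq_fun do rewrite big_cons.
rewrite S_D; [|exact: Is|exact: intble_sum].
by rewrite big_cons -ih S_sin2.
Qed.

Lemma defect_le_sqr nu f : sqint mT f -> defect nu f <= \int[mT]_x (f x ^+ 2).
Proof.
move=> sf; have If := sqint_intble sf.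
rewrite /defect gerBl S_pair// sumr_ge0// => j _.
by rewrite -expr2 sqr_ge0.
Qed.

(** The threshold is uniform over all exponents beyond [n0], equal or not, because later they are
    raised one coordinate at a time. *)
Definition smoothable f := forall e : R, 0 < e -> exists n0, forall nu,
  (forall i, (n0 <= nu i)%N) -> defect nu f <= e.

Lemma smoothable_le (A B : R) f g h : 0 <= A -> 0 <= B ->
  sqint mT f -> sqint mT g -> sqint mT h ->
  (forall x y, (h x - h y) ^+ 2 <= A * (f x - f y) ^+ 2 + B * (g x - g y) ^+ 2) ->
  smoothable f -> smoothable g -> smoothable h.
Proof.
move=> A0 B0 sf sg sh le af ag e e0.
have C0 : 0 < A + B + 1 by lra.
have eC : 0 < e / (A + B + 1) by rewrite divr_gt0.
have [m fm] := af _ eC; have [n gn] := ag _ eC.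
exists (maxn m n) => nu mn.
have := fm nu (fun i => leq_trans (leq_maxl m n) (mn i)).
have := gn nu (fun i => leq_trans (leq_maxr m n) (mn i)).
have := defect_le nu sf sg sh le.
set a := defect nu f; set b := defect nu g; set c := e / _ => h1 h2 h3.
have c0 : 0 <= c by exact: ltW.
have -> : e = c * (A + B + 1) by rewrite /c divfK// gt_eqF.
nra.
Qed.

Lemma smoothable_lim (F : nat -> 'rV[R]_d -> R) f :
  (forall n, sqint mT (F n)) -> sqint mT f -> (forall n, smoothable (F n)) ->
  \int[mT]_x ((f x - F n x) ^+ 2) @[n --> \oo] --> (0 : R) -> smoothable f.
Proof.
move=> sF sf aF cvF e e0.
(* Two error terms, each doubled by [(a + b) ^ 2 <= 2 a ^ 2 + 2 b ^ 2]. *)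
have e4 : 0 < e / 4 by lra.
have [n _ nF] : \forall n \near \oo, \int[mT]_x ((f x - F n x) ^+ 2) < e / 4.
  exact: (cvgr_lt _ cvF).
have {}nF := nF n (leqnn n).
have [m Fm] := aF n _ e4.
exists m => nu mnu.
have sfF : sqint mT (fun x => f x - F n x) by exact: sqintB.
have := @defect_le nu 2 2 _ _ _ (sF n) sfF sf.
have -> : (forall x y, (f x - f y) ^+ 2 <=
    2 * (F n x - F n y) ^+ 2 + 2 * (f x - F n x - (f y - F n y)) ^+ 2) <-> True.
  split=> // _ x y.
  set a := F n x - F n y; set b := f x - F n x - _.
  have -> : f x - f y = a + b by rewrite /a /b; ring.
  by have := sqr_ge0 (a - b); nra.
move=> /(_ I); have := defect_le_sqr nu sfF; have := Fm _ mnu.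
move: (defect nu f) (defect nu (F n)) (defect nu _) (\int[_]_x _) nF => a b c k.
by lra.
Qed.

Lemma smoothable_sin (L : R) f : 0 <= L -> sqint mT f ->
  (forall x y, (f x - f y) ^+ 2 <= L * \sum_i sin (pi * (x ord0 i - y ord0 i)) ^+ 2) ->
  smoothable f.
Proof.
move=> L0 sf le e e0.
have [n nL] : exists n, L * d%:R < n%:R * e.
  exists (Num.truncn (L * d%:R / e)).+1; rewrite -ltr_pdivrMr//.
  by have := truncnS_gt (L * d%:R / e).
exists n => nu nnu; have := defect_sin nu sf le.
suff : L * \sum_i (2 * nu i + 2)%:R^-1 <= 2 * e by lra.
have : \sum_i (2 * nu i + 2)%:R^-1 <= \sum_(i < d) (2 * n + 2)%:R^-1 :> R.
  apply: ler_sum => i _; rewrite lef_pV2 ?posrE ?ltr0n ?addn2// ler_nat.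
  by rewrite !ltnS leq_mul.
rewrite sumr_const card_ord => h.
apply: (le_trans (ler_wpM2l L0 h)).
rewrite -[_ *+ d]mulr_natr mulrA mulrAC ler_pdivrMr ?ltr0n ?addn2//.
apply: (le_trans (ltW nL)).
rewrite [n%:R * e]mulrC [2 * e]mulrC -mulrA ler_pM2l// -natrM ler_nat.
by lia.
Qed.

Definition smoothable_set (A : set 'rV[R]_d) := measurable A /\ smoothable \1_A.

Lemma sqint_indic (A : set 'rV[R]_d) : measurable A -> sqint mT \1_A.
Proof.
move=> mA; apply: (@sqint_bdd _ _ _ _ 1) => //.
by move=> x; rewrite indicE; case: (_ \in _); rewrite ?normr1 ?normr0.
Qed.

Lemma smoothable_cst c : smoothable (fun=> c).
Proof.
apply: (@smoothable_sin 0) => //; first exact: sqint_cst.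
by move=> x y; rewrite subrr expr0n mul0r.
Qed.

Lemma sqr_boolC (a b : bool) :
  ((~~ a)%:R - (~~ b)%:R) ^+ 2 <= 1 * (a%:R - b%:R) ^+ 2 + 0 * (a%:R - b%:R) ^+ 2 :> R.
Proof.
rewrite mul1r mul0r addr0.
by case: a; case: b; rewrite /= ?subrr ?subr0 ?sub0r ?sqrrN ?lexx.
Qed.

Lemma sqr_boolU (a b c e : bool) : ((a || b)%:R - (c || e)%:R) ^+ 2 <=
  2 * (a%:R - c%:R) ^+ 2 + 2 * (b%:R - e%:R) ^+ 2 :> R.
Proof.
by case: a; case: b; case: c; case: e;
  rewrite /= ?mulr1n ?mulr0n; lra.
Qed.

Lemma smoothable_setC A : smoothable_set A -> smoothable_set (~` A).
Proof.
move=> [mA aA]; have mcA := measurableC mA; split; first exact: mcA.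
apply: (@smoothable_le 1 0 (\1_A) (\1_A)).
- exact: ler01.
- exact: lexx.
- exact: sqint_indic.
- exact: sqint_indic.
- exact: sqint_indic.
- by move=> x y; rewrite !indicE !in_setC; exact: sqr_boolC.
- exact: aA.
- exact: aA.
Qed.

Lemma smoothable_setU A B : smoothable_set A -> smoothable_set B -> smoothable_set (A `|` B).
Proof.
move=> [mA aA] [mB aB]; have mAB := measurableU _ _ mA mB.
split; first exact: mAB.
apply: (@smoothable_le 2 2 (\1_A) (\1_B)).
- exact: ler0n.
- exact: ler0n.
- exact: sqint_indic.
- exact: sqint_indic.
- exact: sqint_indic.
- by move=> x y; rewrite !indicE !in_setU; exact: sqr_boolU.
- exact: aA.
- exact: aB.
Qed.

Lemma smoothable_ae_lim (F : nat -> 'rV[R]_d -> R) f g :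
  (forall n, sqint mT (F n)) -> sqint mT f -> (forall n, smoothable (F n)) ->
  intble mT g -> (forall n x, (f x - F n x) ^+ 2 <= g x) ->
  (\forall x \ae mT, F n x @[n --> \oo] --> f x) -> smoothable f.
Proof.
move=> sF sf aF Ig Fg cvF; apply: (smoothable_lim sF sf aF).
rewrite -[X in _ --> X](Rintegral0 mT).
apply: (Rint_DCT _ _ Ig).
- move=> n; apply: measurable_funX; apply: measurable_funB.
    exact: sqint_meas sf.
  exact: sqint_meas (sF n).
- exact: measurable_cst.
- apply: filterS cvF => x cvx.
  rewrite -(_ : (f x - f x) ^+ 2 = 0); last by rewrite subrr expr0n.
  under eq_fun do rewrite expr2.
  by rewrite expr2; apply: cvgM; apply: cvgB => //; exact: cvg_cst.
- by move=> n; apply: aeW => x; rewrite ger0_norm ?sqr_ge0.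
Qed.

End approximation.

(** * From coordinate rays to all square-integrable functions *)

Section density.
Import HBSimple HBNNSimple.
Context {R : realType} {d : nat}.
Local Notation mT := (torus_measure d : probability 'rV[R]_d R).
Implicit Types (nu : 'I_d -> nat) (x y : 'rV[R]_d) (i : 'I_d)
  (f g h : 'rV[R]_d -> R).

Definition clamp01 (r : R) : R := Num.max 0 (Num.min 1 r).

Lemma clamp01_ge0 r : 0 <= clamp01 r.
Proof. by rewrite /clamp01 le_max lexx. Qed.

Lemma clamp01_le1 r : clamp01 r <= 1.
Proof. by rewrite /clamp01 ge_max ler01 ge_min lexx. Qed.

Lemma clamp01_0 r : r <= 0 -> clamp01 r = 0.
Proof. by move=> r0; rewrite /clamp01 max_l// ge_min r0 orbT. Qed.

Lemma clamp01_1 r : 1 <= r -> clamp01 r = 1.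
Proof. by move=> r1; rewrite /clamp01 min_l// max_r// ler01. Qed.

Lemma clamp01_id r : 0 <= r <= 1 -> clamp01 r = r.
Proof. by move=> /andP[r0 r1]; rewrite /clamp01 min_r// max_r. Qed.

Lemma clamp01_sqrB r s : (clamp01 r - clamp01 s) ^+ 2 <= (r - s) ^+ 2.
Proof.
have le a b : a <= b -> 0 <= clamp01 b - clamp01 a <= b - a.
  move=> ab; have [a0|a0] := leP a 0.
    rewrite (clamp01_0 a0) subr0 clamp01_ge0/=.
    have [b0|b0] := leP b 0; first by rewrite clamp01_0//; lra.
    have [b1|b1] := leP 1 b; first by rewrite clamp01_1//; lra.
    by rewrite clamp01_id; lra.
  have [b1|b1] := leP 1 b.
    rewrite (clamp01_1 b1) subr_ge0 clamp01_le1/=.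
    have [a1|a1] := leP 1 a; first by rewrite clamp01_1//; lra.
    by rewrite clamp01_id; lra.
  by rewrite !clamp01_id; lra.
have [rs|/ltW sr] := leP r s.
  have := le _ _ rs; move: (clamp01 r) (clamp01 s) => u v /andP[]; nra.
have := le _ _ sr; move: (clamp01 r) (clamp01 s) => u v /andP[]; nra.
Qed.

(* Positive on [0 < s < a], nonpositive on the rest of the period [0 < s < 1]. *)
Definition bump (a s : R) : R := sin (pi * s) * sin (pi * (a - s)).

(** By product-to-sum formulas, [bump a s] is [(cos (2 pi s - pi a) - cos (pi a)) / 2]; a difference
    of two such cosines factors, and one of the two sines is bounded by one. *)
Lemma bump_sqrB a s t : (bump a s - bump a t) ^+ 2 <= sin (pi * (s - t)) ^+ 2.
Proof.
have prodE u v : 2 * (sin u * sin v) = cos (u - v) - cos (u + v) :> R.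
  by rewrite cosB cosD; ring.
have -> : bump a s - bump a t = sin (pi * (s - t)) * sin (pi * a - pi * (s + t)).
  have h1 := prodE (pi * s) (pi * (a - s)).
  have h2 := prodE (pi * t) (pi * (a - t)).
  have h3 := prodE (pi * (s - t)) (pi * a - pi * (s + t)).
  have e1 : pi * s + pi * (a - s) = pi * a by ring.
  have e2 : pi * t + pi * (a - t) = pi * a by ring.
  have e3 : pi * s - pi * (a - s) = pi * (s - t) - (pi * a - pi * (s + t)) by ring.
  have e4 : pi * t - pi * (a - t) = - (pi * (s - t) + (pi * a - pi * (s + t))) by ring.
  rewrite e1 e3 in h1; rewrite e2 e4 cosN in h2.
  rewrite /bump; lra.
by rewrite exprMn ler_piMr ?sqr_ge0// expr_le1// ler_norml.
Qed.

Lemma bump_gt0 a s : 0 < s < a -> a <= 1 -> 0 < bump a s.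
Proof.
move=> /andP[s0 sa] a1; have p0 := pi_gt0 R.
by rewrite mulr_gt0// sin_gt0_pi// ?mulr_gt0 ?subr_gt0//= gtr_pMr//; lra.
Qed.

Lemma bump_le0 a s : 0 <= a -> 0 < s < 1 -> a <= s -> bump a s <= 0.
Proof.
move=> a0 /andP[s0 s1] sa; have p0 := pi_gt0 R.
rewrite /bump -[a - s]opprB mulrN sinN mulrN oppr_le0 mulr_ge0//.
  by apply: sin_ge0_pi; apply/andP; split; nra.
by apply: sin_ge0_pi; apply/andP; split; nra.
Qed.

(** The clamped multiples of [bump] are Lipschitz for the periodic distance and tend to the
    indicator of the ray inside one open period. *)
Lemma smoothable_ray i (a : R) : smoothable_set [set x : 'rV[R]_d | x ord0 i < a].
Proof.
have mcoor := @measurable_rV_coord _ R d i.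
have mA : measurable [set x : 'rV[R]_d | x ord0 i < a].
  rewrite (_ : mkset _ = (fun x : 'rV[R]_d => x ord0 i) @^-1` `]-oo, a[%classic).
    by rewrite -[X in measurable X]setTI; exact: mcoor.
  by apply/seteqP; split => x /=; rewrite in_itv.
split=> //.
(* Inside the open cube the ray of [a] is the ray of its clamp, for which the sign of [bump] is
   known. *)
pose b := clamp01 a.
pose F (m : nat) x := clamp01 (m%:R * bump b (x ord0 i)).
have mF m : measurable_fun setT (F m).
  apply: measurable_maxr => //; apply: measurable_minr => //.
  apply: measurable_funM => //; apply: measurable_funM.
    apply: (measurableT_comp (continuous_measurable_fun (@continuous_sin R))).
    exact: measurable_funM.
  apply: (measurableT_comp (continuous_measurable_fun (@continuous_sin R))).
  by apply: measurable_funM => //; exact: measurable_funB.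
have sF m : sqint mT (F m).
  apply: (@sqint_bdd _ _ _ _ 1) => // x.
  by rewrite ger0_norm ?clamp01_ge0 ?clamp01_le1.
apply: (@smoothable_ae_lim _ _ F _ (fun=> 1)) => //.
- exact: sqint_indic.
- move=> m; apply: (@smoothable_sin _ _ (m%:R ^+ 2)); [exact: sqr_ge0|exact: sF|].
  move=> x y; apply: (le_trans (clamp01_sqrB _ _)).
  rewrite -mulrBr exprMn ler_wpM2l ?sqr_ge0//.
  apply: (le_trans (bump_sqrB _ _ _)).
  by rewrite (bigD1 i)//= lerDl sumr_ge0// => j _; exact: sqr_ge0.
- exact: intble_cst.
- move=> m x; have := clamp01_ge0 (m%:R * bump b (x ord0 i)).
  have := clamp01_le1 (m%:R * bump b (x ord0 i)).
  rewrite -/(F m x) indicE.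
  by case: (_ \in _); rewrite ?mulr1n ?mulr0n; set u := F m x; nra.
apply: filterS (torus_coord_oo i) => x x01.
have b0 : 0 <= b := clamp01_ge0 a; have b1 : b <= 1 := clamp01_le1 a.
have xab : (x ord0 i < a) = (x ord0 i < b).
  have /andP[x0 x1] := x01; rewrite /b /clamp01.
  by rewrite lt_max lt_min x1 /= (ltNge _ 0) (ltW x0).
have [xa|xa] := ltP (x ord0 i) a.
  rewrite indicE mem_set//=; rewrite xab in xa.
  have g0 : 0 < bump b (x ord0 i) by apply: bump_gt0 => //; case/andP: x01 => ->.
  apply: cvg_near_cst; near=> m.
  apply: clamp01_1; rewrite -ler_pdivrMr//.
  by near: m; exact: nbhs_infty_ger.
rewrite indicE memNset//=; last by apply/negP; rewrite -leNgt.
apply: cvg_near_cst; apply: nearW => m; apply: clamp01_0.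
rewrite mulr_ge0_le0//; apply: bump_le0 => //.
by rewrite leNgt -xab -leNgt.
Unshelve. all: by end_near. Qed.

Lemma smoothable_bigcup (F : (set 'rV[R]_d)^nat) :
  (forall n, smoothable_set (F n)) -> smoothable_set (\bigcup_n F n).
Proof.
move=> aF; pose G n := \big[setU/set0]_(k < n) F k.
have aG n : smoothable_set (G n).
  elim: n => [|n ih]; rewrite /G ?big_ord0 ?big_ord_recr /=.
    split=> //; rewrite indic0; exact: smoothable_cst.
  by apply: smoothable_setU; [exact: ih|exact: aF].
have mG : measurable (\bigcup_n F n).
  by apply: bigcupT_measurable => n; case: (aF n).
split=> //; apply: (@smoothable_ae_lim _ _ (fun n => \1_(G n)) _ (fun=> 1)).
- by move=> n; apply: sqint_indic; case: (aG n).
- exact: sqint_indic.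
- by move=> n; case: (aG n).
- exact: intble_cst.
- move=> n x; rewrite !indicE.
  by do 2 case: (_ \in _); rewrite /= ?mulr1n ?mulr0n; lra.
apply: aeW => x; have [[n _ Fnx]|nFx] := pselect ((\bigcup_n F n) x).
  rewrite [X in _ --> X]indicE mem_set; last by exists n.
  apply: cvg_near_cst; exists n.+1 => // m /= nm.
  rewrite indicE mem_set// /G -bigcup_mkord; exists n => //=.
rewrite [X in _ --> X]indicE memNset//.
apply: cvg_near_cst; apply: nearW => m.
rewrite indicE memNset// /G -bigcup_mkord => -[k _ Fkx].
by apply: nFx; exists k.
Qed.

(** The smoothable sets form a sigma-algebra containing the coordinate rays, and these generate the
    measurable sets. *)
Lemma smoothable_measurable (A : set 'rV[R]_d) : measurable A -> smoothable_set A.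
Proof.
suff : measurable `<=` @smoothable_set R d by apply.
have sigma : sigma_algebra setT (@smoothable_set R d).
  split.
  - by split=> //; rewrite indic0; exact: smoothable_cst.
  - by move=> B aB; rewrite setTD; exact: smoothable_setC.
  - exact: smoothable_bigcup.
apply: smallest_sub => //.
rewrite -bigcup_seq; apply: bigcup_sub => i _ B /= [C mC <-]; rewrite setTI.
suff : measurable `<=` [set C : set R | smoothable_set ((fun x : 'rV[R]_d => x ord0 i) @^-1` C)].
  by apply.
rewrite [X in X `<=` _]RGenInftyO.measurableE.
apply: smallest_sub => /=.
- split => /=.
  + by rewrite preimage_set0; case: sigma.
  + move=> D aD; rewrite setTD preimage_setC; exact: smoothable_setC.
  + move=> F aF; rewrite preimage_bigcup; exact: smoothable_bigcup.
- move=> _ [a ->] /=.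
  rewrite (_ : _ @^-1` _ = [set x : 'rV[R]_d | x ord0 i < a]); first exact: smoothable_ray.
  by apply/seteqP; split => x /=; rewrite in_itv.
Qed.

Lemma smoothableD f g : sqint mT f -> sqint mT g -> smoothable f -> smoothable g ->
  smoothable (fun x => f x + g x).
Proof.
move=> sf sg af ag; apply: (@smoothable_le _ _ 2 2 f g _ (ler0n _ 2) (ler0n _ 2) sf sg (sqintD sf sg) _ af ag).
move=> x y; set a := f x - f y; set b := g x - g y.
rewrite (_ : _ - _ = a + b); last by rewrite /a /b; ring.
by have := sqr_ge0 (a - b); nra.
Qed.

Lemma smoothableZ c f : sqint mT f -> smoothable f -> smoothable (fun x => c * f x).
Proof.
move=> sf af; apply: (@smoothable_le _ _ (c ^+ 2) 0 f f _ (sqr_ge0 c) (lexx 0) sf sf (sqintZ c sf) _ af af).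
by move=> x y; rewrite -mulrBr exprMn mul0r addr0.
Qed.

Lemma smoothable_sfun (f : {sfun 'rV[R]_d >-> R}) :
  smoothable (fun x : 'rV[R]_d => f x).
Proof.
rewrite (_ : (fun x => _) = fun x =>
   \sum_(r <- finmap.enum_fset (fset_set (range f))) (r * \1_(f @^-1` [set r]) x)); last first.
  by apply/funext => x; rewrite fimfunE fsbig_finite.
have mP r : measurable (f @^-1` [set r]) by rewrite -[X in measurable X]setTI; exact: measurable_funP.
elim: (finmap.enum_fset _) => [|k s ih].
  by under eq_fun do rewrite big_nil; exact: smoothable_cst.
under eq_fun do rewrite big_cons.
have s1 r : sqint mT (\1_(f @^-1` [set r]) : 'rV[R]_d -> R) by exact: sqint_indic.
apply: smoothableD.
- exact: sqintZ.
- by apply: sqint_sum => j; exact: sqintZ.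
- by apply: smoothableZ; [exact: s1|have [] := smoothable_measurable (mP k)].
- exact: ih.
Qed.

Lemma smoothable_ge0 f : sqint mT f -> (forall x, 0 <= f x) -> smoothable f.
Proof.
move=> sf f0; have [mf If2] := sf.
have mEf : measurable_fun setT (EFin \o f) by exact/measurable_EFinP.
have Ef0 x : setT x -> (0 <= (EFin \o f) x)%E by move=> _; rewrite lee_fin.
pose g n : 'rV[R]_d -> R := nnsfun_approx measurableT mEf n.
have g0 n x : 0 <= g n x by exact: fun_ge0.
have cvg x : g n x @[n --> \oo] --> f x.
  have /fine_cvgP[_] := @cvg_nnsfun_approx _ _ _ _ measurableT _ mEf Ef0 x I.
  exact.
have gf n x : g n x <= f x.
  have nd : nondecreasing_seq (g ^~ x).
    by move=> p q pq; exact/lefP/nd_nnsfun_approx.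
  have := nondecreasing_cvgn_le nd (cvgP _ (cvg x)) n.
  by rewrite (cvg_lim _ (cvg x)).
apply: (@smoothable_ae_lim _ _ g f (fun x => f x ^+ 2)) => //.
- move=> n; apply: (@sqint_le _ _ _ _ _ f) => //.
  by move=> x; rewrite !ger0_norm.
- by move=> n; exact: smoothable_sfun.
- by move=> n x; have := g0 n x; have := gf n x; nra.
- exact: aeW.
Qed.

Theorem smoothable_sqint f : sqint mT f -> smoothable f.
Proof.
move=> sf; have mf := sqint_meas sf.
have mx g : sqint mT g -> sqint mT (fun x => Num.max (g x) 0).
  move=> sg; have mg := sqint_meas sg; apply: (sqint_le _ _ sg).
    exact: measurable_maxr.
  move=> x; rewrite ger0_norm ?le_max ?lexx ?orbT//.
  by rewrite ge_max ler_norm normr_ge0.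
have mx0 g x : 0 <= Num.max (g x) (0 : R) by rewrite le_max lexx orbT.
rewrite (_ : f = fun x => Num.max (f x) 0 + (-1) * Num.max (- f x) 0); last first.
  apply/funext => x; rewrite /Num.max /Order.max oppr_lt0.
  by case: ltP => h; case: ltP => h'; lra.
have s1 := mx _ sf; have s2 := mx _ (sqintN sf).
have a1 : smoothable (fun x => Num.max (f x) 0).
  by apply: smoothable_ge0 => [|x]; [exact: s1|exact: mx0].
have a2 : smoothable (fun x => Num.max (- f x) 0).
  by apply: smoothable_ge0 => [|x]; [exact: s2|exact: (mx0 (fun x => - f x))].
apply: smoothableD; [exact: s1|exact: sqintZ|exact: a1|].
by apply: smoothableZ; [exact: s2|exact: a2].
Qed.

(** Because [S] is a contraction, expanding the square bounds the squared L^2 distance by twice the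
    defect. *)
Lemma S_cvg f (e : R) : sqint mT f -> 0 < e -> exists n0, forall nu,
  (forall i, (n0 <= nu i)%N) -> \int[mT]_x ((S nu f x - f x) ^+ 2) <= e.
Proof.
move=> sf e0; have e2 : 0 < e / 2 by lra.
have [n0 h] := smoothable_sqint sf e2; exists n0 => nu nun.
have := h nu nun; rewrite /defect => hd.
have If := sqint_intble sf; have sS := S_sqint nu If.
have Ip : intble mT (fun x => f x * S nu f x) by exact: sqintM.
have I1 : intble mT (fun x => f x ^+ 2) by case: sf.
have I2 : intble mT (fun x => S nu f x ^+ 2) by case: sS.
have -> : \int[mT]_x ((S nu f x - f x) ^+ 2) =
  (\int[mT]_x (S nu f x ^+ 2) + (-2) * \int[mT]_x (f x * S nu f x)) + \int[mT]_x (f x ^+ 2).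
  rewrite -RintZ// -RintD//; last exact: intbleZ.
  rewrite -RintD//; last by apply: intbleD => //; exact: intbleZ.
  by apply: eq_Rint => x; ring.
have := S_contract nu sf.
by move: (\int[mT]_x (S nu f x ^+ 2)) hd; move: (\int[mT]_x _) (\int[mT]_x _) => a b k; lra.
Qed.

End density.

(** * Limits of real sequences, and derivatives from quadratic remainders *)

Section sequences.
Context {R : realType}.

Lemma cvg_sqr_le (u e : nat -> R) (l c : R) :
  (forall n, (u n - l) ^+ 2 <= c * e n) -> e n @[n --> \oo] --> (0 : R) ->
  u n @[n --> \oo] --> l.
Proof.
move=> ue e0; apply/cvgrPdist_le => eps eps0.
have ce0 : c * e n @[n --> \oo] --> (0 : R).
  by rewrite -(mulr0 c); apply: cvgM => //; exact: cvg_cst.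
have eps2 : 0 < eps ^+ 2 by rewrite exprn_gt0.
near=> n.
have : c * e n < eps ^+ 2 by near: n; exact: (cvgr_lt _ ce0).
move=> /(le_lt_trans (ue n)) h.
have h2 : `|u n - l| ^+ 2 < eps ^+ 2 by rewrite real_normK ?num_real.
rewrite distrC; apply: ltW; move: h2.
by rewrite ltr_pXn2r// ?nnegrE// ltW.
Unshelve. all: by end_near. Qed.

Lemma cvg0_le (u e : nat -> R) :
  (forall n, 0 <= u n <= e n) -> e n @[n --> \oo] --> (0 : R) ->
  u n @[n --> \oo] --> (0 : R).
Proof.
move=> ue e0; apply: (squeeze_cvgr _ (cvg_cst 0) e0).
exact: nearW.
Qed.

(** Piecewise defined functions are differentiated at their kinks by one remainder estimate instead
    of one-sided limits. Asking for it only when [|b - a| <= 1] lets cubic remainders count as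
    quadratic. *)
Lemma taylor_is_derive (p : R -> R) (a p' C : R) :
  (forall b, `|b - a| <= 1 -> `|p b - p a - p' * (b - a)| <= C * (b - a) ^+ 2) ->
  is_derive a 1 p p'.
Proof.
move=> hp; have C0 : 0 <= C.
  have := hp (a + 1); rewrite addrC addKr normr1 expr1n !mulr1 => /(_ (lexx 1)).
  exact: le_trans.
have cv : (fun h => h^-1 *: ((p \o shift a) (h *: (1 : R)) - p a)) @ 0^' --> p'.
  apply/cvgrPdist_le => e e0; near=> h.
  have h0 : h != 0 by near: h; exact: nbhs_dnbhs_neq.
  have h1 : `|h| <= 1.
    near: h; apply: dnbhs0_le => //.
  have hC : `|h| <= e / (C + 1).
    by near: h; apply: dnbhs0_le; rewrite divr_gt0// ltr_wpDl.
  have := hp (h + a); rewrite addrK => /(_ h1) hh.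
  rewrite /= [h *: _]mulr1 distrC.
  have -> : h^-1 *: (p (h + a) - p a) - p' = h^-1 * (p (h + a) - p a - p' * h).
    by rewrite /GRing.scale /=; field.
  rewrite normrM normfV ler_pdivrMl ?normr_gt0//.
  apply: (le_trans hh); rewrite -[h ^+ 2]real_normK ?num_real// expr2 mulrCA.
  rewrite ler_wpM2l//; move: hC; rewrite ler_pdivlMr ?ltr_wpDl// => hC.
  have := normr_ge0 h; nra.
split; first by apply/cvg_ex; exists p'.
exact: (cvg_lim _ cv).
Unshelve. all: by end_near. Qed.

Lemma continuous_itv_bounded (p : R -> R) (M : R) : continuous p ->
  exists C, forall s, `|s| <= M -> `|p s| <= C.
Proof.
move=> cp; have [M0|M0] := ltP M 0.
  by exists 0 => s sM; have := le_lt_trans sM M0; rewrite normr_lt0.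
have [//||x _ px] := @EVT_max R (fun s => `|p s|) (- M) M.
- by lra.
- apply: continuous_subspaceT => s.
  by apply: (@continuous_comp _ _ _ p (fun r : R => `|r|)); [exact: cp|exact: norm_continuous].
by exists `|p x| => s; rewrite ler_norml => sM; apply: px; rewrite in_itv.
Qed.

End sequences.

(** * Convergence of integrals of products of mollified functions *)

Section convergence.
Context {R : realType} {d : nat}.
Local Notation mT := (torus_measure d : probability 'rV[R]_d R).
Local Notation D i u := ('D_(delta_mx ord0 i) u).
Implicit Types (nu : 'I_d -> nat) (x y : 'rV[R]_d) (i : 'I_d)
  (f g h : 'rV[R]_d -> R).

Lemma S_cvg_seq (nu : nat -> 'I_d -> nat) f : (forall n i, (n <= nu n i)%N) ->
  sqint mT f -> \int[mT]_x ((S (nu n) f x - f x) ^+ 2) @[n --> \oo] --> (0 : R).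
Proof.
move=> nun sf; apply/cvgrPdist_le => e e0.
have [n0 hn0] := S_cvg sf e0; exists n0 => // n /= n0n.
rewrite sub0r normrN ger0_norm; last by apply: Rint_ge0 => x; exact: sqr_ge0.
by apply: hn0 => i; exact: leq_trans (nun n i).
Qed.

Lemma S_pair_cvg (nu : nat -> 'I_d -> nat) f g : (forall n i, (n <= nu n i)%N) ->
  sqint mT f -> sqint mT g ->
  \int[mT]_x (g x * S (nu n) f x) @[n --> \oo] --> \int[mT]_x (g x * f x).
Proof.
move=> nun sf sg; apply: (cvg_sqr_le _ (S_cvg_seq nun sf)) => n.
have sS := S_sqint (nu n) (sqint_intble sf).
rewrite -RintB; [|exact: sqintM|exact: sqintM].
rewrite (eq_Rint mT (fun x => esym (mulrBr (g x) _ _))).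
by apply: Rint_CS => //; exact: sqintB.
Qed.

Lemma intble_trunc (L : 'rV[R]_d -> R) (e : R) : intble mT L -> 0 < e ->
  exists (k : R) (Lk : 'rV[R]_d -> R), [/\ measurable_fun setT Lk,
    forall x, `|Lk x| <= k & \int[mT]_x `|L x - Lk x| <= e].
Proof.
move=> IL e0; have mL := intble_meas IL.
pose F (n : nat) x : R := Num.max (- n%:R) (Num.min n%:R (L x)).
have mF n : measurable_fun setT (F n).
  by apply: measurable_maxr => //; exact: measurable_minr.
have Fle n x : `|F n x| <= n%:R.
  rewrite ler_norml /F le_max lexx /= ge_max ge_min lexx /= andbT.
  by rewrite (@le_trans _ _ 0) // oppr_le0.
have Fid n x : `|L x| <= n%:R -> F n x = L x.
  by rewrite ler_norml /F => /andP[h1 h2]; rewrite min_r// max_r.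
have LF n x : `|L x - F n x| <= `|L x|.
  have n0 : 0 <= n%:R :> R by [].
  have [h|h] := leP `|L x| n%:R; first by rewrite Fid// subrr normr0.
  move: h; rewrite lter_normr => /orP[h|h].
    have -> : F n x = n%:R by rewrite /F min_l ?ltW// max_r//; lra.
    by rewrite !ger0_norm; lra.
  have -> : F n x = - n%:R.
    by rewrite /F min_r ?max_l //; lra.
  by rewrite !ler0_norm; lra.
have cv : \int[mT]_x `|L x - F n x| @[n --> \oo] --> (0 : R).
  rewrite -[X in _ --> X](Rintegral0 mT).
  apply: (Rint_DCT _ _ (intble_norm IL)).
  - move=> n; apply: measurableT_comp => //; exact: measurable_funB.
  - exact: measurable_cst.
  - apply: aeW => x; apply: cvg_near_cst; near=> n.
    rewrite Fid ?subrr ?normr0//; near: n; exact: nbhs_infty_ger.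
  - by move=> n; apply: aeW => x; rewrite normr_id.
have [n _ hn] : \forall n \near \oo, \int[mT]_x `|L x - F n x| < e.
  exact: (cvgr_lt _ cv).
by exists n%:R, (F n); split=> //; apply/ltW/hn => /=.
Unshelve. all: by end_near. Qed.

(** [L] is merely integrable, so Cauchy-Schwarz does not apply directly. A bounded truncation of [L]
    is paired with [p n] in L^2; the remainder is small in L^1 and meets the uniform bound [C]. *)
Lemma L1_pair_cvg (p : nat -> 'rV[R]_d -> R) (L : 'rV[R]_d -> R) (C : R) :
  intble mT L -> (forall n, measurable_fun setT (p n)) ->
  (forall n x, `|p n x| <= C) -> \int[mT]_x (p n x ^+ 2) @[n --> \oo] --> (0 : R) ->
  \int[mT]_x (L x * p n x) @[n --> \oo] --> (0 : R).
Proof.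
move=> IL mp pC cvp; apply/cvgrPdist_le => e e0.
have C0 : 0 <= C by exact: le_trans (pC 0%N 0).
have e1 : 0 < e / (2 * (C + 1)) by rewrite divr_gt0// mulr_gt0// ltr_wpDl.
have [k [Lk [mLk Lkk LLk]]] := intble_trunc IL e1.
have sLk : sqint mT Lk by exact: sqint_bdd mLk Lkk.
have sp n : sqint mT (p n) by exact: sqint_bdd (mp n) (pC n).
have cvk : \int[mT]_x (Lk x * p n x) @[n --> \oo] --> (0 : R).
  apply: (cvg_sqr_le _ cvp) => n; rewrite subr0; exact: Rint_CS.
have e2 : 0 < e / 2 by rewrite divr_gt0.
near=> n; rewrite sub0r normrN.
have I1 : intble mT (fun x => (L x - Lk x) * p n x).
  under eq_fun do rewrite mulrC.
  by apply: (intble_bddM (mp n) (pC n)); apply: intbleB => //; exact: sqint_intble.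
have -> : \int[mT]_x (L x * p n x) =
    \int[mT]_x ((L x - Lk x) * p n x) + \int[mT]_x (Lk x * p n x).
  rewrite -RintD//; last exact: sqintM.
  by apply: eq_Rint => x; ring.
have h1 : `|\int[mT]_x (Lk x * p n x)| <= e / 2.
  by near: n; move/cvgrPdist_le : cvk => /(_ _ e2); apply: filterS => m; rewrite sub0r normrN.
have h2 : `|\int[mT]_x ((L x - Lk x) * p n x)| <= e / 2.
  apply: (le_trans (le_norm_Rint I1)).
  have IB : intble mT (fun x => `|L x - Lk x|).
    by apply/intble_norm/intbleB => //; exact: sqint_intble.
  apply: (@le_trans _ _ (C * \int[mT]_x `|L x - Lk x|)).
    rewrite -RintZ//; apply: le_Rint; [exact: intble_norm|exact: intbleZ|].
    by apply: aeW => x; rewrite normrM mulrC ler_wpM2r.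
  apply: (le_trans (ler_wpM2l C0 LLk)).
  rewrite mulrA ler_pdivrMr ?mulr_gt0 ?ltr_wpDl//; nra.
apply: (le_trans (ler_normD _ _)); rewrite [leRHS]splitr; exact: lerD.
Unshelve. all: by end_near. Qed.

Lemma triple_cvg (F G : nat -> 'rV[R]_d -> R) (p : nat -> 'rV[R]_d -> R)
    (f g q : 'rV[R]_d -> R) (A C : R) :
  (forall n, sqint mT (F n)) -> (forall n, sqint mT (G n)) ->
  (forall n, measurable_fun setT (p n)) -> measurable_fun setT q ->
  sqint mT f -> sqint mT g ->
  (forall n x, `|p n x| <= C) -> (forall x, `|q x| <= C) ->
  (forall n, \int[mT]_x (G n x ^+ 2) <= A) ->
  \int[mT]_x ((F n x - f x) ^+ 2) @[n --> \oo] --> (0 : R) ->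
  \int[mT]_x ((G n x - g x) ^+ 2) @[n --> \oo] --> (0 : R) ->
  \int[mT]_x ((p n x - q x) ^+ 2) @[n --> \oo] --> (0 : R) ->
  \int[mT]_x (F n x * (p n x * G n x)) @[n --> \oo] --> \int[mT]_x (f x * (q x * g x)).
Proof.
move=> sF sG mp mq sf sg pC qC GA cF cG cp.
have A0 : 0 <= A by apply: le_trans (GA 0%N); apply: Rint_ge0 => x; exact: sqr_ge0.
have C0 : 0 <= C by exact: le_trans (qC 0).
have spG n : sqint mT (fun x => p n x * G n x) by exact: sqint_bddM (mp n) (pC n) (sG n).
have sqg : sqint mT (fun x => q x * g x) by exact: sqint_bddM mq qC sg.
have sFf n : sqint mT (fun x => F n x - f x) by exact: sqintB.
have sGg n : sqint mT (fun x => G n x - g x) by exact: sqintB.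
have spf n : sqint mT (fun x => p n x * f x) by exact: sqint_bddM (mp n) (pC n) sf.
have mpq n : measurable_fun setT (fun x => p n x - q x) by exact: measurable_funB.
have pqC n x : `|p n x - q x| <= C + C by rewrite (le_trans (ler_normB _ _))// lerD.
have If : intble mT (fun x => f x * g x) by exact: sqintM.
have sqle (u : 'rV[R]_d -> R) n (sv : sqint mT u) :
    \int[mT]_x ((p n x * u x) ^+ 2) <= C ^+ 2 * \int[mT]_x (u x ^+ 2).
  have I1 : intble mT (fun x => u x ^+ 2) by case: sv.
  rewrite -RintZ//; apply: le_Rint; [|exact: intbleZ|].
    by case: (sqint_bddM (mp n) (pC n) sv).
  apply: aeW => x; rewrite exprMn ler_wpM2r ?sqr_ge0//.
  by rewrite -[p n x ^+ 2]real_normK ?num_real// lerXn2r ?nnegrE.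
have c1 : \int[mT]_x ((F n x - f x) * (p n x * G n x)) @[n --> \oo] --> (0 : R).
  apply: (@cvg_sqr_le _ _ _ _ (C ^+ 2 * A) _ cF) => n; rewrite subr0.
  apply: (le_trans (Rint_CS (sFf n) (spG n))).
  rewrite mulrC ler_wpM2r; [by []| by apply: Rint_ge0 => x; exact: sqr_ge0|].
  by apply: (le_trans (sqle _ n (sG n))); rewrite ler_wpM2l ?sqr_ge0.
have c2 : \int[mT]_x ((G n x - g x) * (p n x * f x)) @[n --> \oo] --> (0 : R).
  apply: (@cvg_sqr_le _ _ _ _ (C ^+ 2 * \int[mT]_x (f x ^+ 2)) _ cG) => n; rewrite subr0.
  apply: (le_trans (Rint_CS (sGg n) (spf n))).
  rewrite mulrC ler_wpM2r; [by []| by apply: Rint_ge0 => x; exact: sqr_ge0|].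
  exact: sqle.
(* The product [f * g] is only integrable, hence the truncation argument here, whereas the first two
   terms follow from Cauchy-Schwarz. *)
have c3 : \int[mT]_x ((f x * g x) * (p n x - q x)) @[n --> \oo] --> (0 : R).
  exact: L1_pair_cvg If mpq pqC cp.
rewrite -[X in _ --> X]add0r -[X in _ --> X + _]addr0 -[X in _ --> X + _ + _]addr0.
rewrite (_ : (fun n => _) = fun n => \int[mT]_x ((F n x - f x) * (p n x * G n x)) +
   \int[mT]_x ((G n x - g x) * (p n x * f x)) +
   \int[mT]_x ((f x * g x) * (p n x - q x)) + \int[mT]_x (f x * (q x * g x))).
  by apply: cvgD; [apply: cvgD; [exact: cvgD|]|exact: cvg_cst].
apply/funext => n.
have I1 : intble mT (fun x => (F n x - f x) * (p n x * G n x)) by exact: sqintM.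
have I2 : intble mT (fun x => (G n x - g x) * (p n x * f x)) by exact: sqintM.
have I3 : intble mT (fun x => (f x * g x) * (p n x - q x)).
  under eq_fun do rewrite mulrC.
  exact: intble_bddM (mpq n) (pqC n) If.
have I4 : intble mT (fun x => f x * (q x * g x)) by exact: sqintM.
rewrite -(RintD I1 I2) -(RintD (intbleD I1 I2) I3).
rewrite -(RintD (intbleD (intbleD I1 I2) I3) I4).
by apply: eq_Rint => x; ring.
Qed.

End convergence.

(** Local Lipschitz bounds on [p] and [p'] carry L^2 convergence of bounded functions over to their
    composites. The functions [entropy'] and [flux] have no more regularity: their derivatives
    contain a positive part. *)
Record C11 (R : realType) (p p' : R -> R) := {
  C11_derive : forall s : R, is_derive s 1 p (p' s) ;
  C11_lip : forall M, exists2 L, 0 <= L & forall a b, `|a| <= M -> `|b| <= M ->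
    `|p b - p a| <= L * `|b - a| /\ `|p' b - p' a| <= L * `|b - a| }.

(** * The positive part, the entropy and the flux *)

Section C11_theory.
Context {R : realType}.
Implicit Types p : R -> R.

Lemma lip_continuous p : (forall M, exists2 L, 0 <= L & forall a b,
    `|a| <= M -> `|b| <= M -> `|p b - p a| <= L * `|b - a|) -> continuous p.
Proof.
move=> lp a; have [L L0 La] := lp (`|a| + 1).
apply/cvgrPdist_le => e e0.
have nb (e' : R) : 0 < e' -> \forall b \near a, `|a - b| <= e'.
  by move=> e'0; apply/nbhs_ballP; exists e' => //= b; rewrite /ball /= => /ltW.
near=> b.
have ab1 : `|b - a| <= 1.
  by rewrite distrC; near: b; exact: nb.
have abe : `|b - a| <= e / (L + 1).
  rewrite distrC; near: b; apply: nb.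
  by rewrite divr_gt0// ltr_wpDl.
have a1 : `|a| <= `|a| + 1 by rewrite lerDl.
have b1 : `|b| <= `|a| + 1.
  have -> : b = a + (b - a) by ring.
  by rewrite (le_trans (ler_normD _ _))// lerD2l.
rewrite distrC; apply: (le_trans (La _ _ a1 b1)).
move: abe; rewrite ler_pdivlMr ?ltr_wpDl// => abe.
have := normr_ge0 (b - a); nra.
Unshelve. all: by end_near. Qed.

Lemma C11_continuous p p' : C11 p p' -> continuous p.
Proof.
move=> h; apply: lip_continuous => M; have [L L0 hL] := C11_lip h M.
by exists L => // a b aM bM; have [] := hL a b aM bM.
Qed.

Lemma C11_continuous' p p' : C11 p p' -> continuous p'.
Proof.
move=> h; apply: lip_continuous => M; have [L L0 hL] := C11_lip h M.
by exists L => // a b aM bM; have [] := hL a b aM bM.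
Qed.

Variable alpha : R.

Definition ppart (s : R) : R := Num.max 0 (alpha - s).

Lemma ppart_ge0 s : 0 <= ppart s.
Proof. by rewrite /ppart le_max lexx. Qed.

Variant ppart_spec (s : R) : R -> Prop :=
| PpartPos of s <= alpha : ppart_spec s (alpha - s)
| PpartNeg of alpha <= s : ppart_spec s 0.

Lemma ppartP s : ppart_spec s (ppart s).
Proof.
rewrite /ppart; have [h|h] := leP s alpha.
  by rewrite max_r ?subr_ge0//; constructor.
by rewrite max_l; [constructor; exact: ltW|rewrite subr_le0 ltW].
Qed.

Lemma ppart_lip a b : `|ppart b - ppart a| <= `|b - a|.
Proof.
rewrite ler_norml; case: ppartP => ha; case: ppartP => hb;
  have := ler_norm (b - a); have := ler_norm (a - b); rewrite (distrC a b);
  by move=> h1 h2; apply/andP; split; lra.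
Qed.

Lemma ppart_le s : ppart s <= `|alpha| + `|s|.
Proof.
case: ppartP => h; last by rewrite addr_ge0.
have := ler_norm alpha; have := ler_norm (- s); rewrite normrN; lra.
Qed.

(** The second factor vanishes when both points lie left of the kink, and [ppart a] vanishes when
    [a] lies right of it; when the kink separates [a] from [b] with [a] on the left, both factors
    are at most [|b - a|]. *)
Lemma taylor_ppart1 a b :
  `|ppart a * (ppart b - ppart a + (b - a))| <= (b - a) ^+ 2.
Proof.
have s0 := sqr_ge0 (b - a); rewrite ler_norml.
case: (ppartP a) => ha; last by rewrite mul0r oppr_le0 s0.
case: (ppartP b) => hb.
  by rewrite (_ : alpha - b - _ + _ = 0) ?mulr0 ?oppr_le0 ?s0//; ring.
rewrite (_ : 0 - _ + _ = b - alpha); last by ring.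
have x0 : 0 <= alpha - a by rewrite subr_ge0.
have y0 : 0 <= b - alpha by rewrite subr_ge0.
rewrite (_ : b - a = (alpha - a) + (b - alpha)) in s0 *; last by ring.
move: (alpha - a) (b - alpha) x0 y0 s0 => x y x0 y0 s0.
have := mulr_ge0 x0 y0; have := sqr_ge0 x; have := sqr_ge0 y.
by move=> h1 h2 h3; apply/andP; split; nra.
Qed.

Lemma taylor_ppart2 a b :
  `|ppart b ^+ 2 - ppart a ^+ 2 - (- 2 * ppart a) * (b - a)| <= 3 * (b - a) ^+ 2.
Proof.
have h1 := taylor_ppart1 a b; have h2 := ppart_lip a b.
rewrite (_ : _ - _ = 2 * (ppart a * (ppart b - ppart a + (b - a))) + (ppart b - ppart a) ^+ 2); last by ring.
apply: (le_trans (ler_normD _ _)); rewrite normrM [`|2|]ger0_norm// normrX.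
have : `|ppart b - ppart a| ^+ 2 <= (b - a) ^+ 2.
  by rewrite -[leRHS]real_normK ?num_real// lerXn2r ?nnegrE.
by lra.
Qed.

Lemma taylor_ppart3 a b :
  `|ppart b ^+ 3 - ppart a ^+ 3 - (- 3 * ppart a ^+ 2) * (b - a)|
  <= (6 * ppart a + `|b - a|) * (b - a) ^+ 2.
Proof.
have h1 := taylor_ppart1 a b; have h2 := ppart_lip a b; have a0 := ppart_ge0 a.
have t2 : `|b - a| ^+ 2 = (b - a) ^+ 2 by rewrite real_normK ?num_real.
rewrite -t2 in h1 *; move: h1 h2.
set A := ppart a in a0 *; set B := ppart b; set t := `|b - a|; set s := b - a => h1 h2.
have t0 : 0 <= t by exact: normr_ge0.
have -> : B ^+ 3 - A ^+ 3 - (- 3 * A ^+ 2) * s =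
  3 * A * (A * (B - A + s)) + (3 * A * (B - A) ^+ 2 + (B - A) ^+ 3) by ring.
have A30 : 0 <= 3 * A by rewrite mulr_ge0.
have k1 : `|3 * A * (A * (B - A + s))| <= 3 * A * t ^+ 2.
  by rewrite normrM ger0_norm// ler_wpM2l.
have k2 : `|3 * A * (B - A) ^+ 2| <= 3 * A * t ^+ 2.
  rewrite normrM ger0_norm// ler_wpM2l//.
  by rewrite normrX lerXn2r ?nnegrE.
have k3 : `|(B - A) ^+ 3| <= t ^+ 3 by rewrite normrX lerXn2r ?nnegrE.
apply: (le_trans (ler_normD _ _)); apply: (le_trans (lerD k1 (ler_normD _ _))).
apply: (le_trans (lerD (lexx _) (lerD k2 k3))).
by rewrite le_eqVlt; apply/orP; left; apply/eqP; ring.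
Qed.

(* [entropy'] and [entropy''] are the first two derivatives of the convex
   function [entropy], and [flux' s = s * entropy'' s]. *)
Definition entropy (s : R) : R := ppart s ^+ 3 / 6.
Definition entropy' (s : R) : R := - (ppart s ^+ 2 / 2).
Definition entropy'' (s : R) : R := ppart s.
Definition flux (s : R) : R := ppart s ^+ 3 / 3 - alpha * (ppart s ^+ 2 / 2).
Definition flux' (s : R) : R := s * ppart s.

Lemma ppart_lipX2 M a b : `|a| <= M -> `|b| <= M ->
  `|ppart b ^+ 2 - ppart a ^+ 2| <= 2 * (`|alpha| + M) * `|b - a|.
Proof.
move=> aM bM; rewrite subr_sqr normrM mulrC ler_pM//; last exact: ppart_lip.
rewrite ger0_norm ?addr_ge0 ?ppart_ge0//.
have := ppart_le a; have := ppart_le b; lra.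
Qed.

Lemma ppart_lipX3 M a b : `|a| <= M -> `|b| <= M ->
  `|ppart b ^+ 3 - ppart a ^+ 3| <= 3 * (`|alpha| + M) ^+ 2 * `|b - a|.
Proof.
move=> aM bM.
have -> : ppart b ^+ 3 - ppart a ^+ 3 =
  (ppart b ^+ 2 + ppart b * ppart a + ppart a ^+ 2) * (ppart b - ppart a) by ring.
rewrite normrM ler_pM//; last exact: ppart_lip.
have := ppart_le a; have := ppart_le b; have := ppart_ge0 a; have := ppart_ge0 b.
move: (ppart a) (ppart b) (`|alpha|) => A B n B0 A0 hB hA.
rewrite ger0_norm; last by nra.
have {}hB : B <= n + M by lra.
have {}hA : A <= n + M by lra.
nra.
Qed.

Lemma C11_entropy' : C11 entropy' entropy''.
Proof.
split=> [s|M].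
  apply: (@taylor_is_derive _ _ _ _ 2) => b _.
  rewrite (_ : _ - _ - _ = - (2^-1) * (ppart b ^+ 2 - ppart s ^+ 2 - (- 2 * ppart s) * (b - s))).
    rewrite normrM normrN [`|2^-1|]ger0_norm ?invr_ge0//.
    apply: (le_trans (ler_wpM2l _ (taylor_ppart2 s b))); first by rewrite invr_ge0.
    by have := sqr_ge0 (b - s); move: ((b - s) ^+ 2) => q q0; lra.
  by rewrite /entropy' /entropy''; field.
exists (`|alpha| + `|M| + 1) => [|a b aM bM]; first by rewrite !addr_ge0.
have M0 : `|M| = M by rewrite ger0_norm// (le_trans _ aM).
rewrite M0; split.
  have -> : entropy' b - entropy' a = - ((ppart b ^+ 2 - ppart a ^+ 2) / 2).
    by rewrite /entropy'; field.
  rewrite normrN normrM [`|2^-1|]ger0_norm ?invr_ge0//.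
  rewrite ler_pdivrMr//; apply: (le_trans (ppart_lipX2 aM bM)).
  have := normr_ge0 (b - a); nra.
rewrite /entropy''; apply: (le_trans (ppart_lip _ _)).
have := normr_ge0 (b - a); have := normr_ge0 alpha.
have := le_trans (normr_ge0 _) aM; nra.
Qed.

Lemma C11_flux : C11 flux flux'.
Proof.
split=> [s|M].
  (* As [|b - s| <= 1], the cubic remainder contributes at most [2 ppart s + 1 / 3], and the
     quadratic one [3 |alpha| / 2]. *)
  apply: (@taylor_is_derive _ _ _ _ (3 * ppart s + 1 + 2 * `|alpha|)) => b bs.
  rewrite (_ : _ - _ - _ =
    (ppart b ^+ 3 - ppart s ^+ 3 - (- 3 * ppart s ^+ 2) * (b - s)) / 3 +
    - (alpha / 2) * (ppart b ^+ 2 - ppart s ^+ 2 - (- 2 * ppart s) * (b - s))); last first.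
    (* Where [ppart s] is nonzero, [s = alpha - ppart s]; so [flux'] is a polynomial in [ppart s],
       and [flux] is its primitive term by term. *)
    have e : s * ppart s = alpha * ppart s - ppart s ^+ 2.
      by case: ppartP => ?; ring.
    by rewrite /flux /flux' e; field.
  apply: (le_trans (ler_normD _ _)); rewrite !normrM normrN [`|alpha / 2|]normrM.
  rewrite ![`|_^-1|]ger0_norm ?invr_ge0//.
  have h3 := taylor_ppart3 s b; have h2 := taylor_ppart2 s b.
  have s0 := ppart_ge0 s; have b0 := sqr_ge0 (b - s); have n0 := normr_ge0 alpha.
  move: h3 h2 bs n0 s0.
  move: (`|_ - (- 3 * ppart s ^+ 2) * _|) (`|_ - (- 2 * ppart s) * _|) (`|b - s|) => x3 x2 t.
  move: (`|alpha|) (ppart s) ((b - s) ^+ 2) b0 => n A q q0 h3 h2 t1 n0 A0.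
  have k1 : 0 <= n * q by rewrite mulr_ge0.
  have k2 : n * x2 <= n * (3 * q) by rewrite ler_wpM2l.
  have k3 : t * q <= 1 * q by rewrite ler_wpM2r.
  have k4 : 0 <= A * q by rewrite mulr_ge0.
  lra.
exists (3 * (`|alpha| + `|M|) ^+ 2 + `|alpha| * (2 * (`|alpha| + `|M|)) + `|alpha| + 2 * `|M|) => [|a b aM bM].
  have n0 := normr_ge0 alpha; have m0 := normr_ge0 M.
  move: (`|alpha|) (`|M|) n0 m0 => n m n0 m0.
  have := mulr_ge0 n0 m0; have := sqr_ge0 (n + m); have := sqr_ge0 n; nra.
have M0 : `|M| = M by rewrite ger0_norm// (le_trans _ aM).
rewrite M0; split.
  rewrite /flux (_ : _ - _ = (ppart b ^+ 3 - ppart a ^+ 3) / 3 +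
     (- (alpha / 2)) * (ppart b ^+ 2 - ppart a ^+ 2)); last by field.
  apply: (le_trans (ler_normD _ _)).
  rewrite !normrM normrN [`|alpha / 2|]normrM ![`|_^-1|]ger0_norm ?invr_ge0//.
  have h3 := ppart_lipX3 aM bM; have h2 := ppart_lipX2 aM bM.
  have n0 := normr_ge0 alpha; have t0 := normr_ge0 (b - a).
  have {}M0 := le_trans (normr_ge0 _) aM.
  have x30 : 0 <= `|ppart b ^+ 3 - ppart a ^+ 3| by exact: normr_ge0.
  have x20 : 0 <= `|ppart b ^+ 2 - ppart a ^+ 2| by exact: normr_ge0.
  move: (`|ppart b ^+ 3 - _|) (`|ppart b ^+ 2 - _|) h3 h2 x30 x20 => x3 x2.
  move: (`|alpha|) (`|b - a|) n0 t0 => n t n0 t0 h3 h2 x30 x20.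
  have k2 : n * x2 <= n * (2 * (n + M) * t) by rewrite ler_wpM2l.
  have k3 : 0 <= n * x2 by rewrite mulr_ge0.
  have k1 : 0 <= n * t by rewrite mulr_ge0.
  have k4 : 0 <= M * t by rewrite mulr_ge0.
  lra.
rewrite /flux' (_ : _ - _ = b * (ppart b - ppart a) + (b - a) * ppart a); last by ring.
apply: (le_trans (ler_normD _ _)); rewrite !normrM.
have h1 := ppart_lip a b; have h2 := ppart_le a; have a0 := ppart_ge0 a.
rewrite [`|ppart a|]ger0_norm//.
have n0 := normr_ge0 alpha; have t0 := normr_ge0 (b - a).
have b0 := normr_ge0 b; have h0 := normr_ge0 (ppart b - ppart a).
have {}h2 : ppart a <= `|alpha| + M by lra.
move: h1 h0 bM b0; move: (`|ppart b - _|) (`|b|) => x y.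
move: (`|alpha|) (`|b - a|) (ppart a) n0 t0 h2 a0 => n t A n0 t0 h2 a0 h1 h0 bM b0.
have k1 : y * x <= M * t by rewrite ler_pM.
have k2 : t * A <= t * (n + M) by rewrite ler_wpM2l.
have k3 : 0 <= (3 * (n + M) ^+ 2 + n * (2 * (n + M))) * t.
  rewrite mulr_ge0// addr_ge0// mulr_ge0 ?sqr_ge0// mulr_ge0//; lra.
lra.
Qed.

(** The tangent is taken at the end point [b], as the partitions in time require. When
    [A = alpha - a] and [B = alpha - b] are both nonnegative, the inequality reduces to
    [(A - B) ^ 2 (A + 2 B) >= 0]. *)
Lemma entropy_convex a b : entropy b - entropy a <= entropy' b * (b - a).
Proof.
rewrite /entropy /entropy'.
have : 0 <= ppart a ^+ 3 - ppart b ^+ 3 - 3 * ppart b ^+ 2 * (b - a).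
  case: (ppartP a) => ha; case: (ppartP b) => hb.
  - rewrite (_ : _ - _ = (a - b) ^+ 2 * ((alpha - a) + 2 * (alpha - b))); last by ring.
    by rewrite mulr_ge0 ?sqr_ge0//; lra.
  - by rewrite !expr0n /= mulr0 mul0r !subr0 exprn_ge0// subr_ge0.
  - rewrite expr0n /= sub0r (_ : _ - _ = (alpha - b) ^+ 2 * (3 * (a - b) - (alpha - b))); last by ring.
    by rewrite mulr_ge0 ?sqr_ge0//; lra.
  - by rewrite !expr0n /= mulr0 mul0r !subr0.
by lra.
Qed.

Lemma entropy_ge0 a : 0 <= entropy a.
Proof. by rewrite divr_ge0// exprn_ge0// ppart_ge0. Qed.

Lemma entropy_le0 a : entropy a <= 0 -> alpha <= a.
Proof.
rewrite /entropy; case: ppartP => // h; rewrite pmulr_lle0 ?invr_gt0// => h'.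
by rewrite leNgt; apply/negP => aa; move: h'; rewrite leNgt exprn_gt0// subr_gt0.
Qed.

Lemma entropy0 a : alpha <= a -> entropy a = 0.
Proof.
rewrite /entropy => h; suff -> : ppart a = 0 by rewrite expr0n mul0r.
by case: ppartP => // h'; apply/eqP; rewrite subr_eq0; apply/eqP/le_anti/andP.
Qed.

Lemma flux'_ge0 s : 0 <= s -> 0 <= flux' s.
Proof. by move=> s0; rewrite mulr_ge0// ppart_ge0. Qed.

Lemma flux_homo a b : 0 <= a -> a <= b -> flux a <= flux b.
Proof.
move=> a0 ab; rewrite /flux -subr_ge0.
have [B0 A0] : 0 <= ppart b /\ 0 <= ppart a by split; exact: ppart_ge0.
have [aalpha|alphaa] := leP a alpha; last first.
  have z s : alpha <= s -> ppart s = 0.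
    by move=> h; case: ppartP => // h'; apply/eqP; rewrite subr_eq0; apply/eqP/le_anti/andP.
  by rewrite !z ?subrr//; lra.
have BA : ppart b <= ppart a by case: ppartP => hb; case: ppartP => ha; lra.
have Aa : ppart a <= alpha by case: ppartP => ha; lra.
move: (ppart a) (ppart b) B0 A0 BA Aa => A B B0 A0 BA Aa.
(* [0 <= a] gave [A <= alpha]. With [A] in place of [alpha] the expression is
   [(A ^ 2 + A B - 2 B ^ 2) / 6], nonnegative since [B <= A]. *)
have k : 0 <= alpha * (A + B) / 2 - (A ^+ 2 + A * B + B ^+ 2) / 3 by nra.
rewrite (_ : _ - _ = (A - B) * (alpha * (A + B) / 2 - (A ^+ 2 + A * B + B ^+ 2) / 3)); last by field.
by rewrite mulr_ge0// subr_ge0.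
Qed.

End C11_theory.

(** * The chain rule for weak gradients *)

Section chain_rule.
Context {R : realType} {d : nat}.
Local Notation mT := (torus_measure d : probability 'rV[R]_d R).
Local Notation D i u := ('D_(delta_mx ord0 i) u).
Implicit Types (nu : 'I_d -> nat) (x y : 'rV[R]_d) (i : 'I_d)
  (f g h : 'rV[R]_d -> R).

Lemma derive_chain (p p' : R -> R) (v : 'rV[R]_d -> R) i x :
  (forall s : R, is_derive s 1 p (p' s)) -> trig v ->
  is_derive x (delta_mx ord0 i) (fun x => p (v x)) (p' (v x) * D i v x).
Proof.
move=> pp' tv; pose A (s : R) := s *: delta_mx ord0 i + x.
have affA (h : R) : A (h *: 1 + 0) = h *: delta_mx ord0 i + A 0.
  by rewrite /A addr0 scale0r add0r [h *: 1]mulr1.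
have A0 : A 0 = x by rewrite /A scale0r add0r.
have [v1 v2] := @derive_affine R R^o _ A v 0 1 _ affA.
have [u1 u2] := @derive_affine R R^o _ A (fun x => p (v x)) 0 1 _ affA.
rewrite A0 in v1 v2 u1 u2.
have vA : is_derive (0 : R) 1 (v \o A) (D i v x).
  by split=> //; apply/v1; exact: trig_derivable.
have pv : is_derive ((v \o A) 0) 1 p (p' (v x)) by rewrite /= A0; exact: pp'.
have [c1 c2] := is_derive1_comp pv vA.
split; first exact: (u1.1 c1).
by rewrite -u2 [LHS]c2 mulrC.
Qed.

Lemma trig_comp_bounded (p : R -> R) (v : 'rV[R]_d -> R) : continuous p ->
  trig v -> exists C, forall x, `|p (v x)| <= C.
Proof.
move=> cp tv; have [M vM] := trig_bounded tv.
by have [C pC] := continuous_itv_bounded M cp; exists C => x; exact: pC.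
Qed.

Lemma continuous_comp_measurable (p : R -> R) (f : 'rV[R]_d -> R) :
  continuous p -> measurable_fun setT f -> measurable_fun setT (fun x => p (f x)).
Proof.
by move=> cp mf; apply: (measurableT_comp (continuous_measurable_fun cp)).
Qed.

(** [p (v x)] is no longer a trigonometric polynomial, so [torus_ibp] is applied to the product
    [p (v x) * u x], whose derivative is bounded and continuous along lines. *)
Lemma wgrad_chain_trig (p p' : R -> R) (v : 'rV[R]_d -> R) i : C11 p p' ->
  trig v -> wgrad i (fun x => p (v x)) (fun x => p' (v x) * D i v x).
Proof.
move=> pp' tv u tu.
have cp := C11_continuous pp'; have cp' := C11_continuous' pp'.
have tDv := trig_derive (delta_mx ord0 i) tv.
have tDu := trig_derive (delta_mx ord0 i) tu.
have [C1 h1] := trig_comp_bounded cp tv; have [C2 h2] := trig_comp_bounded cp' tv.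
have mp := continuous_comp_measurable cp (trig_measurable tv).
have mp' := continuous_comp_measurable cp' (trig_measurable tv).
have I1 : intble mT (fun x => p (v x) * D i u x).
  exact: intble_bddM mp h1 (trig_intble tDu).
have I2 : intble mT (fun x => p' (v x) * D i v x * u x).
  under eq_fun do rewrite -mulrA.
  exact: intble_bddM mp' h2 (trig_intble (trigM tDv tu)).
apply/eqP; rewrite -addr_eq0 -RintD//; apply/eqP.
pose du x := p (v x) * D i u x + p' (v x) * D i v x * u x.
have [M1 hM1] := trig_bounded tDu; have [M2 hM2] := trig_bounded (trigM tDv tu).
have cA (q : R -> R) (w : 'rV[R]_d -> R) y : continuous q -> trig w ->
    continuous (fun s : R => q (w (s *: delta_mx ord0 i + y))).
  move=> cq tw s.
  apply: (@continuous_comp _ _ _ (fun s : R => w (s *: delta_mx ord0 i + y)) q).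
    exact: line_continuous (trig_continuous tw) s.
  exact: cq.
suff e : (\int[mT]_x (du x)%:E = 0)%E by exact: (congr1 fine e).
apply: (@torus_ibp R d i (fun x => p (v x) * u x) du (C1 * M1 + C2 * M2)).
- exact: (intble_meas (intbleD I1 I2)).
- move=> x; apply: (le_trans (ler_normD _ _)); apply: lerD.
    rewrite normrM.
    exact: (ler_pM (normr_ge0 _) (normr_ge0 _) (h1 x) (hM1 x)).
  rewrite -mulrA normrM.
  exact: (ler_pM (normr_ge0 _) (normr_ge0 _) (h2 x) (hM2 x)).
- move=> y s; rewrite /du.
  have cl w : trig w -> continuous (fun s : R => w (s *: delta_mx ord0 i + y)).
    by move=> tw; exact: line_continuous (trig_continuous tw).
  apply: (@continuousD _ _ _ (fun s : R => p (v (s *: delta_mx ord0 i + y)) * D i u (s *: delta_mx ord0 i + y))).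
    apply: (@continuousM _ _ (fun s : R => p (v (s *: delta_mx ord0 i + y)))).
      exact: (cA p v y cp tv).
    exact: (cl _ tDu).
  apply: (@continuousM _ _ (fun s : R => p' (v (s *: delta_mx ord0 i + y)) * D i v (s *: delta_mx ord0 i + y))).
    apply: (@continuousM _ _ (fun s : R => p' (v (s *: delta_mx ord0 i + y)))).
      exact: (cA p' v y cp' tv).
    exact: (cl _ tDv).
  exact: (cl _ tu).
- move=> x; have [d1 d2] := derive_chain i x (C11_derive pp') tv.
  have du' : derivable u x (delta_mx ord0 i) by exact: trig_derivable.
  split; first exact: (derivableM d1 du').
  rewrite (deriveM d1 du') d2 /du /GRing.scale /=; ring.
- move=> x; have [_ pv] := trig_smooth tv; have [_ pu] := trig_smooth tu.
  by rewrite pv pu.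
Qed.

Lemma S_bounded nu f x M : measurable_fun setT f -> (forall x, `|f x| <= M) ->
  `|S nu f x| <= M.
Proof.
move=> mf fM; have If : intble mT f by exact: intble_bdd mf fM.
rewrite ler_norml; apply/andP; split.
  rewrite -(S_cst nu (- M) x); apply: S_le => //; first exact: intble_cst.
  by apply: aeW => y; have := fM y; rewrite ler_norml => /andP[].
rewrite -(S_cst nu M x); apply: S_le => //; first exact: intble_cst.
by apply: aeW => y; have := fM y; rewrite ler_norml => /andP[].
Qed.

Lemma S_comp_cvg (nu : nat -> 'I_d -> nat) (p : R -> R) f M :
  (forall n i, (n <= nu n i)%N) -> continuous p ->
  (exists2 L, 0 <= L & forall a b, `|a| <= M -> `|b| <= M -> `|p b - p a| <= L * `|b - a|) ->
  measurable_fun setT f -> (forall x, `|f x| <= M) ->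
  \int[mT]_x ((p (S (nu n) f x) - p (f x)) ^+ 2) @[n --> \oo] --> (0 : R).
Proof.
move=> nun cp [L L0 pL] mf fM.
have sf : sqint mT f by exact: sqint_bdd mf fM.
have If := sqint_intble sf.
have cS := S_cvg_seq nun sf.
apply: (@cvg0_le _ _ (fun n => L ^+ 2 * \int[mT]_x ((S (nu n) f x - f x) ^+ 2))).
  move=> n; rewrite Rint_ge0/=; last by move=> x; exact: sqr_ge0.
  have sS : sqint mT (S (nu n) f) by exact: S_sqint.
  have I1 : intble mT (fun x => (S (nu n) f x - f x) ^+ 2).
    by case: (sqintB sS sf).
  have SM x := S_bounded (nu n) x mf fM.
  have le x : (p (S (nu n) f x) - p (f x)) ^+ 2 <= L ^+ 2 * (S (nu n) f x - f x) ^+ 2.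
    rewrite -[leLHS]real_normK ?num_real// -[in leRHS]exprMn.
    rewrite -[leRHS]real_normK ?num_real// lerXn2r ?nnegrE//.
    by rewrite normrM (ger0_norm L0); exact: pL.
  rewrite -RintZ//; apply: le_Rint; [|exact: intbleZ|by apply: aeW].
  apply: (intble_le _ _ (intbleZ (L ^+ 2) I1)).
    apply: measurable_funX; apply: measurable_funB.
      exact: continuous_comp_measurable cp (sqint_meas sS).
    exact: continuous_comp_measurable.
  by move=> x; rewrite ger0_norm ?sqr_ge0.
rewrite -(mulr0 (L ^+ 2)); apply: cvgM => //; exact: cvg_cst.
Qed.

(** The rule holds for [S f], a trigonometric polynomial with derivative [S g], and both sides pass
    to the limit. The bound [M] on [f] is also a bound on [S f], so the local Lipschitz constants of
    [p] and [p'] are fixed. *)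
Lemma wgrad_chain (p p' : R -> R) f g i M : C11 p p' ->
  measurable_fun setT f -> (forall x, `|f x| <= M) -> sqint mT g ->
  wgrad i f g -> wgrad i (fun x => p (f x)) (fun x => p' (f x) * g x).
Proof.
move=> pp' mf fM sg fg u tu.
have cp := C11_continuous pp'; have cp' := C11_continuous' pp'.
have tDu := trig_derive (delta_mx ord0 i) tu.
have sf : sqint mT f by exact: sqint_bdd mf fM.
have If := sqint_intble sf; have Ig := sqint_intble sg.
pose nu (n : nat) (j : 'I_d) := n.
have nun n j : (n <= nu n j)%N by [].
have [L L0 pL] := C11_lip pp' M.
have SM n x := S_bounded (nu n) x mf fM.
have [C1 h1] := continuous_itv_bounded M cp; have [C2 h2] := continuous_itv_bounded M cp'.
have mpS n (q : R -> R) : continuous q -> measurable_fun setT (fun x => q (S (nu n) f x)).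
  by move=> cq; exact: (continuous_comp_measurable cq (trig_measurable (trig_S (nu n) If))).
have mpf (q : R -> R) : continuous q -> measurable_fun setT (fun x => q (f x)).
  by move=> cq; exact: continuous_comp_measurable.
have lim1 : \int[mT]_x (p (S (nu n) f x) * D i u x) @[n --> \oo] -->
    \int[mT]_x (p (f x) * D i u x).
  have cS : \int[mT]_x ((p (S (nu n) f x) - p (f x)) ^+ 2) @[n --> \oo] --> (0 : R).
    apply: (S_comp_cvg nun cp _ mf fM).
    by exists L => // a b aM bM; have [] := pL a b aM bM.
  apply: (@cvg_sqr_le _ _ _ _ (\int[mT]_x (D i u x ^+ 2)) _ cS) => n.
  have s1 : sqint mT (fun x => p (S (nu n) f x)).
    by apply: (sqint_bdd _ (mpS n p cp) (M := C1)) => x; exact: h1.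
  have s2 : sqint mT (fun x => p (f x)).
    by apply: (sqint_bdd _ (mpf p cp) (M := C1)) => x; exact: h1.
  have s3 := trig_sqint tDu.
  rewrite -RintB; [|exact: sqintM|exact: sqintM].
  rewrite (eq_Rint mT (fun x => esym (mulrBl (D i u x) _ _))) mulrC.
  by apply: Rint_CS => //; exact: sqintB.
have lim2 : \int[mT]_x (u x * (p' (S (nu n) f x) * S (nu n) g x)) @[n --> \oo] -->
    \int[mT]_x (u x * (p' (f x) * g x)).
  apply: (@triple_cvg _ _ (fun=> u) _ _ u g (fun x => p' (f x)) (\int[mT]_x (g x ^+ 2)) C2).
  - by move=> _; exact: trig_sqint.
  - by move=> n; exact: S_sqint.
  - by move=> n; exact: mpS.
  - exact: mpf.
  - exact: trig_sqint.
  - exact: sg.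
  - by move=> n x; apply: h2.
  - by move=> x; apply: h2.
  - by move=> n; exact: S_contract.
  - under eq_fun do under eq_Rintegral do rewrite subrr expr0n.
    by rewrite Rintegral0; exact: cvg_cst.
  - exact: S_cvg_seq.
  - apply: (S_comp_cvg nun cp' _ mf fM).
    by exists L => // a b aM bM; have [] := pL a b aM bM.
have eqn n : \int[mT]_x (p (S (nu n) f x) * D i u x) =
    - \int[mT]_x (u x * (p' (S (nu n) f x) * S (nu n) g x)).
  rewrite (wgrad_chain_trig i pp' (trig_S (nu n) If) tu); congr (- _).
  by apply: eq_Rint => x; rewrite (derive_S (nu n) x If Ig fg) mulrC.
have lim3 : \int[mT]_x (p (S (nu n) f x) * D i u x) @[n --> \oo] -->
    - \int[mT]_x (u x * (p' (f x) * g x)).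
  by under eq_fun do rewrite eqn; exact: cvgN.
rewrite -(cvg_lim _ lim1)// (cvg_lim _ lim3)//; congr (- _).
by apply: eq_Rint => x; rewrite mulrC.
Qed.

End chain_rule.

(** * The Euclidean norm, and two facts on real sequences *)

Section euclidean.
Context {R : realType} {d : nat}.
Implicit Types x y : 'rV[R]_d.

Lemma dotxx_ge0 x : 0 <= dot x x.
Proof. by apply: sumr_ge0 => i _; rewrite -expr2 sqr_ge0. Qed.

Lemma enorm_ge0 x : 0 <= enorm x.
Proof. exact: sqrtr_ge0. Qed.

Lemma enorm_sqr x : enorm x ^+ 2 = dot x x.
Proof. by rewrite sqr_sqrtr// dotxx_ge0. Qed.

Lemma dot_le x y : dot x y <= enorm x * enorm y.
Proof.
have quad (s t : R) : 0 <= s ^+ 2 * dot x x + s * t * 2 * dot x y + t ^+ 2 * dot y y.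
  rewrite /dot !mulr_sumr -!big_split /=; apply: sumr_ge0 => i _.
  set a := x ord0 i; set b := y ord0 i.
  by rewrite (_ : _ + _ = (s * a + t * b) ^+ 2) ?sqr_ge0//; ring.
have {}quad (s t : R) : 0 <= s ^+ 2 * enorm x ^+ 2 + s * t * 2 * dot x y + t ^+ 2 * enorm y ^+ 2.
  by rewrite !enorm_sqr.
have := quad (enorm y) (- enorm x).
have ex := enorm_ge0 x; have ey := enorm_ge0 y.
move: (enorm x) (enorm y) (dot x y) ex ey quad => a b c a0 b0 quad.
have [a00|a0'] := eqVneq a 0.
  (* For [a = 0] the form at this point is [- (b ^ 2 + 2) c ^ 2], so [c = 0]; the case [b = 0] is
     symmetric. *)
  move=> _; have h := quad (- (b ^+ 2 + 1)) c; rewrite a00 in h *.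
  have c2 : c ^+ 2 <= 0 by have := sqr_ge0 (c * b); lra.
  by rewrite mul0r (_ : c = 0)//; apply/eqP; rewrite -sqrf_eq0 eq_le c2 sqr_ge0.
have [b00|b0'] := eqVneq b 0.
  move=> _; have h := quad c (- (a ^+ 2 + 1)); rewrite b00 in h *.
  have c2 : c ^+ 2 <= 0 by have := sqr_ge0 (c * a); lra.
  by rewrite mulr0 (_ : c = 0)//; apply/eqP; rewrite -sqrf_eq0 eq_le c2 sqr_ge0.
have ab : 0 < a * b by rewrite mulr_gt0// lt_def ?a0' ?b0'.
by move=> h; rewrite -(ler_pM2l ab); nra.
Qed.

Lemma cvg_sumr I (s : seq I) (F : I -> nat -> R) (l : I -> R) :
  (forall i, F i n @[n --> \oo] --> l i) ->
  \sum_(i <- s) F i n @[n --> \oo] --> \sum_(i <- s) l i.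
Proof.
move=> Fl; elim: s => [|i s ih].
  by under eq_fun do rewrite big_nil; rewrite big_nil; exact: cvg_cst.
by under eq_fun do rewrite big_cons; rewrite big_cons; exact: cvgD.
Qed.

Lemma eventually_increasing_lt (T : nat -> R) (l : R) n0 :
  (forall n, (n0 <= n)%N -> T n < T n.+1) -> T n @[n --> \oo] --> l -> T n0 < l.
Proof.
move=> ltT limT; have ndT m n : (n0 <= m)%N -> (m <= n)%N -> T m <= T n.
  move=> m0; elim: n => [|n ih]; first by rewrite leqn0 => /eqP ->.
  rewrite leq_eqVlt => /predU1P[->//|]; rewrite ltnS => mn.
  by rewrite (le_trans (ih mn))// ltW// ltT// (leq_trans m0).
apply: (lt_le_trans (ltT n0 (leqnn _))).
rewrite -(cvg_lim _ limT)//; apply: limr_ge.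
  by apply/cvg_ex; exists l; exact: limT.
by exists n0.+1 => // n /= nn; exact: ndT.
Qed.

End euclidean.

(** * The inequality at a fixed time *)

Section static.
Context {R : realType} {d : nat}.
Local Notation mT := (torus_measure d : probability 'rV[R]_d R).
Local Notation D i u := ('D_(delta_mx ord0 i) u).
Implicit Types (nu : 'I_d -> nat) (x y : 'rV[R]_d) (i : 'I_d)
  (f g h q : 'rV[R]_d -> R) (z G W V : 'rV[R]_d -> 'rV[R]_d).

Definition Svec nu V x : 'rV[R]_d := \row_i S nu (fun y => V y ord0 i) x.

Lemma SvecE nu V x i : Svec nu V x ord0 i = S nu (fun y => V y ord0 i) x.
Proof. by rewrite mxE. Qed.

Lemma dot_Rint V W : (forall i, intble mT (fun x => V x ord0 i * W x ord0 i)) ->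
  \int[mT]_x dot (V x) (W x) = \sum_i \int[mT]_x (V x ord0 i * W x ord0 i).
Proof. by move=> I; rewrite /dot Rint_sum. Qed.

Lemma dot_intble V W : (forall i, intble mT (fun x => V x ord0 i * W x ord0 i)) ->
  intble mT (fun x => dot (V x) (W x)).
Proof. by move=> I; exact: intble_sum. Qed.

Lemma enorm_measurable V : (forall i, measurable_fun setT (fun x => V x ord0 i)) ->
  measurable_fun setT (fun x => enorm (V x)).
Proof.
move=> mV; apply: (measurableT_comp (f := @Num.sqrt R)).
  by apply: continuous_measurable_fun; exact: sqrt_continuous.
rewrite /dot; elim: (index_enum _) => [|i s ih].
  by under eq_fun do rewrite big_nil; exact: measurable_cst.
under eq_fun do rewrite big_cons.
by apply: measurable_funD => //; apply: measurable_funM; exact: mV.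
Qed.

(** Pairing the average [e] with itself, [|e| ^ 2] is the average of [e . V y], hence at most
    [|e|]. *)
Lemma Svec_le1 nu V x : (forall i, intble mT (fun x => V x ord0 i)) ->
  (\forall y \ae mT, enorm (V y) <= 1) -> enorm (Svec nu V x) <= 1.
Proof.
move=> IV V1; set e := Svec nu V x.
have : dot e e <= enorm e.
  have -> : dot e e = S nu (fun y => dot e (V y)) x.
    rewrite /dot; under eq_bigr => i _ do rewrite [X in _ * X]mxE.
    elim: (index_enum _) => [|i s ih].
      under [X in S _ X _]eq_fun do rewrite big_nil.
      by rewrite S_cst big_nil.
    under [X in S _ X _]eq_fun do rewrite big_cons.
    rewrite S_D; [|exact/intbleZ|by apply: intble_sum => j; exact: intbleZ].
    by rewrite S_Z// big_cons ih.
  rewrite -[leRHS](S_cst nu _ x); apply: S_le; [|exact: intble_cst|].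
    by apply: intble_sum => j; exact: intbleZ.
  apply: filterS V1 => y Vy; apply: (le_trans (dot_le _ _)).
  by rewrite ler_piMr// enorm_ge0.
rewrite -enorm_sqr; have := enorm_ge0 e; nra.
Qed.

Lemma Rint_S_grad f (F : 'rV[R]_d -> 'rV[R]_d) z h : sqint mT f ->
  (forall i, sqint mT (fun x => F x ord0 i)) ->
  (forall i, wgrad i f (fun x => F x ord0 i)) ->
  (forall i, sqint mT (fun x => z x ord0 i)) -> sqint mT h ->
  (forall u, trig u -> \int[mT]_x dot (z x) (grad u x) = - \int[mT]_x (h x * u x)) ->
  forall nu, \int[mT]_x (h x * S nu f x) =
    - \sum_i \int[mT]_x (z x ord0 i * S nu (fun y => F y ord0 i) x).
Proof.
move=> sf sF fF sz sh zh nu; have If := sqint_intble sf.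
have IF i := sqint_intble (sF i).
rewrite -[LHS]opprK -zh; last exact: trig_S.
rewrite dot_Rint; last first.
  move=> i; apply: sqintM => //; rewrite (_ : (fun x => _) = D i (S nu f)).
    exact/trig_sqint/trig_derive/trig_S.
  by apply/funext => x; rewrite mxE.
congr (- _); apply: eq_bigr => i _; apply: eq_Rint => x.
by rewrite mxE (derive_S nu x If (IF i) (fF i)).
Qed.

(** The divergence identity, assumed for trigonometric polynomials, extends to functions with a weak
    gradient: it holds for [S f], and both sides converge. *)
Lemma Rint_grad f (F : 'rV[R]_d -> 'rV[R]_d) z h : sqint mT f ->
  (forall i, sqint mT (fun x => F x ord0 i)) ->
  (forall i, wgrad i f (fun x => F x ord0 i)) ->
  (forall i, sqint mT (fun x => z x ord0 i)) -> sqint mT h ->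
  (forall u, trig u -> \int[mT]_x dot (z x) (grad u x) = - \int[mT]_x (h x * u x)) ->
  \int[mT]_x (h x * f x) = - \int[mT]_x dot (z x) (F x).
Proof.
move=> sf sF fF sz sh zh; pose nu (n : nat) (j : 'I_d) := n.
have nun n j : (n <= nu n j)%N by [].
have lim1 := S_pair_cvg nun sf sh.
have lim2 : - \sum_i \int[mT]_x (z x ord0 i * S (nu n) (fun y => F y ord0 i) x) @[n --> \oo] -->
    - \sum_i \int[mT]_x (z x ord0 i * F x ord0 i).
  apply: cvgN; apply: (cvg_sumr (F := fun i n => \int[mT]_x (z x ord0 i * S (nu n) (fun y => F y ord0 i) x))) => i.
  exact: (S_pair_cvg nun (sF i) (sz i)).
rewrite dot_Rint; last by move=> i; exact: sqintM.
have E : (fun n => \int[mT]_x (h x * S (nu n) f x)) = fun n =>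
    - \sum_i \int[mT]_x (z x ord0 i * S (nu n) (fun y => F y ord0 i) x).
  by apply/funext => n; exact: (Rint_S_grad sf sF fF sz sh zh (nu n)).
by rewrite E in lim1; rewrite -(cvg_lim _ lim1)// (cvg_lim _ lim2).
Qed.

(** Interpolates between all exponents [n] and all exponents [n.+1] by raising the first [m]
    coordinates; [stair n d] is [stair n.+1 0]. *)
Definition stair (n m : nat) : 'I_d -> nat := fun j => if (j < m)%N then n.+1 else n.

Lemma stair_ge n m j : (n <= stair n m j)%N.
Proof. by rewrite /stair; case: ifP. Qed.

Lemma stairS n i : stair n i.+1 = upd (stair n i) i n.+1.
Proof.
apply/funext => j; rewrite /upd /stair ltnS leq_eqVlt.
by have [->|ji] := eqVneq j i; rewrite ?eqxx//= (negbTE (_ : val j != val i)).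
Qed.

Lemma stairE n i : stair n i = upd (stair n i) i n.
Proof.
apply/funext => j; rewrite /upd /stair.
by have [->|//] := eqVneq j i; rewrite ltnn.
Qed.

(* If the limit were positive, [int P (S q)] would eventually increase strictly to
   [int P q] along the exponents [stair n m], one coordinate at a time. *)
Lemma dirichlet_limit P q W (Q : 'rV[R]_d -> 'rV[R]_d) :
  sqint mT P -> sqint mT q ->
  (forall i, sqint mT (fun x => W x ord0 i)) ->
  (forall i, sqint mT (fun x => Q x ord0 i)) ->
  (forall i, wgrad i P (fun x => W x ord0 i)) ->
  (forall i, wgrad i q (fun x => Q x ord0 i)) ->
  (forall nu, \int[mT]_x (P x * q x) <= \int[mT]_x (P x * S nu q x)) ->
  \sum_i \int[mT]_x (W x ord0 i * Q x ord0 i) <= 0.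
Proof.
move=> sP sq sW sQ gP gq le; rewrite leNgt; apply/negP => L0.
have Iq := sqint_intble sq; have IQ i := sqint_intble (sQ i).
pose T n m := \int[mT]_x (P x * S (stair n m) q x).
pose X n i := \int[mT]_x (W x ord0 i * S (stair n i.+1) (fun y => Q y ord0 i) x).
pose K (n : nat) : R := 4 * pi ^+ 2 * n.+1%:R ^+ 2.
have K0 n : 0 < K n by rewrite /K !mulr_gt0 ?exprn_gt0 ?pi_gt0.
have step n (i : 'I_d) : K n * (T n i.+1 - T n i) = X n i.
  have IPS nu : intble mT (fun x => P x * S nu q x) by apply: sqintM => //; exact: S_sqint.
  rewrite -RintB// -RintZ; last exact: intbleB.
  have tS : trig (D i (S (stair n i.+1) q)) by apply: trig_derive; exact: trig_S.
  have := gP i _ tS; rewrite /X => h.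
  (* [derive2_S] expresses the change of exponent as a second derivative of [S q]. One derivative
     goes to [P] as its weak gradient; the other passes through [S] onto [q]. *)
  transitivity (- \int[mT]_x (P x * D i (D i (S (stair n i.+1) q)) x)).
    rewrite -RintN; last by apply: sqintM => //; exact/trig_sqint/trig_derive.
    apply: eq_Rint => x; rewrite stairE stairS derive2_S// -/(K n); ring.
  rewrite h opprK; apply: eq_Rint => x.
  by rewrite (derive_S _ x Iq (IQ i) (gq i)).
(* The factor [K n] is common to the [d] steps of one round. Only the sum over a round is known to
   become positive, so strict growth is obtained from round to round. *)
have tele n : K n * (T n d - T n 0%N) = \sum_i X n i.
  rewrite -(telescope_sumr (T n) (leq0n d)) big_mkord mulr_sumr.
  by apply: eq_bigr => i _; exact: step.
have limX : \sum_i X n i @[n --> \oo] --> \sum_i \int[mT]_x (W x ord0 i * Q x ord0 i).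
  apply: (cvg_sumr (F := fun i n => X n i)) => i; apply: (@S_pair_cvg _ _ (fun n => stair n i.+1)) => // n j.
  exact: stair_ge.
have TS n : T n d = T n.+1 0%N.
  rewrite /T (_ : stair n d = stair n.+1 0)//.
  by apply/funext => j; rewrite /stair ltn_ord ltn0.
have limT : T n 0%N @[n --> \oo] --> \int[mT]_x (P x * q x).
  by apply: (@S_pair_cvg _ _ (fun n => stair n 0)) => // n j; exact: stair_ge.
have [n0 _ incr] : \forall n \near \oo, 0 < \sum_i X n i by exact: (cvgr_gt _ limX).
have ltT n : (n0 <= n)%N -> T n 0%N < T n.+1 0%N.
  by move=> nn; have := incr n nn; rewrite -tele pmulr_rgt0// subr_gt0 TS.
have := eventually_increasing_lt ltT limT; apply/negP; rewrite -leNgt.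
exact: le.
Qed.

(** Expanding the nonnegative double integral of [kern nu (x - y) (f x - f y) (g x - g y)] gives
    twice the difference of the two sides. *)
Lemma S_comonotone nu f g : sqint mT f -> sqint mT g ->
  (forall x y, 0 <= (f x - f y) * (g x - g y)) ->
  \int[mT]_x (f x * S nu g x) <= \int[mT]_x (f x * g x).
Proof.
move=> sf sg fg; have If := sqint_intble sf; have Ig := sqint_intble sg.
have Ifg := sqintM sf sg.
have I1 : intble mT (fun x => f x * S nu g x) by apply: sqintM => //; exact: S_sqint.
have I2 : intble mT (fun x => S nu f x * g x) by apply: sqintM => //; exact: S_sqint.
have I3 : intble mT (S nu (fun y => f y * g y)) by exact: S_intble.
have : 0 <= \int[mT]_x ((f x * g x - f x * S nu g x) - (S nu f x * g x - S nu (fun y => f y * g y) x)).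
  apply: Rint_ge0 => x.
  rewrite (_ : _ - _ = S nu (fun y => (f x - f y) * (g x - g y)) x).
    by apply: Rint_ge0 => y; rewrite mulr_ge0// kern_ge0.
  rewrite (_ : (fun y => (f x - f y) * (g x - g y)) =
      (fun y => (f x * g x - f x * g y) - (g x * f y - f y * g y))); last first.
    by apply/funext => y; ring.
  have I4 : intble mT (fun y => f x * g y) by exact: intbleZ.
  have I5 : intble mT (fun y => g x * f y) by exact: intbleZ.
  have I6 : intble mT (fun=> f x * g x) by exact: intble_cst.
  rewrite (S_B nu x (intbleB I6 I4) (intbleB I5 Ifg)) (S_B nu x I6 I4) (S_B nu x I5 Ifg).
  by rewrite S_cst (S_Z nu (f x) x Ig) (S_Z nu (g x) x If) [g x * _]mulrC.
rewrite (RintB (intbleB Ifg I1) (intbleB I2 I3)) (RintB Ifg I1) (RintB I2 I3).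
rewrite -(S_adj nu Ig If) (Rint_S nu Ifg).
by move: (\int[mT]_x _) (\int[mT]_x _) => a b; lra.
Qed.

(** [fp] may blow up at [c], so it enters only through its monotonicity, by [S_comonotone]. The
    information on [z] is extracted from the total variation hypothesis by testing it with mollified
    unit fields, since the direction of [G] is merely measurable. *)
Theorem static_ineq (c M eps : R) (fp p p' : R -> R) (r h : 'rV[R]_d -> R) z G W :
  0 <= c -> 0 < eps -> measurable_fun setT r -> (forall x, c < r x <= M) ->
  (forall i, sqint mT (fun x => G x ord0 i)) ->
  (forall i, wgrad i r (fun x => G x ord0 i)) ->
  (forall i, sqint mT (fun x => z x ord0 i)) ->
  (\forall x \ae mT, enorm (z x) <= 1) -> sqint mT h ->
  (forall u, trig u -> \int[mT]_x dot (z x) (grad u x) = - \int[mT]_x (h x * u x)) ->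
  (forall V, (forall i, trig (fun x => V x ord0 i)) -> (forall x, enorm (V x) <= 1) ->
    \int[mT]_x (- (r x * div V x)) <= - \int[mT]_x (r x * h x)) ->
  sqint mT (fun x => h x - eps * fp (r x)) ->
  (forall i, sqint mT (fun x => W x ord0 i)) ->
  (forall i, wgrad i (fun x => h x - eps * fp (r x)) (fun x => W x ord0 i)) ->
  (forall a b, c < a -> a <= b -> fp a <= fp b) ->
  C11 p p' -> (forall a b, c < a -> a <= b -> p a <= p b) ->
  (forall a, c < a -> 0 <= p' a) ->
  \sum_i \int[mT]_x (W x ord0 i * (p' (r x) * G x ord0 i)) <= 0.
Proof.
move=> c0 eps0 mr rb sG gr sz z1 sh dz tv sP sW gP fpm pp' pm p'0.
have rM x : `|r x| <= M.
  by have /andP[cr rM] := rb x; rewrite ger0_norm// ltW// (le_lt_trans c0).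
have sr : sqint mT r by exact: sqint_bdd mr rM.
have Ir := sqint_intble sr; have IG i := sqint_intble (sG i).
have Iz i := sqint_intble (sz i).
have mG i := sqint_meas (sG i).
have mnG := enorm_measurable mG.
have G2 : sqint mT (fun x => enorm (G x)).
  split=> //; under eq_fun do rewrite enorm_sqr.
  by apply: dot_intble => i; exact: sqintM.
have IzG : intble mT (fun x => dot (z x) (G x)).
  by apply: dot_intble => i; exact: sqintM.
have E1 : \int[mT]_x (r x * h x) = - \int[mT]_x dot (z x) (G x).
  by rewrite -(Rint_grad sr sG gr sz sh dz); apply: eq_Rint => x; rewrite mulrC.
(* The direction of the gradient; where the gradient vanishes, the convention [0^-1 = 0] gives
   [V = 0]. *)
pose V x : 'rV[R]_d := (enorm (G x))^-1 *: G x.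
have V1 x : enorm (V x) <= 1.
  rewrite -(@ler_pXn2r _ 2) ?nnegrE ?enorm_ge0// expr1n enorm_sqr /dot.
  under eq_bigr do rewrite !mxE mulrACA.
  rewrite -mulr_sumr -/(dot (G x) (G x)) -enorm_sqr -expr2 -exprMn.
  have [->|n0] := eqVneq (enorm (G x)) 0; first by rewrite mulr0 expr0n.
  by rewrite mulVf// expr1n.
have mV i : measurable_fun setT (fun x => V x ord0 i).
  under eq_fun do rewrite mxE -(powR_inv1 (enorm_ge0 _)).
  apply: measurable_funM => //.
  exact: (measurableT_comp (measurable_powR _)).
have V1i i x : `|V x ord0 i| <= 1.
  rewrite -(@ler_pXn2r _ 2) ?nnegrE// expr1n real_normK ?num_real//.
  have : dot (V x) (V x) <= 1 by rewrite -enorm_sqr expr_le1// ?enorm_ge0.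
  apply: le_trans; rewrite /dot (bigD1 i)//= -expr2 lerDl sumr_ge0// => j _.
  by rewrite -expr2 sqr_ge0.
have sV i : sqint mT (fun x => V x ord0 i) by exact: sqint_bdd (mV i) (V1i i).
have IV i := sqint_intble (sV i).
(* The mollified [V] has trigonometric components and norm at most one, so it is admissible in the
   total variation; the derivative in its divergence falls on [r]. *)
have E2 nu : \sum_i \int[mT]_x (G x ord0 i * S nu (fun y => V y ord0 i) x) <=
    \int[mT]_x dot (z x) (G x).
  have tS i : trig (S nu (fun y => V y ord0 i)) by exact: trig_S.
  have Sveci i : (fun x => Svec nu V x ord0 i) = S nu (fun y => V y ord0 i).
    by apply/funext => x; rewrite mxE.
  have tSv i : trig (fun x => Svec nu V x ord0 i) by rewrite Sveci.
  have Sv1 x : enorm (Svec nu V x) <= 1 by apply: Svec_le1 => //; exact: aeW.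
  have := tv _ tSv Sv1; rewrite E1 opprK; apply: le_trans.
  rewrite le_eqVlt; apply/orP; left; apply/eqP.
  have IrD i : intble mT (fun x => r x * D i (S nu (fun y => V y ord0 i)) x).
    by apply: sqintM => //; exact/trig_sqint/trig_derive.
  rewrite (_ : (fun x => - (r x * div (Svec nu V) x)) =
      (fun x => \sum_i - (r x * D i (S nu (fun y => V y ord0 i)) x))); last first.
    apply/funext => x; rewrite /div mulr_sumr -sumrN; apply: eq_bigr => i _.
    by rewrite Sveci.
  rewrite Rint_sum; last by move=> i; exact: intbleN.
  apply: eq_bigr => i _; rewrite RintN// (gr i _ (tS i)) opprK.
  exact: eq_Rint.
have GV x : dot (G x) (V x) = enorm (G x).
  rewrite /dot; under eq_bigr do rewrite mxE mulrCA.
  rewrite -mulr_sumr -/(dot (G x) (G x)) -enorm_sqr expr2 mulrA.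
  have [->|n0] := eqVneq (enorm (G x)) 0; first by rewrite mulr0.
  by rewrite mulVf// mul1r.
have E3 : \int[mT]_x enorm (G x) <= \int[mT]_x dot (z x) (G x).
  pose nu (n : nat) (j : 'I_d) := n.
  have nun n j : (n <= nu n j)%N by [].
  have lim : \sum_i \int[mT]_x (G x ord0 i * S (nu n) (fun y => V y ord0 i) x) @[n --> \oo] -->
      \int[mT]_x enorm (G x).
    rewrite (_ : \int[mT]_x enorm (G x) = \sum_i \int[mT]_x (G x ord0 i * V x ord0 i)).
      apply: (cvg_sumr (F := fun i n => \int[mT]_x (G x ord0 i * S (nu n) (fun y => V y ord0 i) x))) => i.
      exact: (S_pair_cvg nun (sV i) (sG i)).
    rewrite -dot_Rint; last by move=> i; exact: sqintM.
    by apply: eq_Rint => x; rewrite GV.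
  rewrite -(cvg_lim _ lim)//; apply: limr_le.
    by apply/cvg_ex; eexists; exact: lim.
  by apply: nearW => n; exact: E2.
(* [J r = \int |grad r|] forces [z . grad r = |grad r|]. *)
have zG : \forall x \ae mT, enorm (G x) = dot (z x) (G x).
  have IG2 := sqint_intble G2.
  have ge0 : \forall x \ae mT, 0 <= enorm (G x) - dot (z x) (G x).
    apply: filterS z1 => x zx; rewrite subr_ge0 (le_trans (dot_le _ _))//.
    by rewrite ler_piMl// enorm_ge0.
  have := ge0_Rint_eq0 (intbleB IG2 IzG) ge0; rewrite RintB// subr_le0 => /(_ E3).
  by apply: filterS => x /eqP; rewrite subr_eq0 => /eqP.
have cp := C11_continuous pp'; have cp' := C11_continuous' pp'.
have [C1 h1] := continuous_itv_bounded M cp; have [C2 h2] := continuous_itv_bounded M cp'.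
have mpr : measurable_fun setT (fun x => p (r x)) by exact: continuous_comp_measurable.
have mpr' : measurable_fun setT (fun x => p' (r x)) by exact: continuous_comp_measurable.
pose q x := p (r x); pose Q x : 'rV[R]_d := p' (r x) *: G x.
have sq : sqint mT q by apply: (sqint_bdd _ mpr (M := C1)) => x; exact: h1.
have QE i : (fun x => Q x ord0 i) = (fun x => p' (r x) * G x ord0 i).
  by apply/funext => x; rewrite mxE.
have sQ i : sqint mT (fun x => Q x ord0 i).
  by rewrite QE; apply: (sqint_bddM mpr' (M := C2)) => // x; exact: h2.
have gq i : wgrad i q (fun x => Q x ord0 i).
  by rewrite QE; exact: (wgrad_chain pp' mr rM (sG i) (gr i)).
have IQ i := sqint_intble (sQ i).
have dotQ x y : dot y (Q x) = p' (r x) * dot y (G x).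
  by rewrite /dot mulr_sumr; apply: eq_bigr => i _; rewrite mxE mulrCA.
have IpG : intble mT (fun x => p' (r x) * enorm (G x)).
  by apply: (intble_bddM mpr' (M := C2)) => [x|]; [exact: h2|exact: sqint_intble].
have hq nu : \int[mT]_x (h x * q x) <= \int[mT]_x (h x * S nu q x).
  rewrite (Rint_grad sq sQ gq sz sh dz) (Rint_S_grad sq sQ gq sz sh dz) lerN2.
  have -> : \int[mT]_x dot (z x) (Q x) = \int[mT]_x (p' (r x) * enorm (G x)).
    apply: ae_eq_Rint.
    - by apply: intble_meas; apply: dot_intble => i; exact: sqintM.
    - exact: (intble_meas IpG).
    - by apply: filterS zG => x zGx; rewrite dotQ zGx.
  have -> : \sum_i \int[mT]_x (z x ord0 i * S nu (fun y => Q y ord0 i) x) =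
      \int[mT]_x dot (Svec nu z x) (Q x).
    rewrite dot_Rint => [|i].
      apply: eq_bigr => i _; rewrite S_adj//.
      by apply: eq_Rint => x; rewrite SvecE.
    under eq_fun do rewrite SvecE.
    by apply: sqintM => //; exact: S_sqint.
  apply: le_Rint => //.
    apply: dot_intble => i; under eq_fun do rewrite SvecE.
    by apply: sqintM => //; exact: S_sqint.
  apply: aeW => x; rewrite dotQ ler_wpM2l//.
    by apply: p'0; case/andP: (rb x).
  rewrite (le_trans (dot_le _ _))// ler_piMl ?enorm_ge0//.
  exact: Svec_le1.
(* No bound on [fp] near [c] is available; square integrability comes from that of [h] and of
   [h - eps * fp (r x)]. *)
have sfp : sqint mT (fun x => fp (r x)).
  rewrite (_ : (fun x => _) = (fun x => eps^-1 * (h x - (h x - eps * fp (r x))))).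
    by apply/sqintZ/sqintB.
  by apply/funext => x; rewrite subKr mulKf// gt_eqF.
have fq nu : \int[mT]_x (fp (r x) * S nu q x) <= \int[mT]_x (fp (r x) * q x).
  apply: S_comonotone => // x y.
  have /andP[cx _] := rb x; have /andP[cy _] := rb y.
  have [xy|/ltW yx] := leP (r x) (r y).
    by rewrite mulr_le0// subr_le0; [exact: fpm|exact: pm].
  by rewrite mulr_ge0// subr_ge0; [exact: fpm|exact: pm].
rewrite [leLHS](_ : _ = \sum_i \int[mT]_x (W x ord0 i * Q x ord0 i)); last first.
  by apply: eq_bigr => i _; apply: eq_Rint => x; rewrite mxE.
apply: (dirichlet_limit sP sq sW sQ gP gq) => nu.
have split (g : 'rV[R]_d -> R) : sqint mT g ->
    \int[mT]_x ((h x - eps * fp (r x)) * g x) =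
    \int[mT]_x (h x * g x) - eps * \int[mT]_x (fp (r x) * g x).
  move=> sg; have I1 := sqintM sh sg; have I2 := sqintM sfp sg.
  rewrite -(RintZ _ I2) -(RintB I1 (intbleZ eps I2)).
  by apply: eq_Rint => x; ring.
rewrite (split _ sq) (split _ (S_sqint nu (sqint_intble sq))).
apply: lerB; first exact: hq.
by rewrite ler_pM2l.
Qed.

End static.

(** * The equation in time *)

Section flat.
Context {R : realType}.

(* The derivatives of [exp (- 1 / s)] for [s > 0] are [P (1 / s) exp (- 1 / s)],
   [P] a polynomial. *)
Definition flat (P : {poly R}) (s : R) : R :=
  if 0 < s then P.[s^-1] * expR (- s^-1) else 0.

(** The inequality [u <= expR u] at [u = y / n.+1], raised to the power [n]; dividing by [n.+1]
    rather than [n] covers [n = 0]. *)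
Lemma expR_ge_pow (n : nat) (y : R) : 0 <= y ->
  y ^+ n <= n.+1%:R ^+ n * expR y.
Proof.
move=> y0; have n0 : 0 < n.+1%:R :> R by rewrite ltr0n.
have : y / n.+1%:R <= expR (y / n.+1%:R).
  by have := expR_ge1Dx (y / n.+1%:R); set u := y / _; set e := expR u; lra.
have yn0 : 0 <= y / n.+1%:R by rewrite divr_ge0// ltW.
move=> /(lerXn2r n) => /(_ yn0 (expR_ge0 _)).
rewrite -expRM_natr expr_div_n ler_pdivrMr ?exprn_gt0// => h.
apply: (le_trans h); rewrite [leLHS]mulrC ler_wpM2l ?exprn_ge0 ?(ltW n0)// ler_expR.
by rewrite mulrAC ler_pdivrMr// ler_wpM2l// ler_nat.
Qed.

(** The weight [y ^ n] feeds the induction on [P], since a factor ['X] raises [n] by one. Weight [2]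
    makes [flat P] vanish quadratically at the origin. *)
Lemma horner_le_exp (P : {poly R}) (n : nat) :
  exists2 C, 0 <= C & forall y, 0 <= y -> `|P.[y]| * y ^+ n <= C * expR y.
Proof.
elim/poly_ind: P n => [|P a ih] n.
  by exists 0 => // y y0; rewrite horner0 normr0 !mul0r.
have [C C0 hC] := ih n.+1.
exists (C + `|a| * n.+1%:R ^+ n) => [|y y0].
  by rewrite addr_ge0 ?mulr_ge0 ?exprn_ge0.
rewrite hornerMXaddC mulrDl.
apply: (le_trans (ler_wpM2r (exprn_ge0 n y0) (ler_normD _ _))).
rewrite mulrDl normrM (ger0_norm y0) -mulrA -exprS lerD ?hC//.
by rewrite -mulrA ler_wpM2l// expR_ge_pow.
Qed.

(** For [s > 0] and [y = 1 / s], a derivative in [s] is [- y ^ 2] times one in [y], hence the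
    polynomial [y ^ 2 (P - P')]. At the origin [|flat P b| <= C b ^ 2] is a quadratic remainder with
    zero slope. *)
Lemma is_derive_flat (P : {poly R}) (s : R) :
  is_derive s 1 (flat P) (flat ('X^2 * (P - P^`())) s).
Proof.
have [s0|s0|s0] := ltgtP s 0.
- have e : \forall t \near s, cst 0 t = flat P t.
    by near=> t; rewrite /flat ltNge ltW//; near: t; exact: lt_nbhsl.
  rewrite {2}/flat ltNge (ltW s0) /=.
  exact: (near_eq_is_derive e (is_derive_cst (0 : R) s 1)).
- pose F t : R := P.[t^-1] * expR (- t^-1).
  have e : \forall t \near s, F t = flat P t.
    by near=> t; rewrite /flat (_ : 0 < t)//; near: t; exact: lt_nbhsr.
  suff h : is_derive s 1 F (flat ('X^2 * (P - P^`())) s).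
    exact: (near_eq_is_derive e h).
  have sn0 : s != 0 by rewrite gt_eqF.
  have dV : is_derive s 1 (fun t : R => t^-1) (- s ^- 2).
    split; first exact: (@derivableV _ _ id).
    by rewrite (@deriveV _ _ id)// derive_id /GRing.scale /= mulr1.
  have dP := is_derive1_comp (is_derive_poly P s^-1) dV.
  have dE : is_derive s 1 (fun t : R => expR (- t^-1)) (expR (- s^-1) * - - s ^- 2).
    have dN : is_derive s 1 (fun t : R => - t^-1) (- - s ^- 2) := is_deriveN dV.
    exact: (@is_derive1_comp _ expR (fun t : R => - t^-1) s _ _ (is_derive_expR (- s^-1)) dN).
  have dF : is_derive s 1 F _ := is_deriveM dP dE.
  apply: (is_derive_eq dF); rewrite /flat s0 /GRing.scale /= hornerM hornerXn hornerD hornerN.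
  move: (P.[_]) (P^`().[_]) (expR _) => u v w; field.
  exact: sn0.
- rewrite s0 {2}/flat ltxx.
  have [C C0 hC] := horner_le_exp P 2.
  apply: (@taylor_is_derive _ _ _ _ C) => b _.
  rewrite {2}/flat ltxx !subr0 mul0r subr0 /flat.
  case: ifP => b0; last by rewrite normr0 mulr_ge0 ?sqr_ge0.
  have := hC b^-1; rewrite invr_ge0 ltW// => /(_ isT).
  rewrite normrM [`|expR _|]ger0_norm ?expR_ge0// expRN exprVn.
  rewrite ler_pdivrMr ?exprn_gt0// => h.
  by rewrite ler_pdivrMr ?expR_gt0// mulrAC.
Unshelve. all: by end_near. Qed.

(* Smooth approximation of the positive part of [b - t], whose derivative stays
   in [-1, 0] and tends to [- 1] for [t < b] and to [0] for [t >= b]. *)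
Definition step (n : nat) (b t : R) : R := (b - t) * flat 1 (n.+1%:R * (b - t)).

Lemma is_derive_affine (m b t : R) : is_derive t 1 (fun t : R => m * (b - t)) (- m).
Proof.
have d1 : is_derive t 1 (fun t : R => b - t) (-1).
  have h : is_derive t 1 (fun t : R => b - t) _ := is_deriveB (is_derive_cst b t 1) (is_derive_id t 1).
  by apply: (is_derive_eq h); rewrite sub0r.
have h : is_derive t 1 (fun t : R => m * (b - t)) _ := is_deriveZ m d1.
by apply: (is_derive_eq h); rewrite /GRing.scale /= mulrN1.
Qed.

Lemma is_derive_flat_affine P (m b t : R) :
  is_derive t 1 (fun t : R => flat P (m * (b - t)))
    (- m * flat ('X^2 * (P - P^`())) (m * (b - t))).
Proof.
have d1 := is_derive_affine m b t.
have := @is_derive1_comp _ (flat P) (fun t : R => m * (b - t)) t _ _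
  (is_derive_flat P (m * (b - t))) d1.
by move=> h; apply: (is_derive_eq h); rewrite mulrC.
Qed.

(** With [y = 1 / (n.+1 (b - t))], the product rule gives [- expR (- y) - (b - t) n.+1 y ^ 2 expR (-
    y)], that is [- (1 + y) expR (- y)]. *)
Lemma is_derive_step (n : nat) (b t : R) :
  is_derive t 1 (step n b) (- flat (1 + 'X) (n.+1%:R * (b - t))).
Proof.
have d1 : is_derive t 1 (fun t : R => b - t) (-1).
  have := is_derive_affine 1 b t.
  by rewrite (_ : (fun t : R => 1 * (b - t)) = (fun t => b - t))//; apply/funext => u; rewrite mul1r.
have ds : is_derive t 1 (step n b) _ := is_deriveM d1 (is_derive_flat_affine 1 n.+1%:R b t).
apply: (is_derive_eq ds); rewrite /GRing.scale /= /flat.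
case: ifP => [h|_]; last by rewrite !(mulr0, mul0r, oppr0) addr0.
have ht : b - t != 0 by move: h; rewrite pmulr_rgt0 ?ltr0n// => /gt_eqF ->.
have nn : n.+1%:R != 0 :> R by rewrite pnatr_eq0.
rewrite derivC subr0 !(hornerM, hornerXn, hornerD, hornerX, hornerC).
move: (n.+1%:R) nn (expR _) => m nn w; field; first by rewrite nn ht.
Qed.

Lemma smooth_step n b : smooth (step n b).
Proof.
move=> k.
have flatC : forall k P, Ck k (fun t : R => flat P (n.+1%:R * (b - t))).
  elim=> [|{}k ih] P.
    split=> // s; apply/differentiable_continuous/derivable1_diffP.
    by case: (is_derive_flat_affine P n.+1%:R b s).
  apply: (CkS_R (is_derive_flat_affine P n.+1%:R b)).
  by apply: CkM; [exact: Ck_cst|exact: ih].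
apply: CkM; last exact: flatC.
apply: CkS; have h := is_derive_affine 1 b.
rewrite (_ : (fun t : R => 1 * (b - t)) = (fun t => b - t)) in h; last first.
  by apply/funext => u; rewrite mul1r.
by apply: (CkS_R h); exact: Ck_cst.
Qed.

Lemma step_eq0 n (b t : R) : b <= t -> step n b t = 0.
Proof.
by move=> bt; rewrite /step /flat pmulr_rgt0 ?ltr0n// subr_gt0 ltNge bt /= mulr0.
Qed.

(** [1 + y <= expR y]. As a bound on the derivative of [step n b] it is uniform in [n], so dominated
    convergence applies. *)
Lemma flat1X_le1 (s : R) : 0 <= flat (1 + 'X) s <= 1.
Proof.
rewrite /flat; case: ifP => s0; last by rewrite lexx ler01.
have y0 : 0 <= s^-1 by rewrite invr_ge0 ltW.
rewrite !hornerE expRN mulr_ge0 ?invr_ge0 ?expR_ge0 ?addr_ge0//=.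
by rewrite ler_pdivrMr ?expR_gt0// mul1r expR_ge1Dx.
Qed.

Lemma step_bound n (b t : R) : `|step n b t| <= `|b - t|.
Proof.
rewrite /step normrM -[leRHS]mulr1 ler_wpM2l// /flat; case: ifP => s0; last by rewrite normr0.
rewrite hornerC mul1r (ger0_norm (expR_ge0 _)).
by rewrite -[leRHS]expR0 ler_expR oppr_le0 invr_ge0 ltW.
Qed.

Lemma cvg_inv_scale (a : R) : (n.+1%:R * a)^-1 @[n --> \oo] --> (0 : R).
Proof.
under eq_fun do rewrite invfM; rewrite -(mul0r a^-1).
by apply: cvgM; [exact: cvg_harmonic|exact: cvg_cst].
Qed.

Lemma cvg_expR_inv_scale (a : R) : expR (- (n.+1%:R * a)^-1) @[n --> \oo] --> (1 : R).
Proof.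
have h : expR (- (n.+1%:R * a)^-1) @[n --> \oo] --> expR (- (0 : R)).
  by apply: continuous_cvg; [exact: continuous_expR|exact: cvgN (cvg_inv_scale a)].
by rewrite oppr0 expR0 in h.
Qed.

Lemma step_cvg (b t : R) : step n b t @[n --> \oo] --> Num.max 0 (b - t).
Proof.
have [bt|tb] := leP b t.
  rewrite (_ : (fun n => step n b t) = cst 0); last by apply/funext => n; rewrite step_eq0.
  by rewrite max_l ?subr_le0//; exact: cvg_cst.
have a0 : 0 < b - t by rewrite subr_gt0.
rewrite max_r ?(ltW a0)// -(mulr1 (b - t)); apply: cvgM; first exact: cvg_cst.
rewrite (_ : (fun n => flat _ _) = (fun n : nat => expR (- (n.+1%:R * (b - t))^-1))).
  exact: cvg_expR_inv_scale.
apply/funext => n; rewrite /flat pmulr_rgt0 ?ltr0n// a0 hornerC.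
exact: mul1r.
Qed.

Lemma flat1X_cvg (b t : R) :
  flat (1 + 'X) (n.+1%:R * (b - t)) @[n --> \oo] --> ((t < b)%R%:R : R).
Proof.
have [bt|tb] := leP b t.
  rewrite (_ : (fun n => flat _ _) = cst 0); first exact: cvg_cst.
  by apply/funext => n; rewrite /flat pmulr_rgt0 ?ltr0n// subr_gt0 ltNge bt.
have a0 : 0 < b - t by rewrite subr_gt0.
rewrite (_ : (fun n => flat _ _) = (fun n : nat => (1 + (n.+1%:R * (b - t))^-1) *
    expR (- (n.+1%:R * (b - t))^-1))); last first.
  apply/funext => n; rewrite /flat pmulr_rgt0 ?ltr0n// a0 hornerD hornerX hornerC.
  by [].
rewrite -[X in _ @ _ --> X](mulr1 (true%:R : R)); apply: cvgM; last exact: cvg_expR_inv_scale.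
rewrite -[X in _ @ _ --> X](addr0 (true%:R : R)); apply: cvgD; first exact: cvg_cst.
exact: cvg_inv_scale.
Qed.

End flat.

(** * Iterated integrals and null sets for products of finite measures *)

Section finite_product.
Context d1 d2 (X : measurableType d1) (Y : measurableType d2) (R : realType).
Variables (mu : {finite_measure set X -> \bar R}) (nu : {finite_measure set Y -> \bar R}).

Lemma finite_product_fin_num : fin_num_fun (mu \x nu)%E.
Proof.
apply: lty_fin_num_fun.
have h : (mu \x nu)%E setT = (mu setT * nu setT)%E.
  by rewrite -[X in (_ \x _)%E X]setXTT; exact: product_measure1E.
suff : (mu setT * nu setT < +oo)%E by rewrite -h.
by rewrite ltey_eq fin_numM// fin_num_measure.
Qed.

(* The library declares products finite only for subprobabilities. *)
Definition prodm : {finite_measure set (X * Y)%type -> \bar R} :=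
  HB.pack_for (FiniteMeasure.type _ _) (mu \x nu)%E (Measure_isFinite.Build _ _ _ (mu \x nu)%E
  finite_product_fin_num).

Lemma measurable_slice_l (F : X * Y -> R) x : measurable_fun setT F ->
  measurable_fun setT (fun y => F (x, y)).
Proof. by move=> mF; apply: measurableT_comp mF _; exact: measurable_pair1. Qed.

Lemma measurable_slice_r (F : X * Y -> R) y : measurable_fun setT F ->
  measurable_fun setT (fun x => F (x, y)).
Proof. by move=> mF; apply: measurableT_comp mF _; exact: measurable_pair2. Qed.

(** The extended integral is a difference of two Tonelli integrals, hence measurable; [fine] sends
    its infinite values to [0]. *)
Lemma measurable_Rint_l (F : X * Y -> R) : measurable_fun setT F ->
  measurable_fun setT (fun x => \int[nu]_y F (x, y)).
Proof.
move=> mF; apply: measurableT_comp; first exact: fine_measurable.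
have mE : measurable_fun setT (EFin \o F) by exact/measurable_EFinP.
rewrite (_ : (fun x => _) = (fun x => fubini_F nu (EFin \o F)^\+ x - fubini_F nu (EFin \o F)^\- x)%E); last first.
  by apply/funext => x; rewrite [LHS]integralE; congr (_ - _)%E; apply: eq_integral => y _; rewrite ?funeposE ?funenegE.
by apply: emeasurable_funB; apply: measurable_fun_fubini_tonelli_F => //;
  [exact: measurable_funepos|exact: measurable_funeneg].
Qed.

Lemma measurable_Rint_r (F : X * Y -> R) : measurable_fun setT F ->
  measurable_fun setT (fun y => \int[mu]_x F (x, y)).
Proof.
move=> mF; apply: measurableT_comp; first exact: fine_measurable.
have mE : measurable_fun setT (EFin \o F) by exact/measurable_EFinP.
rewrite (_ : (fun x => _) = (fun x => fubini_G mu (EFin \o F)^\+ x - fubini_G mu (EFin \o F)^\- x)%E); last first.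
  by apply/funext => x; rewrite [LHS]integralE; congr (_ - _)%E; apply: eq_integral => y _; rewrite ?funeposE ?funenegE.
by apply: emeasurable_funB; apply: measurable_fun_fubini_tonelli_G => //;
  [exact: measurable_funepos|exact: measurable_funeneg].
Qed.

Lemma ae_intble_l (F : X * Y -> R) : intble prodm F ->
  \forall x \ae mu, intble nu (fun y => F (x, y)).
Proof. exact: ae_integrable1. Qed.

Lemma ae_intble_r (F : X * Y -> R) : intble prodm F ->
  \forall y \ae nu, intble mu (fun x => F (x, y)).
Proof. exact: ae_integrable2. Qed.

Lemma intble_Rint_l (F : X * Y -> R) : intble prodm F ->
  intble mu (fun x => \int[nu]_y F (x, y)).
Proof.
move=> IF; have := integrable_fubini_F IF.
apply: le_integrable => //.
  by apply/measurable_EFinP; exact: measurable_Rint_l (intble_meas IF).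
(* Where the inner integral is infinite the real integral is [0], so the domination still holds. *)
by move=> x _; rewrite /= /Rintegral /fubini_F; case: (integral _ _ _) => [r| |]; rewrite ?lexx //=;
  rewrite ?normr0 ?leey ?lexx.
Qed.

Lemma intble_Rint_r (F : X * Y -> R) : intble prodm F ->
  intble nu (fun y => \int[mu]_x F (x, y)).
Proof.
move=> IF; have mF := intble_meas IF.
have mE : measurable_fun setT (EFin \o F) by exact/measurable_EFinP.
have IG : nu.-integrable setT (fun y => \int[mu]_x `|(F (x, y))%:E|)%E.
  apply/integrableP; split.
    apply: (@measurable_fun_fubini_tonelli_G _ _ _ _ _ mu (abse \o (EFin \o F))).
      by apply: measurableT_comp mE; exact: abse_measurable.
    by move=> p; rewrite /= lee_fin.
  under eq_integral do rewrite gee0_abs ?integral_ge0//.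
  exact/(integrable21ltyP mu nu mE).
apply: le_integrable IG => //.
  by apply/measurable_EFinP; exact: measurable_Rint_r mF.
move=> y _; rewrite [leRHS]gee0_abs ?integral_ge0//.
apply: (@le_trans _ _ `|\int[mu]_x (F (x, y))%:E|%E); last first.
  by apply: le_abse_integral => //; apply/measurable_EFinP; exact: measurable_slice_r.
by rewrite /= /Rintegral; case: (integral _ _ _) => [r| |]; rewrite ?lexx //=;
  rewrite ?normr0 ?leey ?lexx.
Qed.

Lemma Rint_prod_l (F : X * Y -> R) : intble prodm F ->
  \int[prodm]_p F p = \int[mu]_x \int[nu]_y F (x, y).
Proof.
move=> IF; rewrite /Rintegral; congr fine.
rewrite -[LHS](integral12_prod_meas1 IF); apply: ae_eq_integral => //.
- exact: (measurable_fubini_F IF).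
- by apply/measurable_EFinP; exact: measurable_Rint_l (intble_meas IF).
- apply: filterS (ae_intble_l IF) => x Ix _.
  by rewrite /= fineK//; exact: integrable_fin_num.
Qed.

Lemma Rint_prod_r (F : X * Y -> R) : intble prodm F ->
  \int[prodm]_p F p = \int[nu]_y \int[mu]_x F (x, y).
Proof.
move=> IF; rewrite /Rintegral; congr fine.
rewrite -[LHS](integral21_prod_meas1 IF); apply: ae_eq_integral => //.
- exact: (measurable_fubini_G IF).
- by apply/measurable_EFinP; exact: measurable_Rint_r (intble_meas IF).
- apply: filterS (ae_intble_r IF) => x Ix _.
  by rewrite /= fineK//; exact: integrable_fin_num.
Qed.

Lemma Rint_swap (F : X * Y -> R) : intble prodm F ->
  \int[mu]_x \int[nu]_y F (x, y) = \int[nu]_y \int[mu]_x F (x, y).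
Proof. by move=> IF; rewrite -Rint_prod_l// Rint_prod_r. Qed.

Lemma Rint_prod_indic N : measurable N -> \int[prodm]_p \1_N p = fine (prodm N).
Proof. by move=> mN; rewrite /Rintegral integral_indic// setIT. Qed.

Lemma intble_prod_indic N : measurable N -> intble prodm \1_N.
Proof.
move=> mN; apply: (@intble_bdd _ _ _ _ 1) => // p.
by rewrite indicE; case: (_ \in _); rewrite ?normr1 ?normr0.
Qed.

Lemma ae_product (P : set (X * Y)) : (\forall p \ae prodm, P p) ->
  \forall x \ae mu, \forall y \ae nu, P (x, y).
Proof.
move=> [N [mN N0 sN]].
have IN := intble_prod_indic mN.
have h : \forall x \ae mu, \int[nu]_y \1_N (x, y) = 0.
  apply: ge0_Rint_eq0; first exact: intble_Rint_l.
    by apply: aeW => x; apply: Rint_ge0 => y; rewrite indicE.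
  by rewrite -Rint_prod_l// Rint_prod_indic// [X in fine X]N0.
apply: filterS2 h (ae_intble_l IN) => x hx Ix.
have h2 : \forall y \ae nu, \1_N (x, y) = 0 :> R.
  by apply: ge0_Rint_eq0 => //; [apply: aeW => y; rewrite indicE|rewrite hx].
apply: filterS h2 => y; rewrite indicE; case: (boolP ((x, y) \in N)) => [_ /eqP|nN _].
  by rewrite pnatr_eq0.
by apply: contrapT => nP; move/negP: nN; apply; rewrite inE; exact: sN.
Qed.

(** Null slices yield a null set only for measurable sets; measurability of [f] makes the set
    [f < 0] measurable, and its indicator is integrated slice by slice. *)
Lemma product_ae (f : X * Y -> R) : measurable_fun setT f ->
  (\forall x \ae mu, \forall y \ae nu, 0 <= f (x, y)) ->
  \forall p \ae prodm, 0 <= f p.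
Proof.
move=> mf h; pose N : set (X * Y) := f @^-1` `]-oo, 0[.
have mN : measurable N by rewrite -[N]setTI; apply: mf.
exists N; split => //; last first.
  by move=> p /= /negP; rewrite -ltNge => fp; rewrite /N /= in_itv.
have IN := intble_prod_indic mN.
have : \int[prodm]_p \1_N p = 0 :> R.
  rewrite Rint_prod_l//.
  have mI : measurable_fun setT (fun x => \int[nu]_y \1_N (x, y) : R) := measurable_Rint_l (intble_meas IN).
  rewrite (@ae_eq_Rint _ _ _ mu _ (fun=> 0) mI (measurable_cst _)) ?Rintegral0//.
  apply: filterS h => x hx.
  rewrite (@ae_eq_Rint _ _ _ nu (fun y => \1_N (x, y)) (fun=> 0) _ (measurable_cst _)) ?Rintegral0//.
    exact: measurable_slice_l (intble_meas IN).
  apply: filterS hx => y fxy; rewrite indicE memNset// /N /= in_itv /=.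
  by apply/negP; rewrite -leNgt.
rewrite Rint_prod_indic// => /eqP.
rewrite fine_eq0 ?fin_num_measure// => /eqP.
by [].
Qed.

End finite_product.

#[local] Instance time_ae_filter (R : realType) (T : R) :
    Filter (almost_everywhere (time_measure T)) :=
  ae_filter_ringOfSetsType (time_measure T).

(** * Primitives of integrable functions of time *)

Section before.
Context {R : realType}.
Variable T : R.
Local Notation tau := (time_measure T : {finite_measure set (measurableTypeR R) -> \bar R}).

(** A comparison as a real weight: integrals up to a variable time become integrals against one
    fixed measure, whose order can be exchanged. *)
Definition before (t s : R) : R := (s < t)%R%:R.

Lemma before_ge0 t s : 0 <= before t s.
Proof. exact: ler0n. Qed.

Lemma before_le1 t s : `|before t s| <= 1.
Proof. by rewrite /before; case: (s < t); rewrite ?normr0 ?normr1. Qed.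

Lemma measurable_before2 d (X : measurableType d) (f g : X -> R) :
  measurable_fun setT f -> measurable_fun setT g ->
  measurable_fun setT (fun x => before (f x) (g x)).
Proof.
move=> mf mg; rewrite (_ : (fun x => _) = (fun x => if g x < f x then 1 else 0)).
  by apply: measurable_fun_ifT => //; exact: measurable_fun_ltr.
by apply/funext => x; rewrite /before; case: (g x < f x).
Qed.

Lemma measurable_before t : measurable_fun [set: measurableTypeR R] (before t).
Proof. by apply: (@measurable_before2 _ _ (cst t) id). Qed.

Lemma intble_before d (X : measurableType d) (mu : {finite_measure set X -> \bar R})
    (f g b : X -> R) :
  measurable_fun setT f -> measurable_fun setT g -> intble mu b ->
  intble mu (fun x => before (f x) (g x) * b x).
Proof.
move=> mf mg Ib; apply: (@intble_bddM _ _ _ mu 1 _ _ _ _ Ib).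
  exact: measurable_before2.
by move=> x; exact: before_le1.
Qed.

Lemma time_ae_itv : \forall t \ae tau, 0 < t < T.
Proof.
exists (~` `]0, T[%classic); split.
- exact: measurableC.
- rewrite /= /time_measure /mrestr setICl; exact: measure0.
- by move=> t; apply: contra_not; rewrite /= in_itv.
Qed.

Lemma time_measure_le (A : set R) (s t : R) : s <= t -> A `<=` `[s, t] ->
  measurable A -> (tau A <= (t - s)%:E)%E.
Proof.
move=> st sA mA; rewrite /= /time_measure /mrestr.
apply: (@le_trans _ _ (lebesgue_measure `[s, t]%classic)).
  apply: le_measure; rewrite ?inE; [exact: measurableI|exact: measurable_itv|].
  by move=> x [Ax _]; exact: sA.
rewrite lebesgue_measure_itv /= lte_fin; case: ifP => //.
by rewrite lee_fin subr_ge0.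
Qed.

Lemma Rint_before2 (s b : R) : 0 <= s -> b < T ->
  \int[tau]_t (before t s * before b t) = Num.max 0 (b - s).
Proof.
move=> s0 bT; rewrite (@eq_Rint _ _ _ tau _ (\1_(`]s, b[%classic : set R))); last first.
  move=> t; rewrite /before indicE -natrM mulnb; congr (_ %:R); congr nat_of_bool.
  by apply/idP/idP; rewrite in_setE /= in_itv.
have h : tau `]s, b[%classic = lebesgue_measure (`]s, b[%classic : set R).
  rewrite /= /time_measure /mrestr setIidl// => x; rewrite /= !in_itv /=.
  by move=> /andP[sx xb]; rewrite (le_lt_trans s0 sx) (lt_trans xb bT).
rewrite /Rintegral integral_indic// setIT [X in fine X]h.
rewrite lebesgue_measure_itv /= lte_fin; case: ifP => sb /=.
  by rewrite max_r// subr_ge0 ltW.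
by rewrite max_l// subr_le0 leNgt sb.
Qed.

Lemma Rint_before (b : R) : b < T -> \int[tau]_t (before b t) = Num.max 0 b.
Proof.
move=> bT; rewrite -[in RHS](subr0 b) -Rint_before2//.
apply: ae_eq_Rint; first exact: measurable_before.
  apply: measurable_funM; last exact: measurable_before.
  by apply: (@measurable_before2 _ _ id (cst 0)).
by apply: filterS time_ae_itv => t /andP[t0 _]; rewrite /before t0 mul1r.
Qed.

(** As the measure is carried by []0, T[], this equals [v0] for [t <= 0] and is constant for
    [t >= T]. *)
Definition primitive (v0 : R) (b : R -> R) (t : R) : R :=
  v0 + \int[tau]_s (before t s * b s).

Lemma measurable_primitive v0 (b : R -> R) :
  measurable_fun [set: measurableTypeR R] b ->
  measurable_fun [set: measurableTypeR R] (primitive v0 b).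
Proof.
move=> mb; apply: measurable_funD; first exact: measurable_cst.
apply: (@measurable_Rint_l _ _ _ _ _ tau (fun p : measurableTypeR R * measurableTypeR R => before p.1 p.2 * b p.2)).
apply: measurable_funM; first exact: measurable_before2.
exact: measurableT_comp.
Qed.

Lemma primitive_bounded v0 (b : R -> R) t : intble tau b ->
  `|primitive v0 b t| <= `|v0| + \int[tau]_s `|b s|.
Proof.
move=> Ib; rewrite (le_trans (ler_normD _ _))// lerD2l.
have Ibt : intble tau (fun s => before t s * b s) by apply: intble_before.
apply: (le_trans (le_norm_Rint Ibt)).
apply: le_Rint; [exact: intble_norm|exact: intble_norm|].
by apply: aeW => s; rewrite normrM ler_piMl// before_le1.
Qed.

Lemma primitiveB v0 (b : R -> R) t t' : intble tau b ->
  primitive v0 b t' - primitive v0 b t = \int[tau]_s ((before t' s - before t s) * b s).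
Proof.
move=> Ib; rewrite /primitive opprD addrACA subrr add0r.
rewrite -RintB; [|by apply: intble_before..].
by apply: eq_Rint => s; rewrite mulrBl.
Qed.

Lemma primitive_continuous v0 (b : R -> R) : intble tau b -> continuous (primitive v0 b).
Proof.
move=> Ib t; apply/cvgrPdist_lt => e e0.
have [r [r0 hr]] := integral_normr_continuous Ib e0.
have key (s t' : R) : s <= t' -> t' - s < r -> `|primitive v0 b t' - primitive v0 b s| < e.
  move=> st hst; rewrite primitiveB//.
  have mS : measurable (`[s, t'[%classic : set R) by exact: measurable_itv.
  apply: le_lt_trans (hr (`[s, t'[%classic) mS _); last first.
    apply: (le_lt_trans (time_measure_le st _ mS)); last by rewrite lte_fin.
    by move=> x; rewrite /= !in_itv /= => /andP[-> /ltW ->].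
  have I1 : intble tau (fun x => (before t' x - before s x) * b x).
    under eq_fun do rewrite mulrBl.
    by apply: intbleB; apply: intble_before.
  apply: (le_trans (le_norm_Rint I1)).
  rewrite [leRHS]Rintegral_mkcond le_eqVlt; apply/orP; left; apply/eqP.
  apply: eq_Rint => x; rewrite patchE /before.
  case: ifPn => [|]; rewrite ?inE ?notin_setE /= in_itv /=.
    by move=> /andP[sx ->]; rewrite ltNge sx /= subr0 mul1r.
  move=> nx; have [xs|sx] := ltP x s; first by rewrite (lt_le_trans xs st) subrr mul0r normr0.
  have -> : (x < t') = false by apply/negP => xt; apply: nx; rewrite sx.
  by rewrite subrr mul0r normr0.
near=> t'; have h : `|t - t'| < r.
  by near: t'; exact: (nbhsx_ballx t r r0).
have [tt|tt] := leP t t'.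
  by rewrite distrC; apply: key => //; rewrite distrC ger0_norm ?subr_ge0 in h.
by apply: key; [exact: ltW|rewrite ger0_norm ?subr_ge0 ?(ltW tt) in h].
Unshelve. all: by end_near. Qed.

End before.

(** * A one-sided chain rule for convex functions *)

Section chain_inequality.
Context {R : realType}.
Variable T : R.
Local Notation tau := (time_measure T : {finite_measure set (measurableTypeR R) -> \bar R}).

Lemma primitive0 v0 (b : R -> R) : measurable_fun [set: measurableTypeR R] b ->
  primitive T v0 b 0 = v0.
Proof.
move=> mb; rewrite /primitive (@ae_eq_Rint _ _ _ tau _ (fun=> 0)).
- by rewrite Rintegral0 addr0.
- by apply: measurable_funM => //; exact: measurable_before.
- exact: measurable_cst.
by apply: filterS (time_ae_itv T) => s /andP[s0 _]; rewrite /before ltNge (ltW s0) mul0r.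
Qed.

Variables (Phi Phi' : R -> R).
Hypothesis Phi_convex : forall x y, Phi y - Phi x <= Phi' y * (y - x).
Hypothesis Phi'_continuous : continuous Phi'.

(** Tangents of [Phi] at the right end points of a uniform partition of [[0, t]] bound the total
    increment by a sum of integrals over the cells. Continuity of the primitive and dominated
    convergence turn the sum into the integral, with no time derivative of the primitive. *)
Lemma chain_le (v0 : R) (b : R -> R) (t : R) : intble tau b -> 0 <= t ->
  Phi (primitive T v0 b t) - Phi v0 <=
  \int[tau]_s (before t s * (Phi' (primitive T v0 b s) * b s)).
Proof.
move=> Ib t0; have mb := intble_meas Ib; pose V := primitive T v0 b.
have cV : continuous V by exact: primitive_continuous.
pose M := `|v0| + \int[tau]_s `|b s|.
have [C C0 hC] : exists2 C, 0 <= C & forall s, `|Phi' (V s)| <= C.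
  have [C hC] := continuous_itv_bounded M Phi'_continuous.
  exists `|C| => // s; apply: le_trans (ler_norm C); apply: hC.
  exact: primitive_bounded.
pose q n i : R := i%:R * (t / n.+1%:R).
have q0 n : q n 0 = 0 by rewrite /q mul0r.
have qn n : q n n.+1 = t by rewrite /q mulrC divfK// pnatr_eq0.
have qS n i : q n i.+1 = q n i + t / n.+1%:R by rewrite /q -natr1 mulrDl mul1r.
have dq0 n : 0 <= t / n.+1%:R by rewrite divr_ge0.
(* The indicator of the cell from [q n i], included, to [q n i.+1], excluded. *)
pose df n i s := before (q n i.+1) s - before (q n i) s.
have df0 n i s : 0 <= df n i s.
  rewrite subr_ge0 /before ler_nat; case: (ltP s (q n i)) => // h.
  by rewrite (lt_le_trans h)// qS lerDl.
have sdf n s : \sum_(0 <= i < n.+1) df n i s = before t s - before 0 s.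
  by rewrite /df (telescope_sumr (fun i => before (q n i) s))// qn q0.
have sdf1 n s : \sum_(0 <= i < n.+1) df n i s <= 1.
  rewrite sdf lerBlDr (le_trans (ler_norm _)) ?(le_trans (before_le1 _ _))//.
  by rewrite lerDl before_ge0.
pose F n s := (\sum_(0 <= i < n.+1) Phi' (V (q n i.+1)) * df n i s) * b s.
have mdf n i : measurable_fun [set: measurableTypeR R] (df n i).
  by apply: measurable_funB; exact: measurable_before.
have IF n i : intble tau (fun s => Phi' (V (q n i.+1)) * (df n i s * b s)).
  apply: intbleZ; under eq_fun do rewrite mulrBl.
  by apply: intbleB; apply: intble_before.
have FE n : \int[tau]_s F n s =
    \sum_(0 <= i < n.+1) Phi' (V (q n i.+1)) * (V (q n i.+1) - V (q n i)).
  rewrite /F (@eq_Rint _ _ _ tau _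
      (fun s => \sum_(0 <= i < n.+1) Phi' (V (q n i.+1)) * (df n i s * b s))); last first.
    by move=> s; rewrite mulr_suml; apply: eq_bigr => i _; rewrite mulrA.
  rewrite Rint_sum//; apply: eq_bigr => i _; rewrite RintZ.
    by rewrite -(primitiveB v0).
  under eq_fun do rewrite mulrBl.
  by apply: intbleB; apply: intble_before.
have leF n : Phi (V t) - Phi v0 <= \int[tau]_s F n s.
  rewrite -{1}(qn n) -[in Phi v0](primitive0 v0 mb) -/V -{1}(q0 n).
  rewrite -(telescope_sumr (fun i => Phi (V (q n i))))// FE.
  by apply: ler_sum => i _; exact: Phi_convex.
have cvF : \int[tau]_s F n s @[n --> \oo] -->
    \int[tau]_s (before t s * (Phi' (V s) * b s)).
  apply: (@Rint_DCT _ _ _ tau F _ (fun s => C * `|b s|)).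
  - move=> n; apply: measurable_funM => //.
    apply: (@measurable_sum _ _ _ _ _ _ (fun (i : nat) (s : measurableTypeR R) => Phi' (V (q n i.+1)) * df n i s)) => i.
    by apply: measurable_funM => //; exact: measurable_cst.
  - apply: measurable_funM; first exact: measurable_before.
    apply: measurable_funM => //; apply: continuous_measurable_fun => s.
    by apply: continuous_comp; [exact: cV|exact: Phi'_continuous].
  - by apply: intbleZ; exact: intble_norm.
  - apply: filterS (time_ae_itv T) => s /andP[s0 _].
    rewrite mulrA; apply: cvgM; last exact: cvg_cst.
     apply/cvgrPdist_le => e e0.
    have cPV : Phi' \o V @ s --> Phi' (V s).
      by apply: continuous_comp; [exact: cV|exact: Phi'_continuous].
    have /cvgrPdist_le/(_ e e0) [r /= r0 hr] := cPV.
    have tn : t / n.+1%:R @[n --> \oo] --> (0 : R).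
      by rewrite -(mulr0 t); apply: cvgM; [exact: cvg_cst|exact: cvg_harmonic].
    have /cvgrPdist_lt/(_ r r0) h := tn.
    apply: filterS h => n; rewrite sub0r normrN (ger0_norm (dq0 n)) => hn.
    have -> : before t s = \sum_(0 <= i < n.+1) df n i s.
      by rewrite sdf {3}/before ltNge (ltW s0) subr0.
    rewrite mulr_suml -sumrB (le_trans (ler_norm_sum _ _ _))//.
    apply: (@le_trans _ _ (\sum_(0 <= i < n.+1) e * df n i s)).
      apply: ler_sum => i _; rewrite mulrC -mulrBl normrM (ger0_norm (df0 n i s)).
      rewrite /df /before; have [h1|h1] := ltP s (q n i.+1); last first.
        have -> : (s < q n i) = false.
          by apply/negbTE; rewrite -leNgt (le_trans _ h1)// qS lerDl.
        by rewrite subrr !mulr0.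
      have [h2|h2] := ltP s (q n i); first by rewrite subrr !mulr0.
      rewrite subr0 !mulr1; apply: hr; rewrite /= ler0_norm ?subr_le0 ?ltW//.
      rewrite opprB; apply: le_lt_trans hn.
      by move: h2; rewrite qS; move: (q n i) (t / _) => a1 a2; lra.
    by rewrite -mulr_sumr ler_piMr// ltW.
  - move=> n; apply: aeW => s; rewrite normrM ler_wpM2r//.
    apply: (le_trans (ler_norm_sum _ _ _)).
    apply: (@le_trans _ _ (\sum_(0 <= i < n.+1) C * df n i s)).
      by apply: ler_sum => i _; rewrite normrM (ger0_norm (df0 n i s)) ler_wpM2r.
    by rewrite -mulr_sumr ler_piMr.
rewrite -(cvg_lim _ cvF)//; apply: limr_ge; first by apply/cvg_ex; eexists; exact: cvF.
by apply: nearW => n; exact: leF.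
Qed.

End chain_inequality.

(** * Functions whose integrals over rays vanish *)

Section zero_mean.
Context {R : realType} (mu : {finite_measure set (measurableTypeR R) -> \bar R}).

#[local] Instance ae_filter_R : Filter (almost_everywhere mu) :=
  ae_filter_ringOfSetsType mu.

Lemma intble_indicM (E : set R) (D : R -> R) : measurable E -> intble mu D ->
  intble mu (fun x => \1_E x * D x).
Proof.
move=> mE ID; apply: (@intble_bddM _ _ _ mu 1 _ _ _ _ ID).
  exact: measurable_indic.
by move=> x; rewrite indicE; case: (_ \in _); rewrite ?normr0 ?normr1.
Qed.

Lemma integral_indicM (E : set R) (D : R -> R) : measurable E -> intble mu D ->
  (\int[mu]_(t in E) (D t)%:E)%E = (\int[mu]_t (\1_E t * D t))%:E.
Proof.
move=> mE ID; rewrite /Rintegral fineK; last first.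
  by apply: integrable_fin_num => //; exact: (intble_indicM mE ID).
rewrite [LHS]integral_mkcond; apply: eq_integral => t _; rewrite patchE indicE.
by case: (t \in E); rewrite ?mul1r ?mul0r.
Qed.

(** The sets on which [D] has zero integral form a Dynkin system containing the rays, which are
    stable under intersection and generate. It then contains the sets where [D] has a given sign. *)
Lemma rays_ae_eq0 (D : R -> R) : intble mu D ->
  (forall b, \int[mu]_t (before b t * D t) = 0) -> \forall t \ae mu, D t = 0.
Proof.
move=> ID hD.
have beforeE b : before b = \1_(`]-oo, b[%classic : set R).
  apply/funext => t; rewrite /before indicE; congr (_ %:R); congr nat_of_bool.
  by apply/idP/idP; rewrite in_setE /= in_itv.
have D0 : \int[mu]_t D t = 0.
  have cv : \int[mu]_t (before n%:R t * D t) @[n --> \oo] --> \int[mu]_t D t.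
    apply: (@Rint_DCT _ _ _ mu _ _ (fun t => `|D t|)).
    - move=> n; apply: measurable_funM; first exact: measurable_before.
      exact: intble_meas ID.
    - exact: intble_meas ID.
    - exact: intble_norm.
    - apply: aeW => t; apply: cvg_near_cst.
      have := nbhs_infty_gtr t; apply: filterS => n tn.
      by rewrite /before tn mul1r.
    - by move=> n; apply: aeW => t; rewrite normrM ler_piMl// before_le1.
  by rewrite -(cvg_lim _ cv)//; under eq_fun do rewrite hD; rewrite lim_cst.
have DT : \int[mu]_t (\1_setT t * D t) = 0.
  by rewrite -[RHS]D0; apply: eq_Rint => t; rewrite indicT mul1r.
have IDE (E : set R) : measurable E -> mu.-integrable E (EFin \o D).
  by move=> mE; apply: (integrableS measurableT).
have main (E : set R) : measurable E -> (\int[mu]_(t in E) (D t)%:E = 0)%E.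
  pose P (E : set (measurableTypeR R)) := (\int[mu]_(t in E) (D t)%:E = 0)%E.
  suff : @measurable _ (measurableTypeR R) `<=` P by apply.
  move=> {}E mE; apply: (@dynkin_induction _ (measurableTypeR R) (@RGenInftyO.G R) P).
  - exact: RGenInftyO.measurableE.
  - move=> _ _ [a ->] [b ->]; exists (Num.min a b).
    by apply/seteqP; split => x; rewrite /= !in_itv /= lt_min => /andP.
  - by rewrite /P integral_indicM// DT.
  - by move=> _ [b ->]; rewrite /P integral_indicM// -beforeE hD.
  - move=> S mS PS; rewrite /P -[LHS]add0e -[in LHS]PS -integral_setU//; last 3 first.
    + exact: measurableC.
    + by rewrite setUv; exact: measurable_int ID.
    + by apply/disj_setPCl.
    by rewrite setUv integral_indicM// DT.
  - move=> F mF tF PF; rewrite /P integral_bigcup//.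
      by rewrite eseries0// => i _ _; exact: PF.
    by apply: IDE; apply: bigcupT_measurable => k; exact: mF.
  - by move: mE; rewrite RGenInftyO.measurableE.
(* The parameter [s] is a sign: the sets [0 <= D] and [D <= 0] are treated at once. *)
have half (s : R) : s ^+ 2 = 1 -> \forall t \ae mu, 0 <= s * D t -> D t = 0.
  move=> s1; pose E : set R := [set t | 0 <= s * D t].
  have mE : measurable E.
    have := measurable_fun_ler (measurable_cst (0 : R)) (measurable_funM (measurable_cst s) (intble_meas ID)).
    by move=> /(_ measurableT [set true] I); rewrite setTI.
  have IE := intble_indicM mE ID.
  have h : \forall t \ae mu, s * (\1_E t * D t) = 0.
    apply: ge0_Rint_eq0.
    - exact: intbleZ.
    - apply: aeW => t; rewrite mulrCA indicE; case: (boolP (t \in E)); last by rewrite mul0r.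
      by rewrite inE mul1r.
    - rewrite RintZ//; have [-> ] : \int[mu]_t (\1_E t * D t) = 0.
        by apply: EFin_inj; rewrite -integral_indicM// main.
      by rewrite mulr0.
  apply: filterS h => t h ht; move: h; rewrite indicE mem_set// mul1r => /eqP.
  rewrite mulf_eq0 => /orP[/eqP s0|/eqP//].
  by move: s1; rewrite s0 expr0n => /eqP; rewrite eq_sym oner_eq0.
apply: filterS2 (half 1 _) (half (-1) _) => [t h1 h2| |]; last 2 first.
- by rewrite expr1n.
- by rewrite sqrrN expr1n.
have [h|h] := leP 0 (D t); first by apply: h1; rewrite mul1r.
by apply: h2; rewrite mulN1r oppr_ge0 ltW.
Qed.

End zero_mean.

(** * From the weak equation in time to a primitive *)

Section du_bois_reymond.
Context {R : realType}.
Variable T : R.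
Local Notation tau := (time_measure T : {finite_measure set (measurableTypeR R) -> \bar R}).

Lemma intble_snd d1 d2 (X : measurableType d1) (Y : measurableType d2)
    (mu : {finite_measure set X -> \bar R}) (nu : {finite_measure set Y -> \bar R})
    (g : Y -> R) : intble nu g -> intble (prodm mu nu) (g \o snd).
Proof.
move=> Ig; have mg : measurable_fun setT (EFin \o (g \o snd) : X * Y -> \bar R).
  apply/measurable_EFinP; apply: measurableT_comp; last exact: measurable_snd.
  exact: intble_meas Ig.
apply/(integrable12ltyP mu nu mg) => /=.
rewrite integral_cst//; have /integrableP[_ h] := Ig.
rewrite lte_mul_pinfty//; first exact: integral_ge0.
  by rewrite ge0_fin_numE//; exact: integral_ge0.
by rewrite ltey_eq fin_num_measure.
Qed.

Lemma intble_fst d1 d2 (X : measurableType d1) (Y : measurableType d2)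
    (mu : {finite_measure set X -> \bar R}) (nu : {finite_measure set Y -> \bar R})
    (g : X -> R) : intble mu g -> intble (prodm mu nu) (g \o fst).
Proof.
move=> Ig; have mg : measurable_fun setT (EFin \o (g \o fst) : X * Y -> \bar R).
  apply/measurable_EFinP; apply: measurableT_comp; last exact: measurable_fst.
  exact: intble_meas Ig.
apply/(integrable21ltyP mu nu mg) => /=.
rewrite integral_cst//; have /integrableP[_ h] := Ig.
rewrite lte_mul_pinfty//; first exact: integral_ge0.
  by rewrite ge0_fin_numE//; exact: integral_ge0.
by rewrite ltey_eq fin_num_measure.
Qed.

Lemma measurable_step n (b : R) : measurable_fun [set: measurableTypeR R] (step n b).
Proof.
apply: continuous_measurable_fun => t; apply/differentiable_continuous/derivable1_diffP.
by case: (is_derive_step n b t).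
Qed.

Lemma measurable_flat1X n (b : R) :
  measurable_fun [set: measurableTypeR R] (fun t => flat (1 + 'X) (n.+1%:R * (b - t))).
Proof.
apply: continuous_measurable_fun => t; apply/differentiable_continuous/derivable1_diffP.
by case: (is_derive_flat_affine (1 + 'X) n.+1%:R b t).
Qed.

Lemma step_equation_limit (A B : R -> R) (A0 b : R) : intble tau A -> intble tau B ->
  (forall n, \int[tau]_t (A t * - flat (1 + 'X) (n.+1%:R * (b - t)) + B t * step n b t) =
     - (A0 * step n b 0)) ->
  \int[tau]_t (before b t * A t) =
    A0 * Num.max 0 b + \int[tau]_t (B t * Num.max 0 (b - t)).
Proof.
move=> IA IB h; have mA := intble_meas IA; have mB := intble_meas IB.
have mmax : measurable_fun [set: measurableTypeR R] (fun t : R => Num.max 0 (b - t)).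
  by apply: measurable_maxr => //; exact: measurable_funB.
(* The positive part of [b - t] is unbounded on the line; its truncation at [K] is bounded
   everywhere and unchanged for [0 < t < T]. *)
pose K := `|b| + `|T|; pose m t := Num.min (Num.max 0 (b - t)) K.
have mm : measurable_fun [set: measurableTypeR R] m by exact: measurable_minr.
have bK t : 0 < t < T -> `|b - t| <= K.
  move=> /andP[t0 tT]; rewrite (le_trans (ler_normB _ _))// lerD2l.
  by rewrite !gtr0_norm ?(lt_trans t0 tT)// ltW.
have mE t : 0 < t < T -> m t = Num.max 0 (b - t).
  move=> tT; rewrite /m min_l// ge_max (le_trans _ (bK _ tT))//=.
  exact: le_trans (ler_norm _) (bK _ tT).
have m0K t : `|m t| <= K.
  have K0 : 0 <= K by rewrite addr_ge0.
  by rewrite ger0_norm /m ?ge_min ?lexx ?orbT// le_min K0 le_max lexx.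
have IBm : intble tau (fun t => m t * B t) by exact: intble_bddM mm m0K IB.
have c1 : \int[tau]_t (A t * - flat (1 + 'X) (n.+1%:R * (b - t)) + B t * step n b t)
    @[n --> \oo] --> \int[tau]_t (m t * B t - before b t * A t).
  apply: (@Rint_DCT _ _ _ tau _ _ (fun t => `|A t| + K * `|B t|)).
  - move=> n; apply: measurable_funD; apply: measurable_funM => //.
      by apply: measurableT_comp => //; exact: measurable_flat1X.
    exact: measurable_step.
  - apply: measurable_funB; apply: measurable_funM => //.
    exact: measurable_before.
  - by apply: intbleD; [exact: intble_norm|apply: intbleZ; exact: intble_norm].
  - apply: filterS (time_ae_itv T) => t tT.
    rewrite (_ : m t * B t - _ = A t * - before b t + B t * Num.max 0 (b - t)); last first.
      by rewrite (mE _ tT); move: (Num.max _ _) (before b t) => u v; ring.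
    apply: cvgD; apply: cvgM; [exact: cvg_cst| |exact: cvg_cst|].
      by apply: cvgN; exact: flat1X_cvg.
    exact: step_cvg.
  - move=> n; apply: filterS (time_ae_itv T) => t tT.
    apply: (le_trans (ler_normD _ _)); rewrite !normrM normrN lerD//.
      by rewrite ler_piMr// ger0_norm; have /andP[] := flat1X_le1 (n.+1%:R * (b - t)).
    rewrite [leLHS]mulrC; apply: ler_wpM2r => //.
    rewrite -normrM;    exact: le_trans (step_bound n b t) (bK _ tT).
have c2 : - (A0 * step n b 0) @[n --> \oo] --> - (A0 * Num.max 0 (b - 0)).
  by apply: cvgN; apply: cvgM; [exact: cvg_cst|exact: step_cvg].
move: c1; under eq_fun do rewrite h.
move=> c1; have := cvg_unique (@Rhausdorff R) c2 c1; rewrite subr0 RintB//; last exact: intble_before.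
have -> : \int[tau]_t (m t * B t) = \int[tau]_t (B t * Num.max 0 (b - t)).
  apply: ae_eq_Rint; [exact: measurable_funM|exact: measurable_funM|].
  by apply: filterS (time_ae_itv T) => t tT; rewrite mE// mulrC.
by move=> e; rewrite -[X in _ = X + _]opprK e opprB subrK.
Qed.

(** In the limit the test functions give the integral of [A] up to any [b < T]; exchanging the two
    time integrals, the primitive has the same integrals. *)
Lemma du_bois_reymond (A B : R -> R) (A0 : R) : intble tau A -> intble tau B ->
  (forall n b, b < T ->
   \int[tau]_t (A t * - flat (1 + 'X) (n.+1%:R * (b - t)) + B t * step n b t) =
     - (A0 * step n b 0)) ->
  \forall t \ae tau, A t = primitive T A0 B t.
Proof.
move=> IA IB h; have mA := intble_meas IA; have mB := intble_meas IB.
have IP : intble tau (primitive T A0 B).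
  apply: (@intble_bdd _ _ _ tau _ _ (measurable_primitive T A0 mB)) => t.
  exact: primitive_bounded.
pose D t := A t - primitive T A0 B t.
have ID : intble tau D by exact: intbleB.
have hD b : b < T -> \int[tau]_t (before b t * D t) = 0.
  move=> bT; rewrite (@eq_Rint _ _ _ tau _ (fun t => before b t * A t -
    (A0 * before b t + \int[tau]_s (before b t * (before t s * B s))))); last first.
    move=> t; rewrite /D /primitive mulrBr mulrDr (mulrC A0) RintZ//.
    by apply: intble_before.
  have I2 : intble (prodm tau tau) (fun p => before b p.1 * (before p.1 p.2 * B p.2)).
    apply: intble_before => //; apply: intble_before => //; exact: intble_snd.
  have I1 : intble tau (fun t => A0 * before b t).
    by apply: intbleZ; apply: (@intble_bdd _ _ _ tau 1) => [|t];
      [exact: measurable_before|exact: before_le1].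
  have I3 : intble tau (fun t => \int[tau]_s (before b t * (before t s * B s))).
    exact: (intble_Rint_l I2).
  rewrite RintB; [|by apply: intble_before|exact: intbleD].
  rewrite RintD// RintZ; last first.
    by apply: (@intble_bdd _ _ _ tau 1) => [|t];
      [exact: measurable_before|exact: before_le1].
  rewrite Rint_before// (Rint_swap I2) (step_equation_limit IA IB (h^~ b ^~ bT)).
  apply/eqP; rewrite subr_eq0; apply/eqP; congr (_ + _).
  apply: ae_eq_Rint.
  - apply: measurable_funM => //; apply: measurable_maxr => //; exact: measurable_funB.
  - exact: (measurable_Rint_r _ (intble_meas I2)).
  apply: filterS (time_ae_itv T) => s /andP[s0 _].
  rewrite -(Rint_before2 (ltW s0) bT) -RintZ.
    by apply: eq_Rint => t /=; move: (B s) (before t s) (before b t) => u v w; ring.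
  apply: (@intble_bdd _ _ _ tau 1) => [|t].
    by apply: measurable_funM; [exact: measurable_before2|exact: measurable_before].
  by rewrite normrM mulr_ile1// before_le1.
suff : \forall t \ae tau, D t = 0 by apply: filterS => t /eqP; rewrite subr_eq0 => /eqP.
apply: rays_ae_eq0 => // b; have [bT|Tb] := ltP b T; first exact: hD.
(* Test functions vanish near [T], so the rays ending at or beyond [T] are reached as limits of
   shorter ones. *)
pose u n : R := T - n.+1%:R^-1.
have cv : \int[tau]_t (before (u n) t * D t) @[n --> \oo] --> \int[tau]_t (before b t * D t).
  apply: (@Rint_DCT _ _ _ tau _ _ (fun t => `|D t|)).
  - by move=> n; apply: measurable_funM; [exact: measurable_before|exact: intble_meas ID].
  - by apply: measurable_funM; [exact: measurable_before|exact: intble_meas ID].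
  - exact: intble_norm.
  - apply: filterS (time_ae_itv T) => t /andP[_ tT]; apply: cvg_near_cst.
    have : \forall n \near \oo, n.+1%:R^-1 < T - t.
      have /cvgrPdist_lt/(_ (T - t)) := @cvg_harmonic R; rewrite subr_gt0 => /(_ tT).
      by apply: filterS => n; rewrite sub0r normrN gtr0_norm ?invr_gt0 ?ltr0n.
    apply: filterS => n hn; rewrite /before (lt_le_trans tT Tb).
    by rewrite (_ : t < u n) // /u; move: (n.+1%:R^-1) hn => q; lra.
  - by move=> n; apply: aeW => t; rewrite normrM ler_piMl// before_le1.
rewrite -(cvg_lim _ cv)//; under eq_fun do rewrite hD ?ltrBlDr ?ltrDl ?invr_gt0 ?ltr0n//.
by rewrite lim_cst.
Qed.

End du_bois_reymond.

(** * Decay of the entropy *)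

Section entropy_continuity.
Context {R : realType} (alpha : R).

Lemma entropy_continuous : continuous (entropy alpha).
Proof.
move=> s; apply: (@continuousM _ _ (fun t : R => ppart alpha t ^+ 3) (fun=> 6^-1)); last exact: cst_continuous.
apply: (@continuous_comp _ _ _ (ppart alpha) (fun t : R => t ^+ 3)).
  exact: (C11_continuous' (C11_entropy' alpha)).
exact: exprn_continuous.
Qed.

End entropy_continuity.

(** * The dissipation of the mollified equation and its limit *)

Section dissipation.
Context {R : realType} {d : nat}.
Local Notation mT := (torus_measure d : probability 'rV[R]_d R).
Local Notation D i u := ('D_(delta_mx ord0 i) u).
Implicit Types (nu : 'I_d -> nat) (r : 'rV[R]_d -> R) (F G : 'I_d -> 'rV[R]_d -> R).

(** Reassembles the scalar equations for the coefficients: the mollified density evolves by minus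
    the divergence of the mollified flux. *)
Lemma bas_flux nu F x : (forall i, intble mT (F i)) ->
  \sum_j (\sum_i \int[mT]_y (F i y * D i (bas j) y)) * @bas R d nu j x =
  - \sum_i D i (S nu (F i)) x.
Proof.
move=> IF; under eq_bigr do rewrite mulr_suml.
rewrite exchange_big /= -sumrN; apply: eq_bigr => i _.
rewrite (_ : S nu (F i) = fun z => \sum_j coef j (F i) * @bas R d nu j z); last first.
  by apply/funext => z; exact: SE.
rewrite trig_sum_derive; last by move=> j; exact: trig_bas.
have h (e : bas_idx nu -> 'rV[R]_d -> R) : (forall j, trig (e j)) ->
    forall c : bas_idx nu -> R, \sum_j (\int[mT]_y (F i y * e j y)) * c j =
    \int[mT]_y ((\sum_j c j * e j y) * F i y).
  move=> te c; rewrite Rint_sum_mul//; apply: eq_bigr => j _.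
  by rewrite mulrC; congr (_ * _); apply: eq_Rint => y; rewrite mulrC.
rewrite h; last by move=> j; exact/trig_derive/trig_bas.
rewrite -sumrN; under [RHS]eq_bigr do rewrite -mulrN.
transitivity (\int[mT]_y ((\sum_j - D i (@bas R d nu j) x * bas j y) * F i y)).
  apply: eq_Rint => y; congr (_ * _); rewrite -[LHS]opprK -derive_bas -sumrN.
  by apply: eq_bigr => j _; rewrite mulNr.
rewrite Rint_sum_mul//; last by move=> j; exact: trig_bas.
by apply: eq_bigr => j _; rewrite mulrC.
Qed.

Variables (p p' : R -> R).
Hypothesis pp' : C11 p p'.

Lemma dissipationE nu r F G : (forall i, intble mT (F i)) -> intble mT r ->
  (forall i, intble mT (G i)) -> (forall i, wgrad i r (G i)) ->
  \int[mT]_x (p (S nu r x) *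
    \sum_j (\sum_i \int[mT]_y (F i y * D i (bas j) y)) * @bas R d nu j x) =
  \sum_i \int[mT]_x (S nu (F i) x * (p' (S nu r x) * S nu (G i) x)).
Proof.
move=> IF Ir IG rG; have tr := trig_S nu Ir.
have cp := C11_continuous pp'.
have [C hC] := trig_comp_bounded cp tr.
have mp := continuous_comp_measurable cp (trig_measurable tr).
rewrite (@eq_Rint _ _ _ mT _ (fun x => \sum_i - (p (S nu r x) * D i (S nu (F i)) x))); last first.
  by move=> x; rewrite bas_flux// mulrN mulr_sumr sumrN.
have I1 i : intble mT (fun x => p (S nu r x) * D i (S nu (F i)) x).
  exact: intble_bddM mp hC (trig_intble (trig_derive _ (trig_S nu (IF i)))).
rewrite Rint_sum; last by move=> i; exact: intbleN.
apply: eq_bigr => i _; rewrite RintN//.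
rewrite (wgrad_chain_trig i pp' tr (trig_S nu (IF i))) opprK.
apply: eq_Rint => x; rewrite (derive_S nu x Ir (IG i) (rG i)).
by rewrite mulrC.
Qed.

(** Uniform in [nu], because [S] is a contraction; this supplies the dominating function in the
    limit under the time integral. *)
Lemma dissipation_bound nu r F G (M C : R) : measurable_fun setT r -> (forall x, `|r x| <= M) ->
  (forall i, sqint mT (F i)) -> (forall i, sqint mT (G i)) ->
  (forall s, `|s| <= M -> `|p' s| <= C) ->
  `|\sum_i \int[mT]_x (S nu (F i) x * (p' (S nu r x) * S nu (G i) x))| <=
  C * \sum_i (\int[mT]_x (F i x ^+ 2) + \int[mT]_x (G i x ^+ 2)).
Proof.
move=> mr rM sF sG hC.
have C0 : 0 <= C.
  have := hC (S nu r 0) (S_bounded nu 0 mr rM); exact: le_trans.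
have IF i := sqint_intble (sF i); have IG i := sqint_intble (sG i).
have Ir : intble mT r := intble_bdd mT mr rM.
have tr := trig_S nu Ir.
have mp' := continuous_comp_measurable (C11_continuous' pp') (trig_measurable tr).
have hp' x : `|p' (S nu r x)| <= C by apply: hC; exact: S_bounded.
rewrite mulr_sumr (le_trans (ler_norm_sum _ _ _))//; apply: ler_sum => i _.
have sSF := S_sqint nu (IF i); have sSG := S_sqint nu (IG i).
have I1 : intble mT (fun x => S nu (F i) x * (p' (S nu r x) * S nu (G i) x)).
  by apply: sqintM => //; exact: sqint_bddM mp' hp' sSG.
have I2 : intble mT (fun x => C * (S nu (F i) x ^+ 2 + S nu (G i) x ^+ 2)).
  by apply: intbleZ; apply: intbleD; [case: sSF|case: sSG].
apply: (le_trans (le_norm_Rint I1)).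
apply: (@le_trans _ _ (\int[mT]_x (C * (S nu (F i) x ^+ 2 + S nu (G i) x ^+ 2)))).
  apply: le_Rint => //; first exact: intble_norm.
  apply: aeW => x; rewrite !normrM mulrCA ler_pM ?mulr_ge0//.
  rewrite -[X in _ <= X + _]real_normK ?num_real// -[X in _ <= _ + X]real_normK ?num_real//.
  move: `|S nu (F i) x| `|S nu (G i) x| => a b.
  have := sqr_ge0 (a - b); have := sqr_ge0 a; have := sqr_ge0 b; nra.
rewrite RintZ; last by apply: intbleD; [case: sSF|case: sSG].
rewrite RintD; [|by case: sSF|by case: sSG].
by rewrite ler_wpM2l// lerD// S_contract.
Qed.

Lemma dissipation_cvg r F G (M : R) : measurable_fun setT r -> (forall x, `|r x| <= M) ->
  (forall i, sqint mT (F i)) -> (forall i, sqint mT (G i)) ->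
  \sum_i \int[mT]_x (S (fun=> n) (F i) x * (p' (S (fun=> n) r x) * S (fun=> n) (G i) x))
    @[n --> \oo] --> \sum_i \int[mT]_x (F i x * (p' (r x) * G i x)).
Proof.
move=> mr rM sF sG.
have cp' := C11_continuous' pp'; have [C hC] := continuous_itv_bounded M cp'.
have IF i := sqint_intble (sF i); have IG i := sqint_intble (sG i).
have Ir : intble mT r := intble_bdd mT mr rM.
apply: (@cvg_sumr _ _ _ (fun i (n : nat) => \int[mT]_x (S (fun=> n) (F i) x *
  (p' (S (fun=> n) r x) * S (fun=> n) (G i) x)))) => i.
apply: (@triple_cvg _ _ (fun n => S (fun=> n) (F i)) (fun n => S (fun=> n) (G i))
  (fun n x => p' (S (fun=> n) r x)) (F i) (G i) (fun x => p' (r x))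
  (\int[mT]_x (G i x ^+ 2)) C) => //.
- by move=> n; exact: S_sqint.
- by move=> n; exact: S_sqint.
- by move=> n; exact: continuous_comp_measurable cp' (trig_measurable (trig_S _ Ir)).
- exact: continuous_comp_measurable.
- by move=> n x; apply: hC; exact: S_bounded.
- by move=> x; exact: hC.
- by move=> n; exact: S_contract.
- exact: S_cvg_seq.
- exact: S_cvg_seq.
- apply: (S_comp_cvg _ cp' _ mr rM) => //.
  have [L L0 hL] := C11_lip pp' M; exists L => // a b aM bM.
  by have [] := hL a b aM bM.
Qed.

End dissipation.

Section convex_smoothing.
Context {R : realType} {d : nat}.
Local Notation mT := (torus_measure d : probability 'rV[R]_d R).

(** Jensen's inequality compares the two entropies in the other direction. The tangent at [r] gives
    this one up to an error that vanishes as [S] tends to the identity. *)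
Lemma convex_smoothing nu (Phi Phi' : R -> R) (r : 'rV[R]_d -> R) (M : R) :
  (forall a b, Phi b - Phi a <= Phi' b * (b - a)) ->
  continuous Phi -> continuous Phi' ->
  measurable_fun setT r -> (forall x, `|r x| <= M) ->
  \int[mT]_x Phi (r x) <= \int[mT]_x Phi (S nu r x) +
    (\int[mT]_x (Phi' (r x) * r x) - \int[mT]_x (Phi' (r x) * S nu r x)).
Proof.
move=> cvx cP cP' mr rM; have Ir : intble mT r := intble_bdd mT mr rM; have tr := trig_S nu Ir.
have [C hC] := continuous_itv_bounded M cP; have [C' hC'] := continuous_itv_bounded M cP'.
have I1 : intble mT (fun x => Phi (r x)).
  apply: (@intble_bdd _ _ _ mT C) => [|x]; first exact: continuous_comp_measurable.
  exact: hC.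
have I2 : intble mT (fun x => Phi (S nu r x)).
  apply: (@intble_bdd _ _ _ mT C) => [|x].
    exact: continuous_comp_measurable cP (trig_measurable tr).
  by apply: hC; exact: S_bounded.
have mP := continuous_comp_measurable cP' mr.
have hP x : `|Phi' (r x)| <= C' by exact: hC'.
have I3 : intble mT (fun x => Phi' (r x) * r x) by exact: intble_bddM mP hP Ir.
have I4 : intble mT (fun x => Phi' (r x) * S nu r x).
  exact: intble_bddM mP hP (trig_intble tr).
have I5 : intble mT (fun x => Phi' (r x) * r x - Phi' (r x) * S nu r x) by exact: intbleB.
rewrite -RintB// -RintD//; apply: le_Rint => //; first exact: intbleD.
apply: aeW => x; have := cvx (S nu r x) (r x).
by rewrite -mulrBr lerBlDl.
Qed.

End convex_smoothing.

(** * Entropy estimate for the mollified density and passage to the limit *)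

Section entropy_decay.
Context {R : realType} {d : nat}.
Variables (T alpha M : R).
Local Notation tau := (time_measure T : {finite_measure set (measurableTypeR R) -> \bar R}).
Local Notation mT := (torus_measure d : probability 'rV[R]_d R).
Local Notation Q := (prodm tau mT).
Local Notation X := (measurableTypeR R * 'rV[R]_d)%type.
Local Notation D i u := ('D_(delta_mx ord0 i) u).
Variables (r : X -> R) (F G : 'I_d -> X -> R) (rho0 : 'rV[R]_d -> R).
Hypotheses (mr : measurable_fun setT r) (rM : forall p, `|r p| <= M)
  (sF : forall i, sqint Q (F i)) (sG : forall i, sqint Q (G i))
  (I0 : intble mT rho0) (rho0_ge : \forall x \ae mT, alpha <= rho0 x).
Hypothesis rG : \forall t \ae tau,
  forall i, wgrad i (fun x => r (t, x)) (fun x => G i (t, x)).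
Hypothesis FG_le0 : \forall t \ae tau,
  \sum_i \int[mT]_x (F i (t, x) * (entropy'' alpha (r (t, x)) * G i (t, x))) <= 0.
Hypothesis weak_eq : forall e, trig e -> forall n b, b < T ->
  \int[tau]_t ((\int[mT]_x (e x * r (t, x))) * - flat (1 + 'X) (n.+1%:R * (b - t)) +
    (\sum_i \int[mT]_x (F i (t, x) * D i e x)) * step n b t) =
  - ((\int[mT]_x (e x * rho0 x)) * step n b 0).

Let mrt t : measurable_fun setT (fun x => r (t, x)).
Proof. exact: measurable_slice_l. Qed.

Let Irt t : intble mT (fun x => r (t, x)).
Proof. exact: (intble_bdd mT (mrt t) (fun x => rM (t, x))). Qed.

Let mfst : measurable_fun [set: X] (fst : X -> measurableTypeR R).
Proof. exact: measurable_fst. Qed.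

Let msnd : measurable_fun [set: X] (snd : X -> 'rV[R]_d).
Proof. exact: measurable_snd. Qed.

Section mollified.
Variable nu : 'I_d -> nat.

Let A0 j := @coef R d nu j rho0.
Let B (j : bas_idx nu) t := \sum_i \int[mT]_x (F i (t, x) * D i (bas j) x).
(* For almost every [t], [v (t, .)] is [S nu] applied to [r (t, .)]; but for every
   [x], [v (., x)] is absolutely continuous. *)
Let v (p : X) := \sum_j primitive T (A0 j) (B j) p.1 * bas j p.2.
Let b (p : X) := \sum_j B j p.1 * bas j p.2.

Let IA j : intble tau (fun t => @coef R d nu j (fun x => r (t, x))).
Proof.
have tj := trig_bas j; have [C hC] := trig_bounded tj.
apply: (@intble_Rint_l _ _ _ _ _ tau mT (fun p : X => bas j p.2 * r p)).
apply: (@intble_bddM _ _ _ Q C (fun p : X => bas j p.2)) => [|p|].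
- exact: (measurableT_comp (trig_measurable tj) msnd).
- exact: hC.
- exact: (intble_bdd Q mr rM).
Qed.

Let IB j : intble tau (B j).
Proof.
apply: intble_sum => i; have tj := trig_derive (delta_mx ord0 i) (trig_bas j).
have [C hC] := trig_bounded tj.
apply: (@intble_Rint_l _ _ _ _ _ tau mT (fun p : X => F i p * D i (bas j) p.2)).
under eq_fun do rewrite mulrC.
apply: (@intble_bddM _ _ _ Q C (fun p : X => D i (bas j) p.2)) => [|p|].
- exact: (measurableT_comp (trig_measurable tj) msnd).
- exact: hC.
- exact: sqint_intble.
Qed.

Let mv : measurable_fun setT v.
Proof.
apply: measurable_sum => j; apply: measurable_funM.
  exact: (measurableT_comp (measurable_primitive T (A0 j) (intble_meas (IB j))) mfst).
exact: (measurableT_comp (trig_measurable (trig_bas j)) msnd).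
Qed.

Let v_bounded : exists C, forall p, `|v p| <= C.
Proof.
have /choice [C hC] j := trig_bounded (@trig_bas R d nu j).
exists (\sum_j (`|A0 j| + \int[tau]_s `|B j s|) * C j) => p.
apply: (le_trans (ler_norm_sum _ _ _)); apply: ler_sum => j _.
by rewrite normrM ler_pM//; exact: primitive_bounded.
Qed.

Let Ib : intble Q b.
Proof.
apply: intble_sum => j; have [C hC] := trig_bounded (@trig_bas R d nu j).
under eq_fun do rewrite mulrC.
apply: (@intble_bddM _ _ _ Q C (fun p : X => bas j p.2)) => [|p|].
- exact: (measurableT_comp (trig_measurable (trig_bas j)) msnd).
- exact: hC.
- exact: intble_fst (IB j).
Qed.

Let Ibx x : intble tau (fun s => b (s, x)).
Proof. by apply: intble_sum => j /=; under eq_fun do rewrite mulrC; exact: intbleZ. Qed.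

Let vE t x : v (t, x) = primitive T (S nu rho0 x) (fun s => b (s, x)) t.
Proof.
rewrite /primitive SE// (@eq_Rint _ _ _ tau _
    (fun s => \sum_j bas j x * (before t s * B j s))); last first.
  move=> s; rewrite /b mulr_sumr; apply: eq_bigr => j _.
  exact: etrans (mulrA _ _ _) (mulrC _ _).
have h j : intble tau (fun s => before t s * B j s) by apply: intble_before.
rewrite Rint_sum => [|j]; last exact: intbleZ.
rewrite -big_split; apply: eq_bigr => j _; rewrite /= RintZ//.
by rewrite /primitive mulrDl (mulrC (bas j x)).
Qed.

(** One null set of times per coefficient, and finitely many coefficients; so the exceptional set
    does not depend on [x]. *)
Lemma mollified_evolution : \forall t \ae tau, forall x,
  v (t, x) = S nu (fun y => r (t, y)) x.
Proof.
have h j : \forall t \ae tau,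
    coef j (fun x => r (t, x)) = primitive T (A0 j) (B j) t.
  apply: du_bois_reymond => // n b' bT.
  exact: (weak_eq (trig_bas j) n bT).
have h' : \forall t \ae tau, forall j,
    coef j (fun x => r (t, x)) = primitive T (A0 j) (B j) t by exact: filter_forall.
apply: filterS h' => t ht x.
by rewrite SE//; apply: eq_bigr => j _; rewrite ht.
Qed.

(** Formally the time derivative of the entropy of [v], as [b] is that of [v]. *)
Definition dissipation_rate s := \int[mT]_x (entropy' alpha (v (s, x)) * b (s, x)).

Let Icomp (p : R -> R) : continuous p -> intble Q (fun q => p (v q)).
Proof.
move=> cp; have [C hC] := v_bounded; have [C' hC'] := continuous_itv_bounded C cp.
apply: (@intble_bdd _ _ _ Q C') => [|q]; last exact: hC'.
exact: measurableT_comp (continuous_measurable_fun cp) mv.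
Qed.

Let cE' : continuous (entropy' alpha).
Proof. exact: C11_continuous (C11_entropy' alpha). Qed.

Let Irate : intble Q (fun q => entropy' alpha (v q) * b q).
Proof.
have [C hC] := v_bounded; have [C' hC'] := continuous_itv_bounded C cE'.
apply: (@intble_bddM _ _ _ Q C') => [|q|]; [|exact: hC'|exact: Ib].
exact: (intble_meas (Icomp cE')).
Qed.

Lemma intble_dissipation_rate : intble tau dissipation_rate.
Proof. exact: (intble_Rint_l Irate). Qed.

Lemma mollified_entropy_le t : 0 <= t ->
  \int[mT]_x entropy alpha (v (t, x)) <=
  \int[tau]_s (before t s * dissipation_rate s).
Proof.
move=> t0.
have Iq : intble Q (fun q => before t q.1 * (entropy' alpha (v q) * b q)).
  by apply: intble_before Irate.
have [C hC] := v_bounded.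
have cE : continuous (entropy alpha) by exact: entropy_continuous.
have [C' hC'] := continuous_itv_bounded C cE.
have I1 : intble mT (fun x => entropy alpha (v (t, x))).
  apply: (@intble_bdd _ _ _ mT C') => [|x]; last exact: hC'.
  exact: (measurable_slice_l t (intble_meas (Icomp cE))).
apply: (@le_trans _ _ (\int[mT]_x \int[tau]_s (before t s * (entropy' alpha (v (s, x)) * b (s, x))))).
  apply: le_Rint => //; first exact: (intble_Rint_r Iq).
  apply: aeW => x.
  have := chain_le (@entropy_convex R alpha) cE' (S nu rho0 x) (Ibx x) t0.
  (* Averages against a probability density keep the lower bound [alpha], so the mollified initial
     datum has zero entropy. *)
  have -> : entropy alpha (S nu rho0 x) = 0.
    by apply: entropy0; have := S_le nu x (intble_cst mT alpha) I0 rho0_ge; rewrite S_cst.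
  rewrite -vE subr0.
  move=> h; apply: (le_trans h); rewrite le_eqVlt; apply/orP; left; apply/eqP.
  by apply: eq_Rint => s; rewrite -vE.
rewrite -(Rint_swap Iq) le_eqVlt; apply/orP; left; apply/eqP.
apply: ae_eq_Rint.
- exact: (measurable_Rint_l mT (intble_meas Iq)).
- by apply: measurable_funM; [exact: measurable_before|exact: intble_meas intble_dissipation_rate].
apply: filterS (ae_intble_l Irate) => s Is.
by rewrite -RintZ.
Qed.

Lemma dissipation_rateE : \forall s \ae tau,
  dissipation_rate s = \sum_i \int[mT]_x (S nu (fun y => F i (s, y)) x *
    (entropy'' alpha (S nu (fun y => r (s, y)) x) * S nu (fun y => G i (s, y)) x)).
Proof.
have hF : \forall s \ae tau, forall i, intble mT (fun x => F i (s, x)).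
  by apply: filter_forall => i; apply: ae_intble_l; exact: sqint_intble.
have hG : \forall s \ae tau, forall i, intble mT (fun x => G i (s, x)).
  by apply: filter_forall => i; apply: ae_intble_l; exact: sqint_intble.
have hFG : \forall s \ae tau, (forall i, intble mT (fun x => F i (s, x))) /\
  (forall i, intble mT (fun x => G i (s, x))) by apply: filterS2 hF hG.
apply: filterS3 mollified_evolution hFG rG => s hv [IF IG] grad_s.
rewrite -(dissipationE (C11_entropy' alpha) nu IF (Irt s) IG grad_s).
by apply: eq_Rint => x; rewrite hv.
Qed.

End mollified.

Let ae_slice_sqint (H : 'I_d -> X -> R) : (forall i, sqint Q (H i)) ->
  \forall s \ae tau, forall i, sqint mT (fun x => H i (s, x)).
Proof.
move=> sH; apply: filter_forall => i; have [mH IH] := sH i.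
apply: filterS (ae_intble_l IH) => s Is; split=> //.
exact: measurable_slice_l.
Qed.

Lemma entropy_ae_le0 : \forall t \ae tau, \int[mT]_x entropy alpha (r (t, x)) <= 0.
Proof.
have C11e := C11_entropy' alpha.
have cE' := C11_continuous C11e; have cE'' := C11_continuous' C11e.
have cE : continuous (entropy alpha) by exact: entropy_continuous.
have [C hC] := continuous_itv_bounded M cE''.
pose N n : 'I_d -> nat := fun=> n.
pose k s := \sum_i \int[mT]_x (F i (s, x) * (entropy'' alpha (r (s, x)) * G i (s, x))).
pose g s := C * \sum_i (\int[mT]_x (F i (s, x) ^+ 2) + \int[mT]_x (G i (s, x) ^+ 2)).
have Ig : intble tau g.
  apply: intbleZ; apply: intble_sum => i.
  apply: intbleD.
    by apply: (@intble_Rint_l _ _ _ _ _ tau mT (fun p => F i p ^+ 2)); case: (sF i).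
  by apply: (@intble_Rint_l _ _ _ _ _ tau mT (fun p => G i p ^+ 2)); case: (sG i).
have Ik : intble tau k.
  apply: intble_sum => i.
  apply: (@intble_Rint_l _ _ _ _ _ tau mT (fun p => F i p * (entropy'' alpha (r p) * G i p))).
  apply: sqintM => //; apply: (@sqint_bddM _ _ _ Q C) => // [|p]; last exact: hC.
  exact: measurableT_comp (continuous_measurable_fun cE'') mr.
have mk : measurable_fun [set: measurableTypeR R] k := intble_meas Ik.
have sFG : \forall s \ae tau, (forall i, sqint mT (fun x => F i (s, x))) /\
  (forall i, sqint mT (fun x => G i (s, x))).
  by apply: filterS2 (ae_slice_sqint sF) (ae_slice_sqint sG).
have rates : \forall s \ae tau, forall n, dissipation_rate (N n) s =
    \sum_i \int[mT]_x (S (N n) (fun y => F i (s, y)) x *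
    (entropy'' alpha (S (N n) (fun y => r (s, y)) x) * S (N n) (fun y => G i (s, y)) x)).
  by apply/ae_foralln => n; exact: dissipation_rateE.
(* Countably many exponents share one null set of times, so that [n] can tend to infinity at a fixed
   [t]. *)
have evol : \forall t \ae tau, forall n, \int[mT]_x entropy alpha (S (N n) (fun y => r (t, y)) x) <=
    \int[tau]_s (before t s * dissipation_rate (N n) s).
  apply/ae_foralln => n.
  apply: filterS2 (mollified_evolution (N n)) (time_ae_itv T) => t ht /andP[t0 _].
  apply: le_trans (mollified_entropy_le (N n) (ltW t0)).
  rewrite le_eqVlt; apply/orP; left; apply/eqP; apply: eq_Rint => x.
  by rewrite ht.
apply: filterS evol => t ht.
have lim1 : \int[tau]_s (before t s * dissipation_rate (N n) s) @[n --> \oo] -->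
    \int[tau]_s (before t s * k s).
  apply: (@Rint_DCT _ _ _ tau _ _ g).
  - by move=> n; apply: measurable_funM; [exact: measurable_before|exact: intble_meas (intble_dissipation_rate (N n))].
  - by apply: measurable_funM => //; exact: measurable_before.
  - exact: Ig.
  - apply: filterS2 rates sFG => s hs [sFs sGs].
    apply: cvgM; first exact: cvg_cst.
    under eq_fun do rewrite hs.
    exact: (dissipation_cvg C11e (mrt s) (fun x => rM (s, x)) sFs sGs).
  - move=> n; apply: filterS2 rates sFG => s hs [sFs sGs].
    rewrite normrM hs; apply: (@le_trans _ _ (1 * g s)); last by rewrite mul1r.
    apply: ler_pM => //; first exact: before_le1.
    exact: (dissipation_bound C11e (N n) (mrt s) (fun x => rM (s, x)) sFs sGs hC).
have sr : sqint mT (fun x => r (t, x)) by exact: (sqint_bdd mT (mrt t) (fun x => rM (t, x))).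
have sE : sqint mT (fun x => entropy' alpha (r (t, x))).
  have [C' hC'] := continuous_itv_bounded M cE'.
  apply: (@sqint_bdd _ _ _ mT C') => [|x]; last exact: hC'.
  exact: continuous_comp_measurable cE' (mrt t).
have lim2 := S_pair_cvg (nu := N) (fun n i => leqnn n) sr sE.
pose I1 := \int[mT]_x (entropy' alpha (r (t, x)) * r (t, x)).
have lim3 : \int[tau]_s (before t s * dissipation_rate (N n) s) +
    (I1 - \int[mT]_x (entropy' alpha (r (t, x)) * S (N n) (fun y => r (t, y)) x)) @[n --> \oo] -->
    \int[tau]_s (before t s * k s) + (I1 - I1).
  by apply: cvgD => //; apply: cvgB => //; exact: cvg_cst.
have le0 : \int[tau]_s (before t s * k s) <= 0.
  rewrite -[leRHS](Rintegral0 tau); apply: le_Rint.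
  - by apply: intble_before.
  - exact: intble_cst.
  - apply: filterS FG_le0 => s; apply: mulr_ge0_le0; exact: before_ge0.
apply: le_trans le0; rewrite -[leRHS]addr0 -(subrr I1) -(cvg_lim _ lim3)//.
apply: limr_ge; first by apply/cvg_ex; eexists; exact: lim3.
apply: nearW => n.
apply: (le_trans (convex_smoothing (N n) (@entropy_convex R alpha) cE cE' (mrt t) (fun x => rM (t, x)))).
by rewrite lerD2r.
Qed.

Lemma entropy_method : \forall p \ae Q, alpha <= r p.
Proof.
have cE : continuous (entropy alpha) by exact: entropy_continuous.
have : \forall p \ae Q, 0 <= r p - alpha.
  apply: product_ae; first exact: measurable_funB.
  apply: filterS entropy_ae_le0 => t ht.
  have [C hC] := continuous_itv_bounded M cE.
  have h : \forall x \ae mT, entropy alpha (r (t, x)) = 0.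
    apply: ge0_Rint_eq0 => //.
      apply: (@intble_bdd _ _ _ mT C) => [|x]; last exact: hC.
      exact: continuous_comp_measurable cE (mrt t).
    by apply: aeW => x; exact: entropy_ge0.
  by apply: filterS h => x hx; rewrite subr_ge0 entropy_le0// hx.
by apply: filterS => p; rewrite subr_ge0.
Qed.

End entropy_decay.

(** * Application to weak solutions *)

Section Lfun_facts.
Context d (X : measurableType d) (R : realType) (mu : {finite_measure set X -> \bar R}).

Lemma Lfun_measurable (p : \bar R) (f : X -> R) : f \in Lfun mu p -> measurable_fun setT f.
Proof. by move=> /andP[]; rewrite inE. Qed.

Lemma Lfun2_sqint (f : X -> R) : f \in Lfun mu 2%:E -> sqint mu f.
Proof.
move=> Lf; split; first exact: Lfun_measurable Lf.
exact: Lfun2_integrable_sqr Lf.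
Qed.

(** The norm at [+oo] is defined by cases on the total mass, hence the positivity hypothesis. *)
Lemma Lnormy_ae_le (f : X -> R) (a : R) : (0 < mu setT)%E ->
  (Lnorm mu +oo (EFin \o f) <= a%:E)%E -> \forall x \ae mu, `|f x| <= a.
Proof.
move=> mu0; rewrite unlock /Lnorm mu0 => /ess_supP.
by apply: filterS => x /=; rewrite lee_fin.
Qed.

Lemma Lfuny_intble (f : X -> R) : f \in Lfun mu +oo%E -> intble mu f.
Proof.
move=> Lf; apply/Lfun1_integrable; move: Lf; apply: Lfun_subset; rewrite ?lexx ?leey//; exact: fin_num_measure.
Qed.

End Lfun_facts.

(** * Weak solutions at a fixed time *)

Section slices.
Context {R : realType} {d : nat}.
Local Notation mT := (torus_measure d : probability 'rV[R]_d R).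
Local Notation D i u := ('D_(delta_mx ord0 i) u).

Lemma torus_gt0 : (0 < mT setT)%E.
Proof. by rewrite (_ : mT setT = 1%E) ?lte01//; exact: probability_setT. Qed.

Lemma gradE (u : 'rV[R]_d -> R) x i : grad u x ord0 i = D i u x.
Proof. by rewrite mxE. Qed.

Lemma TV_ge (rho : 'rV[R]_d -> R) z : torus_vsmooth z -> (forall x, enorm (z x) <= 1) ->
  ((\int[mT]_x (- (rho x * div z x)))%:E <= TV rho)%E.
Proof. by move=> sz z1; apply: ereal_sup_ubound; exists z. Qed.

Lemma TV_ge0 (rho : 'rV[R]_d -> R) : (0 <= TV rho)%E.
Proof.
apply: (le_trans _ (@TV_ge rho (fun=> 0) _ _)).
- rewrite lee_fin (@eq_Rint _ _ _ mT _ (fun=> 0)) ?Rintegral0// => x.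
  rewrite /div big1 ?mulr0 ?oppr0// => i _.
  rewrite (_ : (fun=> _) = (fun=> 0 : R)); first exact: derive_cst.
  by apply/funext => y; rewrite mxE.
- move=> i; split => [k|x j]; last by rewrite !mxE.
  rewrite (_ : (fun=> _) = (fun=> 0 : R)); first exact: Ck_cst.
  by apply/funext => y; rewrite mxE.
- move=> x; rewrite /enorm /dot big1 ?sqrtr0// => i _.
  by rewrite mxE mul0r.
Qed.

Lemma H1_grad_wgrad (g : 'rV[R]_d -> R) G i : H1_grad g G -> wgrad i g (fun x => G x ord0 i).
Proof.
move=> [_ _ h] u tu; rewrite -h; last exact: trig_smooth.
by apply: eq_Rint => x; rewrite gradE.
Qed.

Lemma ae_sqint (f f' : 'rV[R]_d -> R) : measurable_fun setT f' ->
  (\forall x \ae mT, f x = f' x) -> sqint mT f -> sqint mT f'.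
Proof.
move=> mf' ff' [mf If]; split=> //; move/integrableP: If => [m2 If].
have m2' : measurable_fun setT (EFin \o (fun x => f' x ^+ 2)).
  by apply/measurable_EFinP; exact: measurable_funX.
apply/integrableP; split => //.
rewrite (ae_eq_integral (abse \o (EFin \o (fun x => f x ^+ 2))))//.
- exact: measurableT_comp.
- exact: measurableT_comp.
- by apply: filterS ff' => x e _ /=; rewrite e.
Qed.

Lemma ae_wgrad i (f f' g : 'rV[R]_d -> R) : measurable_fun setT f -> measurable_fun setT f' ->
  (\forall x \ae mT, f x = f' x) -> wgrad i f g -> wgrad i f' g.
Proof.
move=> mf mf' ff' h u tu; rewrite -h//.
have mu := trig_measurable (trig_derive (delta_mx ord0 i) tu).
apply: ae_eq_Rint; [exact: measurable_funM|exact: measurable_funM|].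
by apply: filterS ff' => x ->.
Qed.

Lemma is_derive_inv_shift (c s : R) : c < s ->
  is_derive s 1 (fun t : R => (t - c)^-1) (- (s - c) ^- 2).
Proof.
move=> cs; have sc : s - c != 0 by rewrite subr_eq0 gt_eqF.
have dsub : is_derive s 1 (fun t : R => t - c) 1.
  have h : is_derive s 1 (fun t : R => t - c) _ := is_deriveB (is_derive_id s 1) (is_derive_cst c s 1).
  by apply: (is_derive_eq h); rewrite subr0.
have dV : is_derive (s - c) 1 (fun t : R => t^-1) (- (s - c) ^- 2).
  split; first exact: (@derivableV _ _ id).
  by rewrite (@deriveV _ _ id)// derive_id /GRing.scale /= mulr1.
have h := @is_derive1_comp _ (fun t : R => t^-1) (fun t : R => t - c) s _ _ dV dsub.
by apply: (is_derive_eq h); rewrite mulr1.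
Qed.

Lemma potential'E (c s : R) : c < s -> potential' c s = - (s - c) ^- 2.
Proof.
move=> cs; rewrite /potential' derive1E.
have e : \forall t \near s, (t - c)^-1 = (fine \o potential c) t.
  near=> t; rewrite /= /potential (_ : c < t)//; near: t; exact: lt_nbhsr.
by have [_ ->] := near_eq_is_derive e (is_derive_inv_shift cs).
Unshelve. all: by end_near. Qed.

Lemma potential'_homo (c a b : R) : c < a -> a <= b -> potential' c a <= potential' c b.
Proof.
move=> ca ab; have cb := lt_le_trans ca ab.
rewrite !potential'E// lerN2 lef_pV2 ?posrE ?exprn_gt0 ?subr_gt0//.
by rewrite lerXn2r ?nnegrE ?subr_ge0 ?(ltW ca) ?(ltW cb)// lerD2r.
Qed.

(** Transfers the hypotheses from [rho] to an almost everywhere equal [r] that obeys the bounds at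
    every point, as [static_ineq] demands. *)
Lemma static_slice (c M eps : R) (p p' : R -> R) (rho r h : 'rV[R]_d -> R) z G W :
  0 <= c -> 0 < eps -> measurable_fun setT r -> (forall x, c < r x <= M) ->
  (\forall x \ae mT, rho x = r x) ->
  calA rho z -> Hdiv_div z h -> H1_grad rho G ->
  H1_grad (fun x => h x - eps * potential' c (rho x)) W ->
  C11 p p' -> (forall a b, c < a -> a <= b -> p a <= p b) ->
  (forall a, c < a -> 0 <= p' a) ->
  \sum_i \int[mT]_x (W x ord0 i * (p' (r x) * G x ord0 i)) <= 0.
Proof.
move=> c0 e0 mr rM rhor [BVr Lr zle [k zk TVk]] zh rhoG hW pp' hp hp'.
have [Lz Lh divh] := zh; have [_ Lk divk] := zk.
have mrho := Lfun_measurable Lr.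
have sz i := Lfun2_sqint (Lz i); have sh := Lfun2_sqint Lh; have sk := Lfun2_sqint Lk.
have [_ LG _] := rhoG; have sG i := Lfun2_sqint (LG i).
have [LP LW _] := hW; have sW i := Lfun2_sqint (LW i); have sP := Lfun2_sqint LP.
have gG i : wgrad i r (fun x => G x ord0 i).
  exact: ae_wgrad mrho mr rhor (H1_grad_wgrad i rhoG).
have rb x : `|r x| <= `|c| + `|M|.
  have /andP[h1 h2] := rM x; have := ler_norm M; have := ler_norm c.
  have := ler_norm (- c); have := ler_norm (- M); rewrite !normrN.
  by move=> *; rewrite ler_norml; apply/andP; split; lra.
have sr : sqint mT r := sqint_bdd mT mr rb.
have tdiv (f : 'rV[R]_d -> R) : (forall phi, torus_smooth phi ->
    \int[mT]_x dot (z x) (grad phi x) = - \int[mT]_x (f x * phi x)) ->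
    forall u, trig u -> \int[mT]_x dot (z x) (grad u x) = - \int[mT]_x (f x * u x).
  by move=> hf u tu; apply: hf; exact: trig_smooth.
(* [calA] provides some weak divergence [k], a priori another function than [h]; their pairings with
   [r] agree, and the total variation bound involves nothing else. *)
have hk : \int[mT]_x (h x * r x) = \int[mT]_x (k x * r x).
  by rewrite (Rint_grad sr sG gG sz sh (tdiv _ divh)) (Rint_grad sr sG gG sz sk (tdiv _ divk)).
have mpot : measurable_fun setT (fun x => potential' c (r x)).
  (* For [r x > c] the inverse square is an exponential of a logarithm, which reduces measurability
     to known functions. *)
  rewrite (_ : (fun x => _) = (fun x => - expR (- ln ((r x - c) ^+ 2)))); last first.
    apply/funext => x; have /andP[cr _] := rM x.
    by rewrite potential'E// expRN lnK// posrE exprn_gt0// subr_gt0.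
  apply: measurableT_comp => //; apply: measurableT_comp; first exact: measurable_expR.
  apply: measurableT_comp => //; apply: measurableT_comp; first exact: measurable_ln.
  by apply: measurable_funX; exact: measurable_funB.
have Pr : \forall x \ae mT, h x - eps * potential' c (rho x) = h x - eps * potential' c (r x).
  by apply: filterS rhor => x ->.
have mPr : measurable_fun setT (fun x => h x - eps * potential' c (r x)).
  apply: measurable_funB; first exact: sqint_meas sh.
  by apply: measurable_funM => //; exact: measurable_cst.
apply: (@static_ineq R d c M eps (potential' c) p p' r h z G W) => //.
- have z1 := Lnormy_ae_le torus_gt0 zle.
  by apply: filterS z1 => x; apply: le_trans; exact: ler_norm.
- exact: tdiv.
- move=> V tV V1.
  rewrite (@eq_Rint _ _ _ mT (fun x => r x * h x) (fun x => h x * r x)); last by move=> x; exact: mulrC.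
  have mk := sqint_meas sk.
  have mdiv : measurable_fun setT (div V).
    apply: measurable_sum => i.
    exact: trig_measurable (trig_derive (delta_mx ord0 i) (tV i)).
  have e1 : \int[mT]_x (- (r x * div V x)) = \int[mT]_x (- (rho x * div V x)).
    apply: ae_eq_Rint; [by apply: measurableT_comp => //; exact: measurable_funM..|].
    by apply: filterS rhor => x ->.
  have e2 : \int[mT]_x (k x * r x) = \int[mT]_x (rho x * k x).
    apply: ae_eq_Rint; [exact: measurable_funM|exact: measurable_funM|].
    by apply: filterS rhor => x ->; exact: mulrC.
  rewrite hk e1 e2 -lee_fin; apply: le_trans TVk; apply: TV_ge => // i.
  exact: trig_smooth (tV i).
- exact: ae_sqint mPr Pr sP.
- by move=> i; apply: ae_wgrad (H1_grad_wgrad i hW) => //; exact: sqint_meas sP.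
- exact: potential'_homo.
Qed.

End slices.

(** * Test functions with separated variables *)

Section test_functions.
Context {R : realType} {d : nat}.
Local Notation D i u := ('D_(delta_mx ord0 i) u).

Lemma test_step (T b : R) n (e : 'rV[R]_d -> R) : trig e -> b < T ->
  test_function T (fun p : R * 'rV[R]_d => step n b p.1 * e p.2).
Proof.
move=> te bT; have [se pe] := trig_smooth te; split.
- move=> k; apply: (@CkM _ _ k (fun p : R * 'rV[R]_d => step n b p.1) (fun p => e p.2)).
    apply: (@Ck_comp_linear _ _ _ k (fst : R * 'rV[R]_d -> R) (step n b)) => //.
      by move=> p; exact: cvg_fst.
    exact: smooth_step.
  apply: (@Ck_comp_linear _ _ _ k (snd : R * 'rV[R]_d -> 'rV[R]_d) e) => //.
  by move=> p; exact: cvg_snd.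
- by move=> t x i; rewrite /slice /= pe.
- by exists b => // t x bt; rewrite /= step_eq0// mul0r.
Qed.

Lemma derive1_step n (b t : R) (a : R) :
  derive1 (fun s => step n b s * a) t = a * - flat (1 + 'X) (n.+1%:R * (b - t)).
Proof.
rewrite derive1E.
have h : is_derive t 1 (fun s => step n b s * a) _ :=
  is_deriveM (is_derive_step n b t) (is_derive_cst a t 1).
have [_ ->] := h.
by rewrite scaler0 add0r.
Qed.

Lemma dot_gradZ a (e : 'rV[R]_d -> R) (w x : 'rV[R]_d) : trig e ->
  dot w (grad (fun y => a * e y) x) = (\sum_i w ord0 i * D i e x) * a.
Proof.
move=> te; rewrite /dot mulr_suml; apply: eq_bigr => i _.
rewrite gradE -mulrA; congr (_ * _).
rewrite [RHS]mulrC; exact: (deriveZ a (trig_derivable te)).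
Qed.

End test_functions.

Theorem theorem3p1 (R : realType) (d : nat) (d_gt0 : (0 < d)%N)
    (c T eps : R) (c_gt0 : 0 < c) (T_gt0 : 0 < T) (eps_gt0 : 0 < eps)
    (rho0 : 'rV[R]_d -> R)
    (rho : R * 'rV[R]_d -> R) (z : R * 'rV[R]_d -> 'rV[R]_d)
    (rho0_prob : prob_density rho0)
    (rho0_bounded : rho0 \in Lfun (torus_measure d) +oo%E)
    (rho_z_sol : weak_solution c T eps rho0 rho z)
    (rho_reg : L2H1 T rho) (z_reg : L2H2div T z)
    (alpha : R) (alpha_gtc : c < alpha) :
  (\forall x \ae torus_measure d, alpha <= rho0 x) ->
  \forall p \ae (time_measure T \x torus_measure d)%E, alpha <= rho p.
Proof.
move=> rho0_ge.
pose tau : {finite_measure set (measurableTypeR R) -> \bar R} := time_measure T.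
pose mT : probability 'rV[R]_d R := torus_measure d.
pose Q := prodm tau mT.
have fQ : Filter (almost_everywhere (time_measure T \x torus_measure d)%E) :=
  ae_filter_ringOfSetsType Q.
have ft : Filter (almost_everywhere (time_measure T)) := ae_filter_ringOfSetsType tau.
have [G [Lrho LG rhoG]] := rho_reg.
have [h [w [[mrho [M0 bnd]] _ gtc _ calAz divz [LP Lw Pw] eqn]]] := rho_z_sol.
(* The second term guarantees [c < M], so that [M] itself is an admissible value for [r]. *)
pose M := Num.max M0 (c + 1).
have cM : c < M by rewrite lt_max ltrDl ltr01 orbT.
(* [r] agrees with [rho] almost everywhere and takes its values in [c < s <= M]
   everywhere. *)
pose r (p : measurableTypeR R * 'rV[R]_d) := if (c < rho p) && (rho p <= M) then rho p else M.
have rM p : c < r p <= M.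
  by rewrite /r; case: ifP => [/andP[-> ->]|_] //; rewrite cM lexx.
have mr : measurable_fun setT r.
  apply: measurable_fun_ifT => //.
  by apply: measurable_and; [exact: measurable_fun_ltr|exact: measurable_fun_ler].
have rb p : `|r p| <= M.
  have /andP[h1 h2] := rM p; rewrite ger0_norm//.
  exact: ltW (lt_trans c_gt0 h1).
(* The bound [M0] concerns a sum of three nonnegative terms, so it bounds the essential supremum
   alone. *)
have rho_r : \forall t \ae time_measure T, \forall x \ae mT, rho (t, x) = r (t, x).
  have gtc' := @ae_product _ _ _ _ _ tau mT _ gtc.
  apply: filterS2 bnd gtc' => t [_ bt] ct.
  have bt' : (Lnorm mT +oo (EFin \o slice rho t) <= M0%:E)%E.
    apply: le_trans bt; rewrite leeDr// adde_ge0//; first exact: Lnorm_ge0.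
    exact: TV_ge0.
  apply: filterS2 (Lnormy_ae_le torus_gt0 bt') ct => x rx cx.
  by rewrite /r cx (le_trans (ler_norm _) (le_trans rx _))// /M le_max lexx.
have sw i : sqint Q (fun p => w p ord0 i) by exact: (@Lfun2_sqint _ _ _ Q _ (Lw i)).
have sG i : sqint Q (fun p => G p ord0 i) by exact: (@Lfun2_sqint _ _ _ Q _ (LG i)).
have sF i : sqint Q (fun p => r p * w p ord0 i) by exact: sqint_bddM mr rb (sw i).
have mslice t : measurable_fun setT (fun x => r (t, x)) by exact: measurable_slice_l.
have mrhos t : measurable_fun setT (fun x => rho (t, x)) by exact: measurable_slice_l mrho.
have ar : \forall p \ae Q, alpha <= r p.
  apply: (@entropy_method _ _ T alpha M r (fun i p => r p * w p ord0 i)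
    (fun i p => G p ord0 i) rho0 mr rb sF sG _ rho0_ge).
  - exact: Lfuny_intble rho0_bounded.
  - apply: filterS2 rho_r rhoG => t rt Gt i.
    exact: ae_wgrad (mrhos t) (mslice t) rt (H1_grad_wgrad i Gt).
  - have calP : \forall t \ae time_measure T, calA (slice rho t) (slice z t) /\
      Hdiv_div (slice z t) (slice h t) by apply: filterS2 calAz divz.
    have gradP : \forall t \ae time_measure T, H1_grad (slice rho t) (slice G t) /\
      H1_grad (slice (fun p => h p - eps * potential' c (rho p)) t) (slice w t).
      by apply: filterS2 rhoG Pw.
    apply: filterS3 rho_r calP gradP => t rt [At zt] [Gt Pt].
    have st := static_slice (ltW c_gt0) eps_gt0 (mslice t) (fun x => rM (t, x)) rt At zt Gt Pt
      (C11_flux alpha).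
    apply: le_trans (st _ _).
    (* The density factor of the flux [r w] moves over to the gradient, where it turns [entropy'']
       into [flux']. *)
    + apply: ler_sum => i _; rewrite le_eqVlt; apply/orP; left; apply/eqP.
      apply: eq_Rint => x; rewrite /flux' /entropy'' /slice /=.
      ring.
    + move=> a b ca ab; apply: flux_homo => //; exact: ltW (lt_trans c_gt0 ca).
    + by move=> a ca; apply: flux'_ge0; exact: ltW (lt_trans c_gt0 ca).
  - move=> e te n b bT.
    have := eqn _ (@test_step R d T b n e te bT).
    have mu : measurable_fun setT e := trig_measurable te.
    have tD i := trig_derive (delta_mx ord0 i) te.
    have -> : \int[mT]_x (rho0 x * (step n b 0 * e x)) =
        (\int[mT]_x (e x * rho0 x)) * step n b 0.
      rewrite mulrC -RintZ; first by apply: eq_Rint => x; rewrite mulrC mulrA.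
      exact: trig_intbleM te (Lfuny_intble rho0_bounded).
    move=> <-.
    have mfl := measurable_flat1X n b; have mst := measurable_step n b.
    have Dw (x : 'rV[R]_d) t : dot (w (t, x)) (grad (slice (fun p => step n b p.1 * e p.2) t) x) =
        (\sum_i w (t, x) ord0 i * 'D_(delta_mx ord0 i) e x) * step n b t.
      exact: (@dot_gradZ R d (step n b t) e (w (t, x)) x te).
    have D1 (x : 'rV[R]_d) t : derive1 (fun s : R => step n b (s, x).1 * e (s, x).2) t =
        e x * - flat (1 + 'X) (n.+1%:R * (b - t)) := derive1_step n b t (e x).
    (* The weak equation concerns [rho], the entropy argument [r]; the integrands agree for almost
       every [t], once both are shown measurable. *)
    apply: ae_eq_Rint.
    + apply: measurable_funD; apply: measurable_funM => //.
      * apply: (@measurable_Rint_l _ _ _ _ _ mT (fun p => e p.2 * r p)).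
        by apply: measurable_funM => //; exact: measurableT_comp mu measurable_snd.
      * by apply: measurableT_comp.
      * apply: measurable_sum => i.
        apply: (@measurable_Rint_l _ _ _ _ _ mT
          (fun p => r p * w p ord0 i * 'D_(delta_mx ord0 i) e p.2)).
        apply: measurable_funM; first exact: sqint_meas (sF i).
        exact: measurableT_comp (trig_measurable (tD i)) measurable_snd.
    + rewrite (_ : (fun t => \int[mT]_x _) = (fun t => \int[mT]_x (rho (t, x) *
        (e x * - flat (1 + 'X) (n.+1%:R * (b - t))) + rho (t, x) *
        ((\sum_i w (t, x) ord0 i * 'D_(delta_mx ord0 i) e x) * step n b t)))); last first.
        by apply/funext => t; apply: eq_Rint => x; rewrite D1 Dw.
      apply: (@measurable_Rint_l _ _ _ _ _ mT (fun p => rho p *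
        (e p.2 * - flat (1 + 'X) (n.+1%:R * (b - p.1))) + rho p *
        ((\sum_i w p ord0 i * 'D_(delta_mx ord0 i) e p.2) * step n b p.1))).
      apply: measurable_funD; apply: measurable_funM => //; apply: measurable_funM.
      * exact: measurableT_comp mu measurable_snd.
      * by apply: measurableT_comp => //; exact: measurableT_comp mfl measurable_fst.
      * apply: measurable_sum => i; apply: measurable_funM; first exact: sqint_meas (sw i).
        exact: measurableT_comp (trig_measurable (tD i)) measurable_snd.
      * exact: measurableT_comp mst measurable_fst.
    have IF : \forall t \ae time_measure T, forall i, intble mT (fun x => r (t, x) * w (t, x) ord0 i).
      by apply: filter_forall => i; apply: (@ae_intble_l _ _ _ _ _ tau mT (fun p => r p * w p ord0 i)); exact: sqint_intble.
    have wm t i : measurable_fun setT (fun x => w (t, x) ord0 i).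
      exact: (measurable_slice_l t (sqint_meas (sw i))).
    apply: filterS2 rho_r IF => t rt It.
    have I1 : intble mT (fun x => e x * r (t, x)).
      apply: trig_intbleM => //; exact: (intble_bdd mT (mslice t) (fun x => rb (t, x))).
    have I2 i : intble mT (fun x => r (t, x) * w (t, x) ord0 i * 'D_(delta_mx ord0 i) e x).
      by under eq_fun do rewrite mulrC; exact: trig_intbleM.
    have RE (a a' : R) : (\int[mT]_x (e x * r (t, x))) * a +
        (\sum_i \int[mT]_x (r (t, x) * w (t, x) ord0 i * 'D_(delta_mx ord0 i) e x)) * a' =
        \int[mT]_x (a * (e x * r (t, x)) +
          a' * \sum_i (r (t, x) * w (t, x) ord0 i * 'D_(delta_mx ord0 i) e x)).
      rewrite RintD; [|exact: intbleZ|apply: intbleZ; exact: intble_sum].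
      rewrite RintZ// RintZ; last exact: intble_sum.
      by rewrite Rint_sum// mulrC (mulrC a').
    apply: (etrans (RE _ _)); apply: ae_eq_Rint.
    + apply: measurable_funD; apply: measurable_funM => //; first exact: measurable_funM.
      by apply: measurable_sum => i; exact: intble_meas (I2 i).
    + rewrite (_ : (fun x => _) = (fun x => rho (t, x) *
        (e x * - flat (1 + 'X) (n.+1%:R * (b - t))) + rho (t, x) *
        ((\sum_i w (t, x) ord0 i * 'D_(delta_mx ord0 i) e x) * step n b t))); last first.
        by apply/funext => x; rewrite D1 Dw.
      apply: measurable_funD; apply: measurable_funM => //; apply: measurable_funM => //.
      by apply: measurable_sum => i; apply: measurable_funM => //; exact: trig_measurable.
    apply: filterS rt => x ->; rewrite D1 Dw.
    congr (_ + _); first by rewrite mulrC [RHS]mulrA (mulrC (e x)).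
    rewrite [RHS]mulrA [RHS]mulrC; congr (_ * _); rewrite mulr_sumr.
    by apply: eq_bigr => i _; rewrite mulrA.
(* Equality is phrased as a sign condition so that [product_ae] lifts it from slices to the
   product. *)
have rQ : \forall p \ae Q, 0 <= - `|rho p - r p|.
  apply: product_ae.
    by apply: measurableT_comp => //; apply: measurableT_comp => //; exact: measurable_funB.
  by apply: filterS rho_r => t; apply: filterS => x ->; rewrite subrr normr0 oppr0.
apply: filterS2 ar rQ => p ap; rewrite oppr_ge0 normr_le0 subr_eq0 => /eqP ->.
exact: ap.
Qed.
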